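(* Let $p>0$ and let $(\mathscr A,\mathscr H,D)$ be a $p$-summable spectral triple. Let $\alpha\in[0,1]$ and $\beta,\gamma\in[0,1]$ be such that either $\beta+\gamma<\alpha+1$, or $\beta+\gamma=\alpha+1$ with $\max(\beta,\gamma)<1$. Let $\mathscr L(\mathscr H)$ denote the bounded operators on $\mathscr H$. (i) There is a bounded linear operator $\Phi^\alpha_{\beta,\gamma}:\mathscr L(\mathscr H)\to\mathscr L(\mathscr H)$ such that, for all $a\in\mathscr A$, $$\big[|D|^{-\alpha},a\big]=|D|^{-\beta}\Phi^\alpha_{\beta,\gamma}([D,a])|D|^{-\gamma}+|D|^{-(\alpha+1)}F[D,a]\Pi_0+\Pi_0[D,a]F|D|^{-(\alpha+1)},$$ where $F=D|D|^{-1}$ is the sign of $D$ and $\Pi_0$ is the orthogonal projection onto $\ker D$. (ii) Suppose that $\beta+\gamma<\alpha+1$. If $\max(\beta,\gamma)<1$, then the operator $\Phi^\alpha_{\beta,\gamma}$ gives rise to a continuous linear operator $$\Phi^\alpha_{\beta,\gamma}:\mathscr L(\mathscr H)\to\mathscr L_{r,\infty},\qquad r=(1+\alpha-\beta-\gamma)^{-1}p.$$ If $\max(\beta,\gamma)=1$, then this result holds for any $r>(1+\alpha-\beta-\gamma)^{-1}p$. In both cases the range of $\Phi^\alpha_{\beta,\gamma}$ is contained in the ideal of compact operators.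
   Context: A spectral triple $(\mathscr A,\mathscr H,D)$ consists of a unital $*$-algebra $\mathscr A$ represented by bounded operators on a separable Hilbert space $\mathscr H$ (elements are identified with the operators representing them) and an unbounded selfadjoint operator $D$ on $\mathscr H$ with compact resolvent such that $a(\mathrm{dom}\,D)\subseteq \mathrm{dom}\,D$ and $[D,a]$ is bounded for all $a\in\mathscr A$. For a compact operator $T$, $\mu_0(T)\ge\mu_1(T)\ge\cdots$ are its singular values; for $r>0$, $\mathscr L_{r,\infty}$ is the space of compact $T$ with $\|T\|_{r,\infty}=\sup_{j\ge0}(j+1)^{1/r}\mu_j(T)<\infty$, a quasi-Banach space for this quasi-norm. The triple is $p$-summable if the partial inverse $D^{-1}$ (zero on $\ker D$) lies in $\mathscr L_{p,\infty}$. For $q\ge0$, $|D|^{-q}$ is defined by Borel functional calculus with the convention $|D|^{-q}=0$ on $\ker D$; in particular $|D|^0=1-\Pi_0$. Likewise $F=D|D|^{-1}$ vanishes on $\ker D$. The operator $\Phi^\alpha_{\beta,\gamma}$ in (ii) is the same operator as in (i), i.e., there is one $\Phi^\alpha_{\beta,\gamma}$ (depending only on $D,\alpha,\beta,\gamma$) satisfying both (i) and (ii). *)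

(* Defs.v *)
From HB Require Import structures.
From mathcomp Require Import all_boot all_order all_algebra.
From mathcomp Require Import all_classical all_reals all_analysis.
From mathcomp Require Import complex.

Set Implicit Arguments.
Unset Strict Implicit.
Unset Printing Implicit Defensive.
Import Order.TTheory GRing.Theory Num.Theory.
Import numFieldNormedType.Exports.
Local Open Scope classical_set_scope.
Local Open Scope ring_scope.

(* The forms [{dot V for conj}] are linear in the first argument and
   conjugate-linear in the second one. *)
Record hilbertSpace (R : realType) := HilbertSpace {
  hilbert_sort :> completeNormedModType R[i];
  inner : {dot hilbert_sort for @Num.conj R[i]};
  inner_norm : forall x, `|x| ^+ 2 = inner x x }.

Notation "''[' x , y ]" := (inner _ x y) : ring_scope.

Definition separable_space (T : topologicalType) :=
  exists2 S : set T, countable S & dense S.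

Section BoundedOperators.
Context {R : realType} {H : hilbertSpace R}.
Implicit Types (S T P : H -> H) (V : set H).

Definition bounded_op : set (H -> H) :=
  [set T | linear T /\ exists M : R, forall x, `|T x| <= M%:C%C * `|x|].

Definition opnorm T : R :=
  sup [set complex.Re `|T x| | x in [set x : H | `|x| <= 1]].

Definition is_adjoint T S := forall x y, '[T x, y] = '[x, S y].

Definition compact_op : set (H -> H) :=
  [set T | bounded_op T /\ precompact (T @` [set x : H | `|x| <= 1])].

Definition orth_proj V : H -> H :=
  fun x => xget 0 [set y | V y /\ forall v, V v -> '[x - y, v] = 0].

(* The (j+1)-st eigenvalue of |T|, in decreasing order and counted with
   multiplicity: the largest s such that T^* T has j+1 orthonormal eigenvectors
   whose eigenvalues l_i^2 satisfy l_i >= s.  It is 0 (the supremum of the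
   empty set) when j is at least the dimension of H. *)
Definition singular_value T (j : nat) : R :=
  sup [set s : R | 0 <= s /\
    exists (S : H -> H) (v : 'I_j.+1 -> H) (l : 'I_j.+1 -> R),
      [/\ is_adjoint T S,
          forall i k, '[v i, v k] = (i == k)%:R &
          forall i, s <= l i /\ S (T (v i)) = (l i ^+ 2)%:C%C *: v i]].

Definition weak_quasinorm (r : R) T : \bar R :=
  ereal_sup [set ((j.+1%:R `^ r^-1) * singular_value T j)%:E | j in setT].

Definition weak_ideal (r : R) : set (H -> H) :=
  [set T | compact_op T /\ (weak_quasinorm r T < +oo)%E].

Definition unital_star_algebra (A : set (H -> H)) :=
  [/\ A `<=` bounded_op,
      A idfun,
      forall (c : R[i]) a b, A a -> A b -> A (c *: a + b),
      forall a b, A a -> A b -> A (a \o b) &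
      forall a, A a -> exists2 b, A b & is_adjoint a b].

Definition linear_on_bounded (Phi : (H -> H) -> H -> H) :=
  forall (c : R[i]) S T, bounded_op S -> bounded_op T ->
    Phi (c *: S + T) = c *: Phi S + Phi T.

Definition bounded_linear_map (Phi : (H -> H) -> H -> H) :=
  [/\ forall T, bounded_op T -> bounded_op (Phi T),
      linear_on_bounded Phi &
      exists K : R, forall T, bounded_op T -> opnorm (Phi T) <= K * opnorm T].

Definition continuous_linear_map_to_weak (r : R) (Phi : (H -> H) -> H -> H) :=
  [/\ forall T, bounded_op T -> weak_ideal r (Phi T),
      linear_on_bounded Phi &
      forall T, bounded_op T -> forall e : R, 0 < e ->
        exists2 d : R, 0 < d & forall S, bounded_op S ->
          opnorm (S - T) < d -> (weak_quasinorm r (Phi S - Phi T)%R < e%:E)%E].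

End BoundedOperators.

(* The values of [uop] outside [udom] are irrelevant. *)
Record unbounded_op (R : realType) (H : hilbertSpace R) := UnboundedOp {
  udom : set H;
  uop :> H -> H;
  udom0 : udom 0;
  udomP : forall (c : R[i]) x y, udom x -> udom y -> udom (c *: x + y);
  uop_linear : forall (c : R[i]) x y, udom x -> udom y ->
    uop (c *: x + y) = c *: uop x + uop y }.

Section UnboundedOperators.
Context {R : realType} {H : hilbertSpace R}.
Implicit Types (D : unbounded_op H) (T : H -> H).

Definition ugraph D : set (H * H) := [set u | udom D u.1 /\ u.2 = D u.1].

Definition adjoint_graph D : set (H * H) :=
  [set u | forall x, udom D x -> '[D x, u.1] = '[x, u.2]].

Definition selfadjoint D := dense (udom D) /\ adjoint_graph D = ugraph D.

Definition is_resolvent D (z : R[i]) T :=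
  [/\ bounded_op T,
      forall y, udom D (T y) /\ D (T y) - z *: T y = y &
      forall x, udom D x -> T (D x - z *: x) = x].

Definition compact_resolvent D :=
  exists z T, is_resolvent D z T /\ compact_op T.

Definition ukernel D : set H := [set x | udom D x /\ D x = 0].

Definition kernel_proj D : H -> H := orth_proj (ukernel D).

Definition is_partial_inverse D T :=
  [/\ bounded_op T,
      forall x, ukernel D x -> T x = 0 &
      forall x, udom D x -> (forall v, ukernel D v -> '[x, v] = 0) ->
        T (D x) = x].

Definition is_commutator D (a C : H -> H) :=
  bounded_op C /\ forall x, udom D x -> C x = D (a x) - a (D x).

(* The bounded extension to H of the commutator defined on the domain. *)
Definition commutator D (a : H -> H) : H -> H :=
  xget 0 [set C | is_commutator D a C].

Definition projection_valued_measure (E : set R -> H -> H) :=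
  [/\ forall B : set R, measurable B ->
        [/\ bounded_op (E B), E B \o E B = E B & is_adjoint (E B) (E B)],
      E set0 = 0,
      E setT = idfun,
      forall B C : set R, measurable B -> measurable C ->
        E (B `&` C) = E B \o E C &
      forall B : (set R)^nat, (forall n, measurable (B n)) ->
        trivIset setT B -> forall x,
        (fun n => \sum_(i < n) E (B i) x) @ \oo --> E (\bigcup_n B n) x].

Definition scalar_measure (E : set R -> H -> H) (x : H) : set R -> \bar R :=
  fun B => (complex.Re '[E B x, x])%:E.

Definition spectral_measure_of D (E : set R -> H -> H) :=
  [/\ projection_valued_measure E,
      forall x, udom D x <-> (\int[scalar_measure E x]_t (t ^+ 2)%:E < +oo)%E &
      forall x, udom D x ->
        '[D x, x] = (fine (\int[scalar_measure E x]_t t%:E)%E)%:C%C].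

(* Borel functional calculus f(D) = \int f dE for a real Borel function f such
   that f(D) is everywhere defined and bounded.  As the scalars are complex,
   f(D) is determined by its quadratic form. *)
Definition is_borel_calculus D (f : R -> R) T :=
  [/\ measurable_fun setT f, bounded_op T &
      exists E, spectral_measure_of D E /\
        forall x, (\int[scalar_measure E x]_t (f t ^+ 2)%:E < +oo)%E /\
          '[T x, x] = (fine (\int[scalar_measure E x]_t (f t)%:E)%E)%:C%C].

Definition borel_calculus D (f : R -> R) : H -> H :=
  xget 0 [set T | is_borel_calculus D f T].

(* [0 `^ 0 = 1], hence the explicit test. *)
Definition abs_powN (q t : R) : R := if t == 0 then 0 else `|t| `^ (- q).

Definition abs_op_powN D (q : R) : H -> H := borel_calculus D (abs_powN q).

Definition sign_op D : H -> H := D \o abs_op_powN D 1.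

(* The elements of A are identified with the operators representing them, and
   the unit of A acts as the identity. *)
Definition spectral_triple (A : set (H -> H)) D :=
  [/\ separable_space H, unital_star_algebra A, selfadjoint D,
      compact_resolvent D &
      forall a, A a -> (forall x, udom D x -> udom D (a x)) /\
        exists C, is_commutator D a C].

Definition p_summable (p : R) D :=
  exists2 T, is_partial_inverse D T & weak_ideal p T.

End UnboundedOperators.

(* Main.v *)
(* Let e_n be an orthonormal eigenbasis of D, with eigenvalues l_n.  Comparing matrix
   entries, off the kernel of D the operator Phi must be the Schur multiplier with symbol
   |x|^beta |y|^gamma (|x|^-alpha - |y|^-alpha) / (x - y) at (x, y) = (l_m, l_n).
   For x, y > 0, max (beta, gamma) < 1 and beta + gamma = alpha + 1, the resolvent formula
   for x^-alpha writes this symbol as an integral of products A_t(x) B_t(y) such that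
   the functions t |-> A_t(x) and t |-> B_t(y) are bounded in L^2, so that the multiplier
   is bounded.  The sums x + y occurring for eigenvalues of opposite sign, and the case
   max (beta, gamma) = 1, reduce to it by partial fractions in x^2 and y^2.  The excess
   delta = 1 + alpha - beta - gamma is split into weights |x|^-a and |y|^-b: cutting off
   the O(t^-p) eigenvalues with 1 / |l| > t leaves an operator of norm O(t^delta), which
   bounds the singular values of Phi(T). *)

Require Import Defs.
From HB Require Import structures.
From mathcomp Require Import all_boot all_order all_algebra.
From mathcomp Require Import all_classical all_reals all_analysis.
From mathcomp Require Import complex ring lra measurable_realfun.
Set Implicit Arguments.
Unset Strict Implicit.
Unset Printing Implicit Defensive.
Import Order.TTheory GRing.Theory Num.Theory.
Import numFieldNormedType.Exports Normc.
Local Open Scope classical_set_scope.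
Local Open Scope ring_scope.

(** * Hilbert spaces and bounded operators *)

Section Hilbert.
Context {R : realType} {H : hilbertSpace R}.
Local Notation C := R[i].
Implicit Types (x y z : H) (c : C).

(** What shapes the proof is that powers of |D| are not given by their matrix entries:
    [borel_calculus] selects an operator attached to some spectral measure of [D], and
    [spectral_measure_of] prescribes only the domain and the quadratic form of [D]. Before entries
    can be compared, the projections of an eigenbasis must be shown to form a spectral measure, and
    every spectral measure must be shown to agree with them. The eigenbasis comes from the compact
    symmetric partial inverse that summability provides.

    Integration is confined to real functions. Boundedness of a multiplier is an inequality between
    finite sums, which passes under an integral sign, and operators are recovered from their
    matrices only at the end.

    [Phi] must serve all [p] and all algebras at once, and must be defined on all bounded operators
    rather than on commutators alone; its matrix entries do both. The entries of a commutator with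
    [D] vanish where two eigenvalues coincide, so difference quotients have to be controlled only
    off the diagonal. *)

Lemma innerDl x y z : '[x + y, z] = '[x, z] + '[y, z].
Proof. by rewrite linearDl. Qed.
Lemma innerDr x y z : '[x, y + z] = '[x, y] + '[x, z].
Proof. by rewrite linearDr. Qed.
Lemma innerZl c x z : '[c *: x, z] = c * '[x, z].
Proof. by rewrite linearZl_LR. Qed.
Lemma innerZr c x z : '[x, c *: z] = c^* * '[x, z].
Proof. by rewrite linearZr_LR. Qed.
Lemma inner0l z : '[0, z] = 0. Proof. by rewrite linear0l. Qed.
Lemma inner0r z : '[z, 0] = 0. Proof. by rewrite linear0r. Qed.
Lemma innerNl x z : '[- x, z] = - '[x, z]. Proof. by rewrite linearNl. Qed.
Lemma innerNr x z : '[x, - z] = - '[x, z]. Proof. by rewrite linearNr. Qed.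
Lemma innerBl x y z : '[x - y, z] = '[x, z] - '[y, z].
Proof. by rewrite innerDl innerNl. Qed.
Lemma innerBr x y z : '[x, y - z] = '[x, y] - '[x, z].
Proof. by rewrite innerDr innerNr. Qed.
Lemma innerC x y : '[x, y] = ('[y, x])^*.
Proof. by rewrite hermC expr0 mul1r. Qed.
Lemma inner_suml (I : Type) (r : seq I) (P : pred I) (F : I -> H) z :
  '[\sum_(i <- r | P i) F i, z] = \sum_(i <- r | P i) '[F i, z].
Proof. by rewrite linear_sumlz. Qed.
Lemma inner_sumr (I : Type) (r : seq I) (P : pred I) (F : I -> H) z :
  '[z, \sum_(i <- r | P i) F i] = \sum_(i <- r | P i) '[z, F i].
Proof. by rewrite linear_sumr. Qed.

Lemma normCE c : `|c| = (normc c)%:C%C.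
Proof. by rewrite normc_def; case: c. Qed.
Lemma normc_ge0 c : 0 <= normc c.
Proof. by have := normr_ge0 c; rewrite normCE ler0c. Qed.
Lemma normc_real (r : R) : normc (r%:C%C) = `|r|.
Proof. by rewrite /= expr0n addr0 sqrtr_sqr. Qed.
Lemma normc_conj c : normc c^* = normc c.
Proof. by apply: complexI; rewrite -!normCE norm_conjC. Qed.
Lemma normc_eq0 c : (normc c == 0) = (c == 0).
Proof. by apply/eqP/eqP => [/eq0_normc|->] //; rewrite normc0. Qed.
Lemma Re_le_normc c : complex.Re c <= normc c.
Proof.
have := normc_ge_Re c; rewrite normCE lecR; apply: le_trans; exact: ler_norm.
Qed.
Lemma mul_conjC c : c * c^* = (normc c ^+ 2)%:C%C.
Proof. by rewrite -normCK normCE rmorphXn. Qed.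
Lemma ReD (a b : C) : complex.Re (a + b) = complex.Re a + complex.Re b.
Proof. by case: a b => [? ?] [? ?]. Qed.
Lemma ReN (a : C) : complex.Re (- a) = - complex.Re a.
Proof. by case: a. Qed.
Lemma ReB (a b : C) : complex.Re (a - b) = complex.Re a - complex.Re b.
Proof. by rewrite ReD ReN. Qed.
Lemma Re_conj (a : C) : complex.Re a^* = complex.Re a.
Proof. by case: a. Qed.
Lemma Re_sum (I : Type) (r : seq I) (P : pred I) (F : I -> C) :
  complex.Re (\sum_(i <- r | P i) F i) = \sum_(i <- r | P i) complex.Re (F i).
Proof. by elim/big_ind2: _ => // a b d e <- <-; rewrite ReD. Qed.
Lemma ReM_real (r : R) (a : C) : complex.Re (r%:C%C * a) = r * complex.Re a.
Proof. by case: a => a b /=; rewrite mul0r subr0. Qed.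
(** Norms in a normed module over [R[i]] are complex numbers; this is the same number in [R], where
    order, suprema and [lra] are available. *)
Definition nrm x : R := complex.Re `|x|.

Lemma nrmE x : `|x| = (nrm x)%:C%C.
Proof. by rewrite /nrm RRe_real // ger0_real. Qed.
Lemma nrm_ge0 x : 0 <= nrm x.
Proof. by have := normr_ge0 x; rewrite nrmE ler0c. Qed.
Lemma nrm0 : nrm 0 = 0. Proof. by rewrite /nrm normr0. Qed.
Lemma nrm_eq0 x : (nrm x == 0) = (x == 0).
Proof. by rewrite -(normr_eq0 x) nrmE fmorph_eq0. Qed.
Lemma nrmN x : nrm (- x) = nrm x. Proof. by rewrite /nrm normrN. Qed.
Lemma nrm_subC x y : nrm (x - y) = nrm (y - x).
Proof. by rewrite -nrmN opprB. Qed.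
Lemma nrmZ c x : nrm (c *: x) = normc c * nrm x.
Proof. by apply: complexI; rewrite -nrmE normrZ normCE nrmE rmorphM. Qed.
Lemma nrmD x y : nrm (x + y) <= nrm x + nrm y.
Proof. by have := ler_normD x y; rewrite !nrmE -rmorphD lecR. Qed.
Lemma nrmB x y : nrm (x - y) <= nrm x + nrm y.
Proof. by rewrite -(nrmN y) nrmD. Qed.
Lemma nrm_tri y x z : nrm (x - z) <= nrm (x - y) + nrm (y - z).
Proof. by rewrite (_ : x - z = (x - y) + (y - z)) ?nrmD // addrA subrK. Qed.
Lemma nrm_sum (I : Type) (r : seq I) (P : pred I) (F : I -> H) :
  nrm (\sum_(i <- r | P i) F i) <= \sum_(i <- r | P i) nrm (F i).
Proof.
elim/big_ind2: _ => //; first by rewrite nrm0.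
by move=> a b d e ab de; apply: le_trans (nrmD _ _) (lerD ab de).
Qed.
Lemma inner_nrm x : '[x, x] = (nrm x ^+ 2)%:C%C.
Proof. by rewrite -inner_norm nrmE rmorphXn. Qed.
Lemma Re_inner_nrm x : complex.Re '[x, x] = nrm x ^+ 2.
Proof. by rewrite inner_nrm. Qed.

(** Positivity of the squared norm of [|y|^2 x - '[x, y] y]; with this scaling no division by
    [|y|^2] occurs inside the scalars, and the factor is cancelled at the end. *)
Lemma cauchy_schwarz x y : normc '[x, y] <= nrm x * nrm y.
Proof.
have [->|y0] := eqVneq y 0; first by rewrite inner0r normc0 nrm0 mulr0.
have ny : 0 < nrm y by rewrite lt_def nrm_ge0 nrm_eq0 y0.
set d := '[x, y].
have : 0 <= complex.Re '[(nrm y ^+ 2)%:C%C *: x - d *: y,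
                 (nrm y ^+ 2)%:C%C *: x - d *: y].
  by rewrite Re_inner_nrm exprn_ge0 ?nrm_ge0.
rewrite !(innerBl, innerBr, innerZl, innerZr) (innerC y x) -/d !inner_nrm.
have -> : ((nrm y ^+ 2)%:C%C : C)^* = (nrm y ^+ 2)%:C%C by exact: conjc_real.
set n := nrm y ^+ 2; set m := nrm x ^+ 2.
have dd : d * d^* = (normc d ^+ 2)%:C%C by exact: mul_conjC.
have key (k l j : R) : d * d^* = j%:C%C -> k%:C%C * (k%:C%C * l%:C%C - d^* * d) -
     (k%:C%C * (d * d^*) - d * (d^* * k%:C%C)) = (k * (k * l - j))%:C%C :> C.
  move=> ddj; rewrite (mulrA d) [d^* * d]mulrC ddj -!(rmorphM, rmorphB) /=.
  by congr (_%:C)%C; ring.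
rewrite (key n m _ dd) /= pmulr_rge0 ?exprn_gt0 // subr_ge0 /n /m -exprMn.
by rewrite ler_sqr ?nnegrE ?normc_ge0 ?mulr_ge0 ?nrm_ge0 // mulrC.
Qed.

Lemma nrmD_sqr x y :
  nrm (x + y) ^+ 2 = nrm x ^+ 2 + nrm y ^+ 2 + 2 * complex.Re '[x, y].
Proof.
rewrite -!Re_inner_nrm !(innerDl, innerDr) !ReD (innerC y x) Re_conj; ring.
Qed.
Lemma nrmB_sqr x y :
  nrm (x - y) ^+ 2 = nrm x ^+ 2 + nrm y ^+ 2 - 2 * complex.Re '[x, y].
Proof. by rewrite nrmD_sqr nrmN innerNr ReN mulrN. Qed.
Lemma parallelogram x y :
  nrm (x + y) ^+ 2 + nrm (x - y) ^+ 2 = 2 * nrm x ^+ 2 + 2 * nrm y ^+ 2.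
Proof. rewrite nrmD_sqr nrmB_sqr; ring. Qed.
Lemma pythagoras x y : '[x, y] = 0 -> nrm (x + y) ^+ 2 = nrm x ^+ 2 + nrm y ^+ 2.
Proof. by move=> xy; rewrite nrmD_sqr xy /= mulr0 addr0. Qed.
Lemma inner_eq0 x : '[x, x] = 0 -> x = 0.
Proof.
rewrite inner_nrm => /eqP; rewrite fmorph_eq0 sqrf_eq0 nrm_eq0; exact: eqP.
Qed.
Lemma nrm_le_eps (r : R) x : (forall e : R, 0 < e -> nrm x <= e) -> x = 0.
Proof.
move=> h; apply/eqP; rewrite -nrm_eq0 eq_le nrm_ge0 andbT.
by apply/ler_addgt0Pl => e e0; rewrite addr0; exact: h.
Qed.
End Hilbert.

(** * Convergence of sequences, bounded operators and orthogonal projection *)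

Section HilbertTopology.
Context {R : realType} {H : hilbertSpace R}.
Local Notation C := R[i].
Implicit Types (x y z : H) (c : C) (u : nat -> H) (V : set H).

Definition scvg u l := forall e : R, 0 < e ->
  exists N, forall n, (N <= n)%N -> nrm (u n - l) < e.

Lemma gt0_complex c : 0 < c -> exists2 e : R, 0 < e & c = e%:C%C.
Proof.
move=> c0; exists (complex.Re c); first by rewrite -ltcR RRe_real // gtr0_real.
by rewrite RRe_real // gtr0_real.
Qed.

Lemma scvgP u l : scvg u l <-> u @ \oo --> l.
Proof.
split=> [ul|/cvgrPdist_lt ul e e0].
  apply/cvgrPdist_lt => c /gt0_complex[e e0 ->].
  have [N hN] := ul e e0; exists N => // n /= Nn.
  by rewrite nrmE ltcR nrm_subC; exact: hN.
have [|N _ hN] := ul e%:C%C; first by rewrite ltcR.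
by exists N => n /hN; rewrite /= nrmE ltcR nrm_subC.
Qed.

Lemma hilbert_complete u :
  (forall e : R, 0 < e -> exists N, forall m n, (N <= m)%N -> (N <= n)%N ->
     nrm (u m - u n) < e) -> exists l, scvg u l.
Proof.
move=> uC; have /cauchy_cvgP ucvg : cauchy (u @ \oo).
  apply: cauchy_exP => c /gt0_complex[e e0 ->].
  have [N hN] := uC e e0; exists (u N); exists N => // n /= Nn.
  by rewrite -ball_normE /= nrmE ltcR; exact: hN.
by exists (lim (u @ \oo)); apply/scvgP.
Qed.

Lemma scvg_unique u x y : scvg u x -> scvg u y -> x = y.
Proof.
move=> ux uy; apply/eqP; rewrite -subr_eq0; apply/eqP/(@nrm_le_eps _ _ 0) => e e0.
have [N hN] := ux _ (divr_gt0 e0 (ltr0Sn _ 1)).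
have [M hM] := uy _ (divr_gt0 e0 (ltr0Sn _ 1)).
have := hN (maxn N M) (leq_maxl _ _); have := hM (maxn N M) (leq_maxr _ _).
have := nrm_tri (u (maxn N M)) x y; rewrite [in X in _ <= X + _]nrm_subC; lra.
Qed.

Lemma closure_nrmP V x :
  closure V x <-> forall e : R, 0 < e -> exists2 v, V v & nrm (v - x) < e.
Proof.
split=> [cV e e0|h B /nbhs_ballP[c /= /gt0_complex[e e0 ->]] cB].
  have [|v [Vv]] := cV (ball x e%:C%C); first by apply: nbhsx_ballx; rewrite ltcR.
  by rewrite -ball_normE /= nrmE ltcR => hv; exists v => //; rewrite nrm_subC.
have [v Vv ve] := h _ e0; exists v; split=> //; apply: cB.
by rewrite -ball_normE /= nrmE ltcR nrm_subC.
Qed.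

Lemma denseP V : dense V <-> forall x (e : R), 0 < e -> exists2 v, V v & nrm (v - x) < e.
Proof.
split=> [dV x e e0|h].
  have [||v [bv Vv]] := dV (ball x e%:C%C).
  - by exists x; apply: ballxx; rewrite ltcR.
  - exact: ball_open.
  - by exists v => //; move: bv; rewrite -ball_normE /= nrmE ltcR nrm_subC.
move=> O [x Ox] oO.
have /nbhs_ballP[c /= /gt0_complex[e e0 ->] cB] : nbhs x O by exact: open_nbhs_nbhs.
have [v Vv ve] := h x e e0; exists v; split => //.
by apply: cB; rewrite -ball_normE /= nrmE ltcR nrm_subC.
Qed.

Lemma scvg_inner u x y : scvg u x ->
  forall e : R, 0 < e -> exists N, forall n, (N <= n)%N -> normc ('[u n, y] - '[x, y]) < e.
Proof.
move=> ux e e0.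
have hp : 0 < nrm y + 1 by rewrite ltr_wpDl ?nrm_ge0.
have [N hN] := ux _ (divr_gt0 e0 hp); exists N => n /hN.
rewrite -innerBl ltr_pdivlMr // => h; apply: le_lt_trans (cauchy_schwarz _ _) _.
by apply: le_lt_trans h; rewrite ler_wpM2l ?nrm_ge0 // lerDl.
Qed.

Lemma scvg_inner_eq u x y c : scvg u x -> (forall n, '[u n, y] = c) -> '[x, y] = c.
Proof.
move=> ux h; apply/eqP; rewrite eq_sym -subr_eq0 -normc_eq0 eq_le normc_ge0 andbT.
apply/ler_addgt0Pl => e e0; rewrite addr0.
by have [N /(_ N (leqnn _))] := scvg_inner y ux e0; rewrite h => /ltW.
Qed.

Lemma scvg_nrm_le u x (M : R) : scvg u x -> (forall n, nrm (u n) <= M) -> nrm x <= M.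
Proof.
move=> ux h; apply/ler_addgt0Pl => e e0.
have [N /(_ N (leqnn _)) hN] := ux _ e0.
have := nrm_tri (u N) x 0; rewrite !subr0 nrm_subC; have := h N; lra.
Qed.

Implicit Types S T : H -> H.

Lemma linP T : linear T <->
  (forall x y, T (x + y) = T x + T y) /\ (forall c x, T (c *: x) = c *: T x).
Proof.
split=> [lT|[TD TZ] c x y]; last by rewrite TD TZ.
have T0 : T 0 = 0.
  by have := lT (-1) 0 0; rewrite scaleN1r oppr0 addr0 scaleN1r addNr.
by split=> [x y|c x]; [have := lT 1 x y; rewrite !scale1r | have := lT c x 0; rewrite T0 !addr0].
Qed.

Lemma bopP T (M : R) : linear T -> (forall x, nrm (T x) <= M * nrm x) -> bounded_op T.
Proof.
move=> lT hM; split=> //; exists M => x.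
by rewrite !nrmE -rmorphM lecR; exact: hM.
Qed.

Section BoundedOperators.
Variable T : H -> H.
Hypothesis bT : bounded_op T.
Lemma bopD x y : T (x + y) = T x + T y.
Proof. by have [/linP[h _] _] := bT; exact: h. Qed.
Lemma bopZ c x : T (c *: x) = c *: T x.
Proof. by have [/linP[_ h] _] := bT; exact: h. Qed.
Lemma bop0 : T 0 = 0.
Proof. by have := bopZ 0 0; rewrite !scale0r. Qed.
Lemma bopN x : T (- x) = - T x.
Proof. by rewrite -scaleN1r bopZ scaleN1r. Qed.
Lemma bopB x y : T (x - y) = T x - T y.
Proof. by rewrite bopD bopN. Qed.
Lemma bop_sum (I : Type) (r : seq I) (P : pred I) (F : I -> H) :
  T (\sum_(i <- r | P i) F i) = \sum_(i <- r | P i) T (F i).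
Proof. by apply: (big_morph T bopD bop0). Qed.
Lemma bop_bound : exists2 M : R, 0 < M & forall x, nrm (T x) <= M * nrm x.
Proof.
have [_ [M hM]] := bT; exists (`|M| + 1); first by rewrite ltr_wpDl.
move=> x; have := hM x; rewrite !nrmE -rmorphM lecR => /le_trans; apply.
by rewrite ler_wpM2r ?nrm_ge0 // (le_trans (ler_norm M)) // lerDl.
Qed.

Let onset := [set complex.Re `|T x| | x in [set x : H | `|x| <= 1]].

Lemma nrm_le1 x : (`|x| <= 1) = (nrm x <= 1).
Proof. by rewrite nrmE -(lecR (nrm x) 1). Qed.

Let onset_sup : has_sup onset.
Proof.
split; first by exists (complex.Re `|T 0|); exists 0 => //=; rewrite normr0.
have [M M0 hM] := bop_bound; exists M => _ [x /= x1 <-]; rewrite nrm_le1 in x1.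
by rewrite -/(nrm _); apply: le_trans (hM x) _; rewrite ler_piMr // ltW.
Qed.

Lemma opnorm_ge0 : 0 <= opnorm T.
Proof.
apply: ub_le_sup; first by have [] := onset_sup.
by exists 0; rewrite /= ?normr0 ?bop0 ?normr0.
Qed.

Lemma opnorm_bound x : nrm (T x) <= opnorm T * nrm x.
Proof.
have [->|x0] := eqVneq x 0; first by rewrite bop0 nrm0 mulr0.
have nx : 0 < nrm x by rewrite lt_def nrm_ge0 nrm_eq0 x0.
rewrite -ler_pdivrMr //.
have -> : nrm (T x) / nrm x = nrm (T ((nrm x)^-1%:C%C *: x)).
  by rewrite bopZ nrmZ normc_real ger0_norm ?invr_ge0 ?nrm_ge0 // mulrC.
apply: ub_le_sup; first by have [] := onset_sup.
exists ((nrm x)^-1%:C%C *: x) => //=; rewrite nrm_le1 nrmZ normc_real.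
by rewrite ger0_norm ?invr_ge0 ?nrm_ge0 // mulVf // gt_eqF.
Qed.

Lemma opnorm_le (M : R) : 0 <= M -> (forall x, nrm (T x) <= M * nrm x) -> opnorm T <= M.
Proof.
move=> M0 hM; apply: ge_sup => [|_ [z /= z1 <-]]; first by have [] := onset_sup.
rewrite nrm_le1 in z1.
by rewrite -/(nrm _); apply: le_trans (hM z) _; rewrite ler_piMr.
Qed.
End BoundedOperators.

Lemma bounded_op0 : bounded_op (0 : H -> H).
Proof.
apply: (@bopP _ 0) => [c x y|x]; first by rewrite scaler0 addr0.
by rewrite nrm0 mul0r.
Qed.
Lemma bounded_op_lin c S T : bounded_op S -> bounded_op T -> bounded_op (c *: S + T).
Proof.
move=> bS bT; have [M M0 hM] := bop_bound bS; have [N N0 hN] := bop_bound bT.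
apply: (@bopP _ (normc c * M + N)).
  apply/linP; split=> [x y|d x]; rewrite !fctE.
    by rewrite (bopD bS) (bopD bT) scalerDr addrACA.
  by rewrite (bopZ bS) (bopZ bT) scalerDr !scalerA [d * c]mulrC.
move=> x; rewrite !fctE; apply: le_trans (nrmD _ _) _; rewrite nrmZ mulrDl.
by rewrite lerD // -mulrA ler_wpM2l ?normc_ge0.
Qed.

Lemma bounded_opD S T : bounded_op S -> bounded_op T -> bounded_op (S + T).
Proof. by move=> bS bT; have := bounded_op_lin 1 bS bT; rewrite scale1r. Qed.

Lemma bounded_opB S T : bounded_op S -> bounded_op T -> bounded_op (S - T).
Proof.
by move=> bS bT; have := bounded_op_lin (-1) bT bS; rewrite scaleN1r addrC.
Qed.

Lemma bounded_op_comp S T : bounded_op S -> bounded_op T -> bounded_op (S \o T).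
Proof.
move=> bS bT; have [M M0 hM] := bop_bound bS; have [N N0 hN] := bop_bound bT.
apply: (@bopP _ (M * N)).
  by move=> c x y; rewrite /= (bopD bT) (bopD bS) (bopZ bT) (bopZ bS).
by move=> x; rewrite /= -mulrA (le_trans (hM _)) // ler_wpM2l // ltW.
Qed.

Lemma scvg_bop T u x : bounded_op T -> scvg u x -> scvg (T \o u) (T x).
Proof.
move=> bT ux e e0; have [M M0 hM] := bop_bound bT.
have [N hN] := ux _ (divr_gt0 e0 M0); exists N => n /hN.
rewrite ltr_pdivlMr // => h; rewrite /= -bopB //.
by apply: le_lt_trans (hM _) _; rewrite mulrC.
Qed.

Definition linset V := V 0 /\ forall c x y, V x -> V y -> V (c *: x + y).

Lemma linset_closure V x y c :
  linset V -> closure V x -> closure V y -> closure V (c *: x + y).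
Proof.
move=> [_ lV] /closure_nrmP cx /closure_nrmP cy; apply/closure_nrmP => e e0.
have hp : 0 < normc c + 1 by rewrite ltr_wpDl ?normc_ge0.
have [v Vv hv] := cx _ (divr_gt0 (divr_gt0 e0 (ltr0Sn _ 1)) hp).
have [w Vw hw] := cy _ (divr_gt0 e0 (ltr0Sn _ 1)).
exists (c *: v + w); first exact: lV.
rewrite (_ : _ - _ = c *: (v - x) + (w - y)); last first.
  by rewrite scalerBr opprD addrACA.
apply: le_lt_trans (nrmD _ _) _; rewrite nrmZ.
have : normc c * nrm (v - x) <= (normc c + 1) * nrm (v - x).
  by rewrite ler_wpM2r ?nrm_ge0 // lerDl.
move: hv; rewrite ltr_pdivlMr // mulrC => hv; lra.
Qed.

(* A minimizing sequence is Cauchy by the parallelogram law. *)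
Lemma projection_ex V x : linset V ->
  exists2 y, closure V y & forall v, V v -> '[x - y, v] = 0.
Proof.
move=> [V0 lV]; pose A := [set nrm (x - v) ^+ 2 | v in V].
have A0 : has_inf A.
  split; first by exists (nrm (x - 0) ^+ 2), 0.
  by exists 0 => _ [v _ <-]; rewrite exprn_ge0 ?nrm_ge0.
have inf_le v : V v -> inf A <= nrm (x - v) ^+ 2.
  by move=> Vv; apply: ge_inf; [have [] := A0|exists v].
have /choice[u hu] n : exists v, V v /\ nrm (x - v) ^+ 2 < inf A + n.+1%:R^-1.
  have [|_ [v Vv <-] hv] := inf_adherent (eps := n.+1%:R^-1) _ A0.
    by rewrite invr_gt0.
  by exists v.
have par v w : V v -> V w ->
    nrm (v - w) ^+ 2 <= 2 * (nrm (x - v) ^+ 2 - inf A) + 2 * (nrm (x - w) ^+ 2 - inf A).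
  move=> Vv Vw; have := parallelogram (x - v) (x - w).
  rewrite (_ : x - v - (x - w) = w - v); last by rewrite opprB addrC addrA subrK.
  rewrite (_ : x - v + (x - w) = 2%:R%:C%C *: (x - (2^-1%:C%C *: v + 2^-1%:C%C *: w))); last first.
    rewrite scalerBr scalerDr !scalerA -!rmorphM /= mulfV // !scale1r opprD.
    by rewrite rmorph_nat scaler_nat mulr2n addrACA.
  (* The midpoint of [v] and [w] stays in [V], so it is no closer to [x] than the infimum. *)
  have V2 : V (2^-1%:C%C *: v + 2^-1%:C%C *: w).
    by apply: (lV) => //; rewrite -[_ *: w]addr0; exact: lV.
  have := inf_le _ V2; rewrite nrmZ normc_real ger0_norm // exprMn [nrm (w - v)]nrm_subC; lra.
have [|y uy] := hilbert_complete (u := u).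
  move=> e e0.
  (* By [par], [|u m - u n|^2] is less than [2 / (m + 1) + 2 / (n + 1)], hence less than
     [4 / (N + 1)]. *)
  have [N hN] : exists N : nat, 4 / e ^+ 2 < N.+1%:R.
    by exists (Num.truncn (4 / e ^+ 2)); exact: truncnS_gt.
  exists N => m n Nm Nn.
  rewrite -(ltr_pXn2r (n := 2)) ?nnegrE ?nrm_ge0 ?(ltW e0) //.
  apply: le_lt_trans (par _ _ (proj1 (hu m)) (proj1 (hu n))) _.
  have inv k : (N <= k)%N -> k.+1%:R^-1 <= N.+1%:R^-1 :> R.
    by move=> Nk; rewrite lef_pV2 ?posrE // ler_nat.
  have : 4 * N.+1%:R^-1 < e ^+ 2.
    by rewrite ltr_pdivrMr // mulrC -ltr_pdivrMr // exprn_gt0.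
  have := inv m Nm; have := inv n Nn; have := (hu m).2; have := (hu n).2.
  by move: (n.+1%:R^-1) (m.+1%:R^-1) (N.+1%:R^-1) => i j k; lra.
exists y.
  apply/closure_nrmP => e e0; have [N /(_ N (leqnn _)) hN] := uy e e0.
  by exists (u N) => //; exact: (hu N).1.
have ymin : nrm (x - y) ^+ 2 <= inf A.
  have le_sqrt : nrm (x - y) <= Num.sqrt (inf A).
    apply/ler_addgt0Pl => e e0.
    have e2 : 0 < e / 2 by rewrite divr_gt0.
    have [N hN] := uy _ e2.
    have i0 : 0 <= inf A.
      by apply: lb_le_inf; [case: A0|move=> _ [v _ <-]; rewrite exprn_ge0 ?nrm_ge0].
    have [M hM] : exists M : nat, ((e/2)^+2)^-1 < M.+1%:R.
      by exists (Num.truncn ((e/2)^+2)^-1); exact: truncnS_gt.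
    pose K := maxn N M.
    have h1 : nrm (x - u K) <= Num.sqrt (inf A) + e / 2.
      rewrite -(ler_pXn2r (n := 2)) ?nnegrE ?nrm_ge0 ?addr_ge0 ?sqrtr_ge0 ?ltW//.
      have := (hu K).2; rewrite sqrrD sqr_sqrtr //.
      have : 0 <= Num.sqrt (inf A) * (e / 2) by rewrite mulr_ge0 ?sqrtr_ge0 // ltW.
      have : K.+1%:R^-1 <= (e / 2) ^+ 2.
        rewrite -[leRHS]invrK lef_pV2 ?posrE ?invr_gt0 ?exprn_gt0 //.
        by apply: le_trans (ltW hM) _; rewrite ler_nat ltnS leq_maxr.
      move: (K.+1%:R^-1) => i; rewrite mulr2n; lra.
    have := hN K (leq_maxl _ _); have := nrm_tri (u K) x y; lra.
  have i0 : 0 <= inf A.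
    by apply: lb_le_inf; [case: A0|move=> _ [v _ <-]; rewrite exprn_ge0 ?nrm_ge0].
  have := le_sqrt; rewrite -(ler_pXn2r (n := 2)) ?nnegrE ?nrm_ge0 ?sqrtr_ge0 //.
  by rewrite sqr_sqrtr.
have clV w : closure V w -> inf A <= nrm (x - w) ^+ 2.
  move=> /closure_nrmP cw.
  have i0 : 0 <= inf A.
    by apply: lb_le_inf; [case: A0|move=> _ [v _ <-]; rewrite exprn_ge0 ?nrm_ge0].
  suff h : Num.sqrt (inf A) <= nrm (x - w).
    move: h; rewrite -(ler_pXn2r (n := 2)) ?nnegrE ?nrm_ge0 ?sqrtr_ge0 //.
    by rewrite sqr_sqrtr.
  apply/ler_addgt0Pl => e e0; have [v Vv hv] := cw e e0.
  have h1 : Num.sqrt (inf A) <= nrm (x - v).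
    rewrite -(ler_pXn2r (n := 2)) ?nnegrE ?nrm_ge0 ?sqrtr_ge0 // sqr_sqrtr //.
    exact: inf_le.
  have := nrm_tri w x v; rewrite [nrm (w - v)]nrm_subC; lra.
move=> v Vv; set d := '[x - y, v].
have cy : closure V y.
  apply/closure_nrmP => e e0; have [N /(_ N (leqnn _)) hN] := uy e e0.
  by exists (u N) => //; exact: (hu N).1.
have cv : closure V v by exact: subset_closure.
(* The quadratic [t |-> |x - y - t d v|^2] is minimal at 0. *)
have quad (t : R) : 0 <= t ^+ 2 * (normc d ^+ 2 * nrm v ^+ 2) - 2 * t * normc d ^+ 2.
  have := clV _ (linset_closure (c := t%:C%C * d) (conj V0 lV) cv cy).
  move/(le_trans ymin).
  rewrite (_ : x - ((t%:C%C * d) *: v + y) = (x - y) - (t%:C%C * d) *: v); last first.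
    by rewrite opprD addrCA addrC.
  rewrite (nrmB_sqr (x - y)) innerZr -/d nrmZ normcM normc_real.
  rewrite (_ : ((t%:C%C * d : C)^* * d) = (t * normc d ^+ 2)%:C%C); last first.
    rewrite rmorphM /= -mulrA [_ * d]mulrC mul_conjC.
    by rewrite (_ : (t%:C%C : C)^* = t%:C%C) ?rmorphM //; exact: conjc_real.
  rewrite /= !exprMn real_normK ?num_real //; lra.
apply/eqP; rewrite -normc_eq0; apply/negP => /negP d0.
have dp : 0 < normc d ^+ 2 by rewrite exprn_gt0 // lt_def normc_ge0 andbT.
have vp : 0 <= nrm v ^+ 2 by rewrite exprn_ge0 ?nrm_ge0.
(* At this [t] the quadratic equals [t |d|^2 (t |v|^2 - 2)] with [t |v|^2 <= 1], which is negative
   unless [d = 0]; adding 1 to [|v|^2] covers [v = 0]. *)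
have := quad (nrm v ^+ 2 + 1)^-1.
set a := nrm v ^+ 2 in vp *; set b := (a + 1)^-1.
have b0 : 0 < b by rewrite invr_gt0 ltr_wpDl.
have ba : b * a <= 1 by rewrite /b mulrC ler_pdivrMr ?ltr_wpDl // mul1r lerDl.
have -> : b ^+ 2 * (normc d ^+ 2 * a) - 2 * b * normc d ^+ 2 =
   (b * normc d ^+ 2) * (b * a - 2) by ring.
have bd : 0 < b * normc d ^+ 2 by apply: mulr_gt0.
rewrite (pmulr_rge0 _ bd) subr_ge0 leNgt => /negP; apply.
by rewrite (le_lt_trans ba) // ltr1n.
Qed.

End HilbertTopology.

(** * Eigenbasis of the Dirac operator *)

Section CompactSymmetric.
Context {R : realType} {H : hilbertSpace R}.
Local Notation C := R[i].
Implicit Types (x y z : H) (c : C) (u : nat -> H) (V : set H).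

Lemma scvg_inner_eq2 (u v : nat -> H) x y a b : scvg u x -> scvg v y ->
  (forall n, '[u n, a] = '[v n, b]) -> '[x, a] = '[y, b].
Proof.
move=> ux vy h; apply/eqP; rewrite -subr_eq0 -normc_eq0 eq_le normc_ge0 andbT.
apply/ler_addgt0Pl => e e0; rewrite addr0.
have e2 : 0 < e / 2 by rewrite divr_gt0.
have [N hN] := scvg_inner a ux e2; have [M hM] := scvg_inner b vy e2.
have := hN (maxn N M) (leq_maxl _ _); have := hM (maxn N M) (leq_maxr _ _).
have -> : '[x, a] - '[y, b] =
   - ('[u (maxn N M), a] - '[x, a]) + ('[v (maxn N M), b] - '[y, b]).
  by rewrite h; ring.
move=> p q; apply: le_trans (le_normcD _ _) _; rewrite normcN; move: p q.
by move: (normc _) (normc _) => p q; lra.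
Qed.

Lemma closure_seq V x : closure V x -> exists2 u, (forall n, V (u n)) & scvg u x.
Proof.
move=> /closure_nrmP cV.
have /choice[u hu] n : exists v, V v /\ nrm (v - x) < n.+1%:R^-1.
  by have [|v Vv hv] := cV n.+1%:R^-1; [rewrite invr_gt0|exists v].
exists u => [n|e e0]; first exact: (hu n).1.
exists (Num.truncn e^-1) => n hn; apply: lt_trans (hu n).2 _.
rewrite invf_plt ?posrE //; apply: lt_le_trans (truncnS_gt _) _.
by rewrite ler_nat.
Qed.
(* A cluster point [w] of [T x_n], where [x_n] is maximizing for [|T x|] on the
   unit ball of [V], satisfies [T (T w) = M ^ 2 w]. *)
Lemma compact_symmetric_eigenvector (T : H -> H) V :
  compact_op T -> is_adjoint T T ->
  (forall x, closure V x -> V x) -> linset V -> (forall x, V x -> V (T x)) ->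
  (exists2 v, V v & T v != 0) ->
  exists2 e, V e & nrm e = 1 /\ exists2 k : R, k != 0 & T e = k%:C%C *: e.
Proof.
move=> [bT [K TK [cK _]]] sT clV sV VT [v0 Vv0 Tv0].
have [V0 lV] := sV.
have VZ c x : V x -> V (c *: x) by move=> Vx; rewrite -[_ *: x]addr0; apply: lV.
have [B B0 hB] := bop_bound bT.
pose A := [set nrm (T x) | x in [set x | V x /\ nrm x <= 1]].
have sA : has_sup A.
  split; first by exists (nrm (T 0)), 0 => //=; rewrite nrm0.
  exists B => _ [x /= [_ x1] <-]; apply: le_trans (hB x) _.
  by rewrite ler_piMr // ltW.
set M := sup A.
have Mub x : V x -> nrm (T x) <= M * nrm x.
  move=> Vx; have [->|x0] := eqVneq x 0; first by rewrite bop0 // nrm0 mulr0.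
  have nx : 0 < nrm x by rewrite lt_def nrm_ge0 nrm_eq0 x0.
  rewrite -ler_pdivrMr //; apply: ub_le_sup; first by case: sA.
  exists ((nrm x)^-1%:C%C *: x); last first.
    by rewrite bopZ // nrmZ normc_real ger0_norm ?invr_ge0 ?nrm_ge0 // mulrC.
  split; first exact: VZ.
  by rewrite nrmZ normc_real ger0_norm ?invr_ge0 ?nrm_ge0 // mulVf // gt_eqF.
have M0 : 0 < M.
  have nv : 0 < nrm (T v0) by rewrite lt_def nrm_ge0 nrm_eq0 Tv0.
  have := lt_le_trans nv (Mub _ Vv0); have := nrm_ge0 v0.
  rewrite le_eqVlt => /orP[/eqP <-|v0p]; first by rewrite mulr0 ltxx.
  by rewrite pmulr_lgt0.
have /choice[x hx] n : exists x, [/\ V x, nrm x <= 1 & M - n.+1%:R^-1 < nrm (T x)].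
  have [|_ [x /= [Vx x1] <-] h] := sup_adherent (eps := n.+1%:R^-1) _ sA.
    by rewrite invr_gt0.
  by exists x.
have [|w [Kw clw]] := cK ((T \o x) @ \oo) _.
  by exists 0%N => // n _ /=; apply: TK; exists (x n) => //=; rewrite nrm_le1; case: (hx n).
have near (e : R) : 0 < e ->
    exists2 z, V z /\ nrm z <= 1 & M - e < nrm (T z) /\ nrm (T z - w) < e.
  move=> e0.
  have Fn : ((T \o x) @ \oo) ((T \o x) @` [set n | (Num.truncn e^-1 <= n)%N]).
    by exists (Num.truncn e^-1) => // n hn; exists n.
  have Bn : nbhs w (ball w e%:C%C) by apply: nbhsx_ballx; rewrite ltcR.
  have [_ [[n /= hn <-] hw]] := clw _ _ Fn Bn; exists (x n).
    by case: (hx n).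
  split; last by move: hw; rewrite -ball_normE /= nrmE ltcR nrm_subC.
  have [_ _] := hx n; apply: le_lt_trans; rewrite lerD2l lerN2.
  rewrite -[leRHS]invrK lef_pV2 ?posrE ?invr_gt0 //.
  by apply/ltW/(lt_le_trans (truncnS_gt _)); rewrite ler_nat.
have Vw : V w.
  apply: clV; apply/closure_nrmP => e e0; have [z [Vz _] [_ zw]] := near e e0.
  by exists (T z) => //; exact: VT.
(* Symmetry turns the cross term of the square into [|T z|^2]; the resulting bound tends to 0 along
   a maximizing sequence. *)
have est z : V z -> nrm z <= 1 ->
    nrm (T (T z) - (M ^+ 2)%:C%C *: z) ^+ 2 <= M ^+ 2 * (M ^+ 2 - nrm (T z) ^+ 2).
  move=> Vz z1; rewrite nrmB_sqr nrmZ normc_real ger0_norm ?exprn_ge0 ?(ltW M0) //.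
  rewrite innerZr (_ : ((M ^+ 2)%:C%C : C)^* = (M ^+ 2)%:C%C); last exact: conjc_real.
  rewrite sT ReM_real Re_inner_nrm.
  have : nrm (T (T z)) ^+ 2 <= (M * nrm (T z)) ^+ 2.
    rewrite ler_pXn2r ?nnegrE ?mulr_ge0 ?nrm_ge0 ?(ltW M0) //.
    by apply: Mub; exact: VT.
  have : (M ^+ 2 * nrm z) ^+ 2 <= M ^+ 2 * M ^+ 2.
    rewrite -expr2 ler_pXn2r ?nnegrE ?mulr_ge0 ?exprn_ge0 ?nrm_ge0 ?(ltW M0) //.
    by rewrite ler_piMr // exprn_ge0 // ltW.
  rewrite [(M * nrm (T z)) ^+ 2]exprMn; set a := nrm (T z) ^+ 2; set b := M ^+ 2; lra.
have w0 : w != 0.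
  have [|z [Vz z1] [Tz zw]] := near (M / 2); first by rewrite divr_gt0.
  apply/eqP => w0; move: zw; rewrite w0 subr0; move: Tz; lra.
have SE : T (T w) = (M ^+ 2)%:C%C *: w.
  apply/eqP; rewrite -subr_eq0 -nrm_eq0 -sqrf_eq0 eq_le sqr_ge0 andbT.
  (* The sum of the constants in [n3] and [n2], doubled by [(a + b)^2 <= 2 a^2 + 2 b^2]; since
     [h <= 1], the [h ^ 2] in [n3] may be replaced by [h]. *)
  pose L := 2 * (B ^+ 2 + M ^+ 2) ^+ 2 + 2 * (B ^+ 2 * (M ^+ 2 * (2 * M))).
  have L0 : 0 < L by rewrite addr_gt0 // !mulr_gt0 ?exprn_gt0 ?addr_gt0 ?exprn_gt0 ?mulr_gt0.
  apply/ler_addgt0Pl => e e0; rewrite addr0.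
  pose h := Num.min 1 (e / L).
  have h0 : 0 < h by rewrite lt_min ltr01 divr_gt0.
  have h1 : h <= 1 by rewrite ge_min lexx.
  have he : h * L <= e by rewrite -ler_pdivlMr // ge_min lexx orbT.
  have [z [Vz z1] [Tz zw]] := near h h0.
  have E1 : T (T w) - (M ^+ 2)%:C%C *: w =
     (- (T (T (T z - w)) - (M ^+ 2)%:C%C *: (T z - w)))
       + T (T (T z) - (M ^+ 2)%:C%C *: z).
    rewrite !(bopB bT) (bopZ bT) scalerBr.
    set a := T (T w); set b := T (T (T z)).
    set f := _ *: w; set g := _ *: T z.
    by rewrite !opprB !addrA subrK [g - f + a]addrC addrA addrAC addrK.
  have n1 : nrm (T (T (T z - w)) - (M ^+ 2)%:C%C *: (T z - w)) <= (B ^+ 2 + M ^+ 2) * h.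
    apply: le_trans (nrmB _ _) _; rewrite nrmZ normc_real ger0_norm ?exprn_ge0 ?(ltW M0) //.
    rewrite mulrDl lerD //; last by rewrite ler_pM2l ?exprn_gt0 // ltW.
    apply: le_trans (hB _) _; rewrite expr2 -mulrA ler_pM2l //.
    by apply: le_trans (hB _) _; rewrite ler_pM2l // ltW.
  have n2 : nrm (T (T (T z) - (M ^+ 2)%:C%C *: z)) ^+ 2 <= B ^+ 2 * (M ^+ 2 * (2 * M * h)).
    apply: (@le_trans _ _ ((B * nrm (T (T z) - (M ^+ 2)%:C%C *: z)) ^+ 2)).
      by rewrite ler_pXn2r ?nnegrE ?mulr_ge0 ?nrm_ge0 ?(ltW B0).
    rewrite exprMn ler_pM2l ?exprn_gt0 //; apply: le_trans (est _ Vz z1) _.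
    rewrite ler_pM2l ?exprn_gt0 //.
    have TM : nrm (T z) <= M by apply: le_trans (Mub _ Vz) _; rewrite ler_piMr // ltW.
    have -> : M ^+ 2 - nrm (T z) ^+ 2 = (M - nrm (T z)) * (M + nrm (T z)) by ring.
    have -> : 2 * M * h = h * (M + M) by ring.
    rewrite ler_pM ?subr_ge0 ?addr_ge0 ?nrm_ge0 ?(ltW M0) ?lerD2l //.
    by move: Tz; lra.
  have tri (a b : R) : (a + b) ^+ 2 <= 2 * a ^+ 2 + 2 * b ^+ 2.
    by have := sqr_ge0 (a - b); rewrite sqrrB sqrrD !mulr2n; lra.
  have n3 : nrm (T (T (T z - w)) - (M ^+ 2)%:C%C *: (T z - w)) ^+ 2 <= (B ^+ 2 + M ^+ 2) ^+ 2 * h.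
    apply: (@le_trans _ _ (((B ^+ 2 + M ^+ 2) * h) ^+ 2)).
      by rewrite ler_pXn2r ?nnegrE ?mulr_ge0 ?addr_ge0 ?exprn_ge0 ?nrm_ge0 ?(ltW B0) ?(ltW M0) ?(ltW h0).
    rewrite exprMn ler_wpM2l ?exprn_ge0 ?addr_ge0 ?exprn_ge0 ?(ltW B0) ?(ltW M0) //.
    by rewrite expr2 ler_piMr // ltW.
  apply: le_trans he; rewrite E1.
  apply: (@le_trans _ _ ((nrm (T (T (T z - w)) - (M ^+ 2)%:C%C *: (T z - w)) +
       nrm (T (T (T z) - (M ^+ 2)%:C%C *: z))) ^+ 2)).
    rewrite ler_pXn2r ?nnegrE ?addr_ge0 ?nrm_ge0 //.
    by apply: le_trans (nrmD _ _) _; rewrite nrmN.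
  apply: le_trans (tri _ _) _; rewrite /L; move: n2 n3.
  set a := nrm _ ^+ 2; set b := nrm _ ^+ 2; lra.
have normalize (y : H) (k : R) : V y -> y != 0 -> k != 0 -> T y = k%:C%C *: y ->
    exists2 e, V e & nrm e = 1 /\ exists2 k : R, k != 0 & T e = k%:C%C *: e.
  move=> Vy y0 k0 Ty; have ny : 0 < nrm y by rewrite lt_def nrm_ge0 nrm_eq0 y0.
  exists ((nrm y)^-1%:C%C *: y); first exact: VZ.
  split; first by rewrite nrmZ normc_real ger0_norm ?invr_ge0 ?nrm_ge0 // mulVf // gt_eqF.
  by exists k => //; rewrite bopZ // Ty !scalerA mulrC.
(* As [(T - M) (T + M) w = 0], either [w] is an eigenvector for [- M] or [T w + M w] is one for
   [M]. *)
have [w'0|w'0] := eqVneq (T w + M%:C%C *: w) 0.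
  apply: (normalize w (- M)) => //; first by rewrite oppr_eq0 gt_eqF.
  by rewrite rmorphN scaleNr; apply/eqP; rewrite -addr_eq0 w'0.
apply: (normalize (T w + M%:C%C *: w) M) => //.
- by rewrite addrC; apply: lV => //; exact: VT.
- by rewrite gt_eqF.
rewrite bopD // bopZ // SE scalerDr scalerA -rmorphM -expr2 addrC //.
Qed.

End CompactSymmetric.

(** * Partial inverses and eigenvectors of a selfadjoint operator *)

Section Selfadjoint.
Context {R : realType} {H : hilbertSpace R}.
Local Notation C := R[i].
Implicit Types (x y z : H) (c : C).
Variable D : unbounded_op H.
Hypothesis sD : selfadjoint D.

Lemma conjC_real (r : R) : (r%:C%C : C)^* = r%:C%C.
Proof. exact: conjc_real. Qed.

Lemma uopE x y : udom D x -> udom D y -> '[D x, y] = '[x, D y].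
Proof.
move=> dx dy; have [_ sG] := sD.
have : ugraph D (y, D y) by [].
by rewrite -sG /= => /(_ x dx).
Qed.

(** The half of selfadjointness that symmetry does not give. It turns a weak equation into
    membership in the domain, or in the kernel when [w = 0]. *)
Lemma uop_adjoint (u w : H) : (forall x, udom D x -> '[D x, u] = '[x, w]) ->
  udom D u /\ D u = w.
Proof.
move=> h; have [_ sG] := sD.
have : adjoint_graph D (u, w) by [].
by rewrite sG => -[/= ? ->].
Qed.

Lemma udomZ c x : udom D x -> udom D (c *: x) /\ D (c *: x) = c *: D x.
Proof.
move=> dx; have d0 := udom0 D.
have D0 : D 0 = 0.
  by have := uop_linear (-1) d0 d0; rewrite !scaleN1r oppr0 addr0 addNr.
by split; [rewrite -[_ *: x]addr0; apply: udomP|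
           rewrite -[c *: x]addr0 uop_linear // D0 addr0].
Qed.

Lemma udomD x y : udom D x -> udom D y -> udom D (x + y) /\ D (x + y) = D x + D y.
Proof.
move=> dx dy; rewrite -[x]scale1r; split; first exact: udomP.
by rewrite uop_linear // !scale1r.
Qed.

Lemma udomB x y : udom D x -> udom D y -> udom D (x - y) /\ D (x - y) = D x - D y.
Proof.
move=> dx dy; have [dy' Dy] := udomZ (-1) dy; rewrite !scaleN1r in dy' Dy.
by have [? ?] := udomD dx dy'; rewrite -Dy.
Qed.

Lemma ukernel_linset : linset (ukernel D).
Proof.
split; first by split; [exact: udom0|have [_] := udomZ 0 (udom0 D); rewrite !scale0r].
move=> c x y [dx Dx] [dy Dy]; split; first exact: udomP.
by rewrite uop_linear // Dx Dy scaler0 addr0.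
Qed.

Lemma ukernel_closed x : closure (ukernel D) x -> ukernel D x.
Proof.
move=> /closure_seq[u ku ux]; apply: uop_adjoint => y dy; rewrite inner0r innerC.
rewrite (scvg_inner_eq (c := 0) ux) ?conjC0 // => n.
by have [dn Dn] := ku n; rewrite -uopE // Dn inner0l.
Qed.

Lemma ukernel_proj x : exists2 k, ukernel D k & forall v, ukernel D v -> '[x - k, v] = 0.
Proof.
have [k ck hk] := projection_ex x ukernel_linset.
by exists k => //; exact: ukernel_closed.
Qed.

Variable T : H -> H.
Hypothesis pT : is_partial_inverse D T.
Let bT : bounded_op T. Proof. by case: pT. Qed.

Let ker_perp x := forall v, ukernel D v -> '[x, v] = 0.

(** A vector orthogonal to this subspace is orthogonal to the range of [D], so it lies in the kernel
    by selfadjointness; being orthogonal to the kernel as well, it is 0. On this subspace the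
    definition of a partial inverse prescribes the values of [T]. *)
Lemma partial_inverse_dense z :
  closure [set w | exists k x, [/\ ukernel D k, udom D x, ker_perp x & w = k + D x]] z.
Proof.
set W := [set w | _].
have lW : linset W.
  split.
    exists 0, 0; have [k0 _] := ukernel_linset.
    split => //; [exact: udom0|by move=> v _; rewrite inner0l|].
    by rewrite (proj2 k0) addr0.
  move=> c _ _ [k [x [kk dx px ->]]] [l [y [kl dy py ->]]].
  exists (c *: k + l), (c *: x + y); split.
  - by case: ukernel_linset => _; apply.
  - exact: udomP.
  - by move=> v kv; rewrite innerDl innerZl px // py // mulr0 addr0.
  - by rewrite uop_linear // scalerDr addrACA.
have [y cy hy] := projection_ex z lW.
suff -> : z = y by [].
apply/eqP; rewrite -subr_eq0; apply/eqP/inner_eq0.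
have [k kk hk] := ukernel_proj (z - y).
have zk v : ukernel D v -> '[z - y, v] = 0.
  move=> kv; apply: hy; exists v, 0; split => //; first exact: udom0.
    by move=> w _; rewrite inner0l.
  by have [k0 _] := ukernel_linset; rewrite (proj2 k0) addr0.
suff kzy : ukernel D (z - y) by exact: zk.
apply: uop_adjoint => x dx; rewrite inner0r.
have [l kl hl] := ukernel_proj x.
have [dl Dl] := udomB dx (proj1 kl).
have -> : D x = D (x - l) by rewrite Dl (proj2 kl) subr0.
rewrite innerC hy ?conjC0 //; exists 0, (x - l); split => //.
  by case: ukernel_linset.
by rewrite add0r.
Qed.

(** On the dense subspace [T (k + D x) = x], and the claim reduces to the symmetry of [D];
    continuity of [T] extends it first in the second argument, then in the first. *)
Lemma partial_inverse_sym : is_adjoint T T.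
Proof.
have [_ Tk TD] := pT.
have TW k x : ukernel D k -> udom D x -> ker_perp x -> T (k + D x) = x.
  by move=> kk dx px; rewrite bopD // Tk // add0r TD.
move=> y z.
have [u hu uy] := closure_seq (@partial_inverse_dense y).
have [v hv vz] := closure_seq (@partial_inverse_dense z).
have h1 n m : '[T (u n), v m] = '[u n, T (v m)].
  have [k [x [kk dx px ->]]] := hu n; have [l [w [kl dw pw ->]]] := hv m.
  rewrite !TW // innerDr px // add0r innerDl [X in _ = X + _]innerC pw // conjC0 add0r.
  by rewrite uopE.
have h2 n : '[T (u n), z] = '[u n, T z].
  rewrite innerC [RHS]innerC; congr (_^*).
  by apply: scvg_inner_eq2 vz (scvg_bop bT vz) _ => m; rewrite innerC h1 -innerC.
exact: scvg_inner_eq2 (scvg_bop bT uy) uy h2.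
Qed.

Lemma partial_inverse_perp z v : ukernel D v -> '[T z, v] = 0.
Proof. by move=> kv; have [_ Tk _] := pT; rewrite partial_inverse_sym Tk // inner0r. Qed.

(** With [k] the kernel part of [v], the vector [v - k] is orthogonal to the whole domain, whose
    elements are values of [T] modulo the kernel. The domain being dense, [v = k]. *)
Lemma partial_inverse_eq0 v : T v = 0 -> ukernel D v.
Proof.
move=> Tv; have [_ Tk TD] := pT; have [k kk hk] := ukernel_proj v.
suff -> : v = k by [].
apply/eqP; rewrite -subr_eq0; apply/eqP.
have Z x : udom D x -> '[v - k, x] = 0.
  move=> dx; have [l kl hl] := ukernel_proj x.
  have [dxl Dxl] := udomB dx (proj1 kl).
  rewrite -[x](subrK l) innerDr (hk l) // addr0 -(TD (x - l)) // -partial_inverse_sym.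
  by rewrite bopB // Tv Tk // subr0 inner0l.
have [dD _] := sD; move: dD => /denseP dD.
apply: (@nrm_le_eps _ _ 0) => e e0; rewrite leNgt; apply/negP => le.
have [x dx hx] := dD (v - k) e e0.
have := Re_inner_nrm (v - k); rewrite -{2}[v - k](subrK x) innerDr (Z x dx) addr0.
move=> E; have := Re_le_normc '[v - k, v - k - x]; rewrite E.
move=> h; have := le_trans h (cauchy_schwarz _ _); rewrite expr2 ler_pM2l; last exact: lt_trans e0 le.
by rewrite [nrm (v - k - x)]nrm_subC leNgt (lt_trans hx le).
Qed.

Lemma partial_inverse_eigen e (k : R) : k != 0 -> T e = k%:C%C *: e ->
  udom D e /\ D e = k^-1%:C%C *: e.
Proof.
move=> k0 Te; have [_ Tk TD] := pT.
have kC : k%:C%C != 0 :> C by rewrite fmorph_eq0.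
have eE : e = k^-1%:C%C *: T e by rewrite Te scalerA -rmorphM mulVf // scale1r.
have pe v : ukernel D v -> '[e, v] = 0.
  by move=> kv; rewrite eE innerZl partial_inverse_perp // mulr0.
apply: uop_adjoint => x dx; have [l kl hl] := ukernel_proj x.
have [dxl Dxl] := udomB dx (proj1 kl).
have -> : D x = D (x - l) by rewrite Dxl (proj2 kl) subr0.
rewrite {1}eE !innerZr -partial_inverse_sym TD // innerBl [X in _ - X]innerC pe //.
by rewrite conjC0 subr0.
Qed.

Lemma eigen_partial_inverse e (l : R) : udom D e -> D e = l%:C%C *: e ->
  T e = l^-1%:C%C *: e.
Proof.
move=> de De; have [_ Tk TD] := pT.
(* The convention [0^-1 = 0] agrees with [T] vanishing on the kernel. *)
have [l0|l0] := eqVneq l 0.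
  by rewrite l0 invr0 scale0r Tk //; split=> //; rewrite De l0 scale0r.
have : T (D e) = e.
  apply: TD => // v [dv Dv].
  have : '[D e, v] = 0 by rewrite uopE // Dv inner0r.
  by rewrite De innerZl => /eqP; rewrite mulf_eq0 fmorph_eq0 (negbTE l0) => /eqP.
by rewrite De bopZ // => E; rewrite -{2}E scalerA -rmorphM mulVf // scale1r.
Qed.

Hypothesis cT : compact_op T.
Hypothesis sepH : separable_space H.

Definition eigenset : set H := [set e | nrm e = 1 /\ exists l : R, udom D e /\ D e = l%:C%C *: e].

Let ons (E : set H) := E `<=` eigenset /\ forall e f, E e -> E f -> e != f -> '[e, f] = 0.

(** Zorn's lemma gives a maximal orthonormal set of eigenvectors of [D]. Its orthogonal complement
    is closed and invariant under [T]. If [T] is not zero there, the compact symmetric operator [T]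
    has an eigenvector in it; if [T] is zero there, the complement lies in the kernel of [D]. A
    nonzero vector in it would thus contradict maximality. *)
Lemma eigenset_total : exists2 E, ons E & forall x, (forall e, E e -> '[x, e] = 0) -> x = 0.
Proof.
have [|E [onsE maxE]] := @Zorn_bigcup H ons.
  move=> F FP totF; split; first by move=> e [E FE Ee]; apply: (FP E FE).1.
  move=> e f [E FE Ee] [E' FE' Ef] ef.
  by have [s|s] := totF _ _ FE FE'; [apply: (FP E' FE').2 => //; exact: s|
    apply: (FP E FE).2 => //; exact: s].
exists E => // v0 hv0; apply/eqP; apply: contrapT => /negP v00.
pose V := [set x : H | forall e, E e -> '[x, e] = 0].
have sV : linset V.
  split; first by move=> e _; rewrite inner0l.
  by move=> c x y Vx Vy e Ee; rewrite innerDl innerZl Vx // Vy // mulr0 addr0.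
have cV x : closure V x -> V x.
  move=> /closure_seq[u uV ux] e Ee; apply: scvg_inner_eq ux _ => n.
  exact: uV.
have TV x : V x -> V (T x).
  move=> Vx e Ee; rewrite partial_inverse_sym.
  have [_ [l [de De]]] := onsE.1 e Ee.
  by rewrite (eigen_partial_inverse de De) innerZr Vx // mulr0.
suff [f Vf [nf ef]] : exists2 f, V f & eigenset f.
  apply: (maxE (E `|` [set f])).
    split; first by left.
    move=> /(_ f) /(_ (or_intror erefl)) Ef.
    have := Vf f Ef; rewrite inner_nrm nf expr1n => /eqP.
    by rewrite fmorph_eq0 oner_eq0.
  split=> [e [/onsE.1//|->//]|e g].
  move=> [Ee|->] [Eg|->] eg; rewrite ?eqxx // in eg *; first exact: onsE.2.
    by rewrite innerC Vf // conjC0.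
  exact: Vf.
have [[x Vx Tx]|noT] := pselect (exists2 v, V v & T v != 0).
  have [|e Ve [ne [k k0 Te]]] := compact_symmetric_eigenvector cT partial_inverse_sym cV sV TV.
    by exists x.
  exists e => //; split => //; exists k^-1; exact: partial_inverse_eigen.
have Tv0 : T v0 = 0.
  by apply/eqP; apply: contrapT => /negP h; apply: noT; exists v0.
have nv : 0 < nrm v0 by rewrite lt_def nrm_ge0 nrm_eq0 v00.
exists ((nrm v0)^-1%:C%C *: v0).
  by move=> e Ee; rewrite innerZl hv0 // mulr0.
split; first by rewrite nrmZ normc_real ger0_norm ?invr_ge0 ?nrm_ge0 // mulVf // gt_eqF.
have [dv Dv] := partial_inverse_eq0 Tv0.
have [? DZ] := udomZ (nrm v0)^-1%:C%C dv.
by exists 0; split=> //; rewrite DZ Dv scaler0 scale0r.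
Qed.

(** Distinct members are at distance [sqrt 2], so points of a countable dense set chosen within 1/2
    of them are distinct. *)
Lemma orthonormal_countable (E : set H) : ons E -> countable E.
Proof.
move=> [En Eo]; have [S cS /denseP dS] := sepH.
have /choice[s hs] (e : H) : exists v, S v /\ nrm (v - e) < 2^-1.
  by have [|v Sv hv] := dS e 2^-1; [rewrite invr_gt0|exists v].
have /countable_injP[f fI] := cS.
apply/countable_injP; exists (f \o s) => e g /set_mem Ee /set_mem Eg /= h.
have {}h : s e = s g.
  by apply: fI => //; apply/mem_set; [exact: (hs e).1|exact: (hs g).1].
apply/eqP; apply: contrapT => /negP eg.
have := Eo _ _ Ee Eg eg => eg0.
have := nrmB_sqr e g; rewrite eg0 (En _ Ee).1 (En _ Eg).1 /= mulr0 subr0.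
have := (hs e).2; have := (hs g).2; rewrite -h => h1 h2.
have : nrm (e - g) < 1.
  have := nrm_tri (s e) e g; rewrite [in X in _ <= X + _]nrm_subC; move: h1 h2.
  by move: (nrm _) (nrm _) (nrm _) => a b c; lra.
move=> h3 E2; have : nrm (e - g) ^+ 2 < 1 by rewrite expr_lt1 ?nrm_ge0.
by rewrite E2; lra.
Qed.

(* Padding by zero vectors makes room for finite-dimensional spaces. *)
Lemma eigenbasis_ex : exists (e : nat -> H) (l : nat -> R) (d : nat -> bool),
  [/\ forall i j, '[e i, e j] = ((i == j) && d i)%:R,
      forall x, (forall i, '[x, e i] = 0) -> x = 0,
      forall i, udom D (e i) /\ D (e i) = (l i)%:C%C *: e i &
      forall i, ~~ d i -> l i = 0].
Proof.
have [E onsE totE] := eigenset_total.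
have /countable_injP[f fI] := orthonormal_countable onsE.
pose P n := [set e | E e /\ f e = n].
pose e n := xget 0 (P n).
pose d n := `[< exists e, P n e >].
have dP n : d n -> P n (e n).
  by move=> /asboolP h; exact: xgetPex h.
have dN n : ~~ d n -> e n = 0.
  move=> /asboolP h; rewrite /e; case: xgetP => // x _ Px.
  by exfalso; apply: h; exists x.
have /choice[l hl] n : exists l : R, (udom D (e n) /\ D (e n) = l%:C%C *: e n) /\ (~~ d n -> l = 0).
  have [dn|dn] := boolP (d n).
    by have [/onsE.1[_ [l hl]] _] := dP n dn; exists l.
  exists 0; split=> //; rewrite dN // scaler0; split; first exact: udom0.
  by have [_] := udomZ 0 (udom0 D); rewrite !scale0r.
exists e, l, d; split.
- move=> i j; have [di|di] := boolP (d i); last by rewrite dN // inner0l andbF.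
  have [<-|ij] := eqVneq i j.
    have [/onsE.1[h _] _] := dP i di.
    by rewrite inner_nrm h expr1n.
  have [dj|dj] := boolP (d j); last by rewrite (dN j) // inner0r.
  have [Ei fi] := dP i di; have [Ej fj] := dP j dj.
  by apply: onsE.2 => //; apply/eqP => eij; move: ij; rewrite -fi -fj eij eqxx.
- move=> x h; apply: totE => g Eg.
  have dg : d (f g) by apply/asboolP; exists g.
  have [Ee fe] := dP _ dg.
  have E2 : g = e (f g) by apply: fI; rewrite ?fe //; apply/mem_set.
  by rewrite E2; exact: h.
- by move=> i; case: (hl i).
- by move=> i; case: (hl i).
Qed.

End Selfadjoint.

(** * Coordinates and matrices in a countable basis, padded by zero vectors *)

Section Basis.
Context {R : realType} {H : hilbertSpace R}.
Local Notation C := R[i].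
Implicit Types (x y z : H) (c : C).
Variables (e : nat -> H) (d : nat -> bool).
Hypothesis he : forall i j, '[e i, e j] = ((i == j) && d i)%:R.
Hypothesis tot : forall x, (forall i, '[x, e i] = 0) -> x = 0.

Lemma basis_dead i : ~~ d i -> e i = 0.
Proof. by move=> di; apply: inner_eq0; rewrite he (negbTE di) andbF. Qed.

Lemma coord_dead x i : ~~ d i -> '[x, e i] = 0.
Proof. by move=> /basis_dead ->; rewrite inner0r. Qed.

Lemma inner_comb N (c : nat -> C) j :
  '[\sum_(i < N) c i *: e i, e j] = if (j < N)%N && d j then c j else 0.
Proof.
rewrite inner_suml; under eq_bigr do rewrite innerZl he.
have [jN|jN] /= := ltnP j N.
  rewrite (bigD1 (Ordinal jN)) //= eqxx big1 ?addr0.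
    by case: (d j); rewrite ?mulr1 ?mulr0.
  by move=> i; rewrite -val_eqE /= => /negbTE ->; rewrite mulr0.
by rewrite big1 // => i _; rewrite ltn_eqF ?mulr0 // (leq_trans (ltn_ord i)).
Qed.

Lemma inner_comb2 N (c : nat -> C) y :
  '[y, \sum_(i < N) c i *: e i] = \sum_(i < N) (c i)^* * '[y, e i].
Proof. by rewrite inner_sumr; apply: eq_bigr => i _; rewrite innerZr. Qed.

Lemma nrm_comb N (c : nat -> C) :
  nrm (\sum_(i < N) c i *: e i) ^+ 2 = \sum_(i < N | d i) normc (c i) ^+ 2.
Proof.
rewrite -Re_inner_nrm inner_comb2 Re_sum [RHS]big_mkcond /=.
apply: eq_bigr => i _; rewrite inner_comb ltn_ord /=.
by case: (d i); rewrite ?mulr0 // mulrC mul_conjC.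
Qed.

Definition btrunc N x := \sum_(i < N) '[x, e i] *: e i.

Lemma inner_btrunc N x j : '[btrunc N x, e j] = if (j < N)%N then '[x, e j] else 0.
Proof.
rewrite /btrunc (inner_comb N (fun i => '[x, e i])); case: (j < N)%N => //=.
by case: (boolP (d j)) => // /coord_dead ->.
Qed.

Lemma nrm_btrunc N x : nrm (btrunc N x) ^+ 2 = \sum_(i < N) normc '[x, e i] ^+ 2.
Proof.
rewrite /btrunc (nrm_comb N (fun i => '[x, e i])) big_mkcond; apply: eq_bigr => i _.
by case: (boolP (d i)) => // /coord_dead ->; rewrite normc0 expr0n.
Qed.

Lemma bessel N x : \sum_(i < N) normc '[x, e i] ^+ 2 <= nrm x ^+ 2.
Proof.
rewrite -nrm_btrunc -{2}[x](subrK (btrunc N x)) addrC pythagoras.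
  by rewrite lerDl sqr_ge0.
rewrite /btrunc inner_suml big1 // => i _.
rewrite innerZl innerBr [X in _ - X]innerC inner_btrunc ltn_ord -innerC subrr.
by rewrite mulr0.
Qed.

Lemma nrm_btrunc_le N x : nrm (btrunc N x) <= nrm x.
Proof.
by rewrite -(@ler_pXn2r _ 2) ?nnegrE ?nrm_ge0 // nrm_btrunc bessel.
Qed.

Lemma riesz_fischer (c : nat -> C) (M : R) : 0 <= M ->
  (forall i, ~~ d i -> c i = 0) ->
  (forall N, \sum_(i < N) normc (c i) ^+ 2 <= M ^+ 2) ->
  exists y, [/\ forall i, '[y, e i] = c i, nrm y <= M &
     scvg (fun N => \sum_(i < N) c i *: e i) y].
Proof.
move=> M0 cd cM; pose s N : R := \sum_(i < N) normc (c i) ^+ 2.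
pose S N := \sum_(i < N) c i *: e i.
have nS N : nrm (S N) ^+ 2 = s N.
  rewrite nrm_comb /s big_mkcond; apply: eq_bigr => i _.
  by case: (boolP (d i)) => // /cd ->; rewrite normc0 expr0n.
have sS m n : (n <= m)%N -> nrm (S m - S n) ^+ 2 = s m - s n.
  move=> nm; rewrite nrmB_sqr !nS inner_comb2 Re_sum.
  have -> : \sum_(i < n) complex.Re ((c i)^* * '[S m, e i]) = s n.
    apply: eq_bigr => i _; rewrite inner_comb (leq_trans (ltn_ord i) nm) /=.
    case: (boolP (d i)) => [_|/cd ->]; first by rewrite mulrC mul_conjC.
    by rewrite mulr0 normc0 expr0n.
  by rewrite mulr_natl mulr2n opprD addrA addrK.
have s_homo m n : (n <= m)%N -> s n <= s m.
  by move=> nm; rewrite -subr_ge0 -sS // sqr_ge0.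
have sup_s : has_sup (range s).
  by split; [exists (s 0%N); exists 0%N|exists (M ^+ 2) => _ [n _ <-]; exact: cM].
have [|y Sy] := hilbert_complete (u := S).
  move=> eps eps0; have [|_ [N _ <-] hN] := sup_adherent (eps := eps ^+ 2) _ sup_s.
    by rewrite exprn_gt0.
  have key m n : (N <= n)%N -> (n <= m)%N -> nrm (S m - S n) < eps.
    move=> Nn nm; rewrite -(@ltr_pXn2r _ 2) ?nnegrE ?nrm_ge0 ?(ltW eps0) // sS //.
    have := s_homo _ _ Nn.
    have : s m <= sup (range s) by apply: ub_le_sup; [case: sup_s|exists m].
    by move: hN; lra.
  exists N => m n Nm Nn; have [nm|/ltnW mn] := leqP n m; first exact: key.
  by rewrite nrm_subC; exact: key.
exists y; split => //.
(* Shifted past [i], the partial sums have a constant [i]-th coordinate, as [scvg_inner_eq]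
   requires. *)
- move=> i; have Sk : scvg (fun N => S (i.+1 + N)%N) y.
    by move=> eps /Sy[N hN]; exists N => n /leq_trans h; apply/hN/h/leq_addl.
  apply: scvg_inner_eq Sk _ => N; rewrite inner_comb leq_addr /=.
  by case: (boolP (d i)) => // /cd ->.
- apply: scvg_nrm_le Sy _ => N.
  by rewrite -(@ler_pXn2r _ 2) ?nnegrE ?nrm_ge0 // nS; exact: cM.
Qed.

Lemma coord_inj x y : (forall i, '[x, e i] = '[y, e i]) -> x = y.
Proof.
move=> h; apply/eqP; rewrite -subr_eq0; apply/eqP/tot => i.
by rewrite innerBl h subrr.
Qed.

Lemma btrunc_cvg x : scvg (fun N => btrunc N x) x.
Proof.
have [y [yc _ cy]] := riesz_fischer (nrm_ge0 x) (@coord_dead x) (bessel^~ x).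
by rewrite -{2}(coord_inj yc).
Qed.
Lemma inner_coord_eq x y x' y' :
  (forall i, '[x, e i] * ('[y, e i])^* = '[x', e i] * ('[y', e i])^*) ->
  '[x, y] = '[x', y'].
Proof.
move=> h; apply: scvg_inner_eq2 (@btrunc_cvg x) (@btrunc_cvg x') _ => N.
rewrite /btrunc !inner_suml; apply: eq_bigr => i _; rewrite !innerZl.
by rewrite (innerC (e i) y) (innerC (e i) y').
Qed.

Lemma op_basis_inj (S T : H -> H) : bounded_op S -> bounded_op T ->
  (forall n m, '[S (e n), e m] = '[T (e n), e m]) -> S = T.
Proof.
move=> bS bT h; apply/funext => x.
have E n : S (e n) = T (e n) by apply: coord_inj.
have hS := scvg_bop bS (@btrunc_cvg x); have hT := scvg_bop bT (@btrunc_cvg x).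
apply: scvg_unique hS _; congr (scvg _ _): hT; apply/funext => N /=.
rewrite /btrunc !bop_sum //; apply: eq_bigr => i _.
by rewrite !bopZ // E.
Qed.

Lemma bounded_op_rank1 (r f : H) : bounded_op (fun x => '[x, r] *: f).
Proof.
apply: (@bopP _ _ _ (nrm r * nrm f)).
  by move=> c x y; rewrite innerDl innerZl scalerDl scalerA.
move=> x; rewrite nrmZ mulrAC ler_wpM2r ?nrm_ge0 // mulrC.
exact: cauchy_schwarz.
Qed.

Lemma bounded_op_sum (I : Type) (r : seq I) (P : pred I) (F : I -> H -> H) :
  (forall i, P i -> bounded_op (F i)) -> bounded_op (\sum_(i <- r | P i) F i).
Proof.
move=> h; elim/big_ind: _ => //; first exact: bounded_op0.
by move=> S T bS bT; exact: bounded_opD.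
Qed.

Definition matrix_form N K (c : nat -> nat -> C) (x y : nat -> C) : C :=
  \sum_(m < N) \sum_(n < K) c m n * x n * (y m)^*.

(** The rows are square summable, hence given by inner products with vectors [r m], and the numbers
    ['[x, r m]] are then the coordinates of [X x]. The additive form of the hypothesis is the one
    that Schur multiplier estimates produce; a suitable scaling of [y] turns it into a bound by a
    product. *)
Lemma op_of_matrix (c : nat -> nat -> C) (M : R) : 0 < M ->
  (forall m n, ~~ d m || ~~ d n -> c m n = 0) ->
  (forall N K (x y : nat -> C), complex.Re (matrix_form N K c x y) <=
     M / 2 * (\sum_(n < K) normc (x n) ^+ 2 + \sum_(m < N) normc (y m) ^+ 2)) ->
  exists X, [/\ bounded_op X, forall n m, '[X (e n), e m] = c m n &
    forall x, nrm (X x) <= M * nrm x].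
Proof.
move=> M0 cd cM.
have /choice[r hr] m : exists r, forall n, '[e n, r] = c m n.
  have [|i|N|r [hr _ _]] := @riesz_fischer (fun n => (c m n)^*) M.
  - exact: ltW.
  - by move=> di; rewrite cd ?di ?orbT // conjC0.
  - pose S := \sum_(i < N) normc (c m i) ^+ 2.
    (* For [x] the conjugate of row [m] and [y] equal to [M] at [m] only, the hypothesis reads
       [M S <= M / 2 (S + M ^ 2)], that is [S <= M ^ 2]. *)
    have := cM m.+1 N (fun n => (c m n)^*) (fun k => if k == m then M%:C%C else 0).
    rewrite /matrix_form big_ord_recr /= big1 ?add0r; last first.
      move=> i _; rewrite big1 // => n _.
      by rewrite ltn_eqF // conjC0 mulr0.
    rewrite Re_sum big_ord_recr /= [X in X + normc _ ^+ 2]big1 ?add0r; last first.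
      by move=> i _; rewrite ltn_eqF // normc0 expr0n.
    rewrite eqxx conjC_real.
    have -> : \sum_(i < N) complex.Re (c m i * (c m i)^* * M%:C%C) = M * S.
      rewrite /S mulr_sumr; apply: eq_bigr => i _.
      by rewrite mulrC ReM_real mul_conjC.
    have -> : \sum_(i < N) normc (c m i)^* ^+ 2 = S.
      by apply: eq_bigr => i _; rewrite normc_conj.
    rewrite normc_real real_normK ?num_real // [leLHS]mulrC => h.
    have : M * S <= M * ((S + M ^+ 2) / 2) by rewrite mulrC; apply: le_trans h _; lra.
    by rewrite ler_pM2l //; lra.
  by exists r => n; rewrite innerC hr conjCK.
have est N x : \sum_(m < N) normc '[x, r m] ^+ 2 <= (M * nrm x) ^+ 2.
  pose A : H -> H := \sum_(m < N) (fun x => '[x, r m] *: e m).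
  have bA : bounded_op A by apply: bounded_op_sum => i _; exact: bounded_op_rank1.
  have AE z : A z = \sum_(m < N) '[z, r m] *: e m by rewrite /A fct_sumE.
  have nA z : nrm (A z) ^+ 2 = \sum_(m < N) normc '[z, r m] ^+ 2.
    rewrite AE (nrm_comb N (fun m => '[z, r m])) big_mkcond; apply: eq_bigr => i _.
    case: (boolP (d i)) => // di; suff -> : r i = 0 by rewrite inner0r normc0 expr0n.
    by apply: tot => n; rewrite innerC hr cd ?di // conjC0.
  have AK K : nrm (A (btrunc K x)) <= M * nrm x.
    rewrite -(@ler_pXn2r _ 2) ?nnegrE ?mulr_ge0 ?nrm_ge0 ?(ltW M0) // nA exprMn.
    set V := \sum_(m < N) _.
    apply: (@le_trans _ _ (M ^+ 2 * nrm (btrunc K x) ^+ 2)); last first.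
      rewrite ler_pM2l ?exprn_gt0 // ler_pXn2r ?nnegrE ?nrm_ge0 //.
      exact: nrm_btrunc_le.
    (* The factor [M^-1] in [y] makes the hypothesis [M^-1 V <= M / 2 (w + M^-2 V)] with [w] the
       squared norm of the truncation, that is [V <= M ^ 2 w]. *)
    have := cM N K (fun n => '[x, e n]) (fun m => M^-1%:C%C * '[btrunc K x, r m]).
    have -> : complex.Re (matrix_form N K c (fun n => '[x, e n])
       (fun m => M^-1%:C%C * '[btrunc K x, r m])) = M^-1 * V.
      rewrite /matrix_form /V mulr_sumr Re_sum; apply: eq_bigr => m _.
      rewrite -mulr_suml.
      have -> : \sum_(i < K) c m i * '[x, e i] = '[btrunc K x, r m].
        rewrite /btrunc inner_suml; apply: eq_bigr => i _.
        by rewrite innerZl hr mulrC.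
      rewrite rmorphM /= (conjC_real M^-1) mulrCA ReM_real.
      by rewrite mul_conjC.
    rewrite -nrm_btrunc.
    have -> : \sum_(m < N) normc (M^-1%:C%C * '[btrunc K x, r m]) ^+ 2 = (M^-1) ^+ 2 * V.
      rewrite /V mulr_sumr; apply: eq_bigr => m _.
      by rewrite normcM normc_real exprMn real_normK ?num_real.
    set w := nrm _ ^+ 2 => h.
    have : M * (M^-1 * V) <= M * (M / 2 * (w + M^-1 ^+ 2 * V)) by rewrite ler_pM2l.
    have -> : M * (M / 2 * (w + M^-1 ^+ 2 * V)) = (M ^+ 2 * w + V) / 2.
      by field; rewrite gt_eqF.
    by rewrite mulrA mulfV ?gt_eqF // mul1r; lra.
  rewrite -nA ler_pXn2r ?nnegrE ?mulr_ge0 ?nrm_ge0 ?(ltW M0) //.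
  exact: scvg_nrm_le (scvg_bop bA (@btrunc_cvg x)) AK.
have /choice[X hX] x : exists y, (forall m, '[y, e m] = '[x, r m]) /\ nrm y <= M * nrm x.
  have [|i|N|y [hy ny _]] := @riesz_fischer (fun m => '[x, r m]) (M * nrm x).
  - by rewrite mulr_ge0 ?nrm_ge0 ?ltW.
  - move=> di; suff -> : r i = 0 by rewrite inner0r.
    by apply: tot => n; rewrite innerC hr cd ?di // conjC0.
  - exact: est.
  by exists y.
exists X; split => [|n m|x]; last exact: (hX x).2.
  apply: (@bopP _ _ _ M) => [a x y|x]; last exact: (hX x).2.
  apply: coord_inj => m.
  by rewrite innerDl innerZl !(hX _).1 innerDl innerZl.
by rewrite (hX _).1 hr.
Qed.

Lemma diag_ex (f : nat -> R) (M : R) : 0 <= M -> (forall i, d i -> `|f i| <= M) ->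
  exists X, [/\ bounded_op X, forall x i, '[X x, e i] = (f i)%:C%C * '[x, e i] &
    forall x, nrm (X x) <= M * nrm x].
Proof.
move=> M0 fM.
have /choice[X hX] x : exists y,
    (forall i, '[y, e i] = (f i)%:C%C * '[x, e i]) /\ nrm y <= M * nrm x.
  have [|i|N|y [hy ny _]] := @riesz_fischer (fun i => (f i)%:C%C * '[x, e i]) (M * nrm x).
  - by rewrite mulr_ge0 ?nrm_ge0.
  - by move=> /coord_dead ->; rewrite mulr0.
  - rewrite exprMn; apply: le_trans (ler_wpM2l (exprn_ge0 2 M0) (bessel N x)).
    rewrite mulr_sumr; apply: ler_sum => i _; rewrite normcM normc_real exprMn.
    case: (boolP (d i)) => [di|/coord_dead ->]; last by rewrite normc0 expr0n !mulr0.
    by rewrite ler_wpM2r ?sqr_ge0 // ler_pXn2r ?nnegrE // fM.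
  by exists y.
exists X; split => [|x i|x]; [|exact: (hX x).1|exact: (hX x).2].
apply: (@bopP _ _ _ M) => [a x y|x]; last exact: (hX x).2.
apply: coord_inj => m.
by rewrite innerDl innerZl !(hX _).1 innerDl innerZl mulrDr mulrCA.
Qed.

End Basis.

(** * Schur multipliers *)

Section Kernel.
Context {R : realType}.
Let mu := @lebesgue_measure R.
Implicit Types (s t u x y : R).

(** In the variable [t = expR u] this is [t^s / (1 + t)], the integrand of the resolvent formula for
    powers with respect to [dt / t]. The logarithmic variable turns dilations into translations,
    under which Lebesgue measure is invariant. *)
Definition logistic s u := expR (s * u) / (1 + expR u).

Lemma den_gt0 u : 0 < 1 + expR u. Proof. by rewrite addr_gt0 ?expR_gt0. Qed.

Lemma logistic_gt0 s u : 0 < logistic s u.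
Proof. by rewrite divr_gt0 ?expR_gt0 ?den_gt0. Qed.

Lemma continuous_expRZ s : continuous (fun u => expR (s * u)).
Proof.
move=> u; apply: continuous_comp; last exact: continuous_expR.
by apply: (@continuousM _ R^o (fun=> s) id) => //; exact: cst_continuous.
Qed.

Lemma continuous_logistic s : continuous (logistic s).
Proof.
move=> u; apply: (@cvgM _ _ _ _ (fun u => expR (s * u)) (fun u => (1 + expR u)^-1)).
  exact: continuous_expRZ.
apply: (@cvgV _ _ _ _ (fun u => 1 + expR u)); first by rewrite gt_eqF // den_gt0.
by apply: cvgD; [exact: cvg_cst|exact: continuous_expR].
Qed.

(** The numerator decays with rate [s] at -oo; at +oo the denominator leaves the rate [1 - s]. *)
Lemma logistic_le s u : 0 < s < 1 -> logistic s u <= expR (- Num.min s (1 - s) * `|u|).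
Proof.
move=> /andP[s0 s1]; rewrite ler_pdivrMr ?den_gt0 // mulrDr mulr1 -expRD.
have m1 : Num.min s (1 - s) <= s by rewrite ge_min lexx.
have m2 : Num.min s (1 - s) <= 1 - s by rewrite ge_min lexx orbT.
set m := Num.min _ _ in m1 m2 *.
have [u0|u0] := lerP 0 u.
  rewrite ger0_norm //.
  apply: (@le_trans _ _ (expR (- m * u + u))); last by rewrite lerDr expR_ge0.
  by rewrite ler_expR; nra.
rewrite ltr0_norm //.
apply: (@le_trans _ _ (expR (- m * - u))); last by rewrite lerDl expR_ge0.
by rewrite ler_expR; nra.
Qed.

Lemma measurable_continuous (f : R -> R) : continuous f -> measurable_fun [set: R] (EFin \o f).
Proof. by move=> cf; apply/measurable_EFinP; exact: continuous_measurable_fun. Qed.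

(** By symmetry the integral is twice that over the half-line, where the integrand is [m^-1] times
    the exponential density. *)
Lemma integrable_laplace (m : R) : 0 < m ->
  mu.-integrable setT (EFin \o (fun u => expR (- m * `|u|))).
Proof.
move=> m0; have cf : continuous (fun u => expR (- m * `|u|)).
  move=> u; apply: (@continuous_comp _ _ _ (fun u : R => `|u|) (fun v => expR (- m * v))).
    exact: norm_continuous.
  exact: continuous_expRZ.
apply/integrableP; split; first exact: measurable_continuous.
under eq_integral do rewrite /= ger0_norm ?expR_ge0 //.
rewrite (@ge0_symfun_integralT _ (fun u => expR (- m * `|u|))) //; last first.
  by move=> x /=; rewrite normrN.
rewrite lte_mul_pinfty //; pose S := [set x : R | 0 <= x].
have mS : measurable [set x : R | 0 <= x] by rewrite -set_itvcy.
have step : (\int[mu]_(x in S) (expR (- m * `|x|))%:E <= \int[mu]_(x in S) (m^-1 * exponential_pdf m x)%:E)%E.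
  apply: ge0_le_integral => //=.
  - by apply: measurable_funTS; exact: (measurable_continuous cf).
  - apply/measurable_funTS/measurable_EFinP/measurable_funM => //.
    exact: measurable_exponential_pdf.
  - move=> x x0; rewrite exponential_pdfE // mulrA mulVf ?gt_eqF // mul1r.
    by rewrite ger0_norm.
apply: le_lt_trans step _.
apply: (@le_lt_trans _ _ (\int[mu]_x (m^-1 * exponential_pdf m x)%:E)%E).
  apply: ge0_subset_integral => //.
    apply/measurable_EFinP/measurable_funM => //; exact: measurable_exponential_pdf.
  by move=> x _; rewrite lee_fin mulr_ge0 ?invr_ge0 ?exponential_pdf_ge0 // ltW.
under eq_integral do rewrite EFinM.
rewrite integralZl //; last exact: integrable_exponential_pdf.
by rewrite integral_exponential_pdf // mule1 ltry.
Qed.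

Lemma integrable_logistic s : 0 < s < 1 -> mu.-integrable setT (EFin \o logistic s).
Proof.
move=> s01; have m0 : 0 < Num.min s (1 - s).
  by rewrite lt_min subr_gt0; case/andP: s01 => -> ->.
apply: le_integrable (integrable_laplace m0) => //.
  exact: (measurable_continuous (@continuous_logistic s)).
move=> u _; rewrite lee_fin (ger0_norm (ltW (logistic_gt0 s u))).
by apply: le_trans (logistic_le u s01) _; exact: ler_norm.
Qed.

Lemma Rintegral_logistic_gt0 s : 0 < s < 1 -> 0 < Rintegral mu setT (logistic s).
Proof.
move=> s01; have Ih := integrable_logistic s01.
have c0 : 0 < (1 + expR 1)^-1 :> R by rewrite invr_gt0 den_gt0.
rewrite -lte_fin fineK; last exact: integrable_fin_num.
apply: (@lt_le_trans _ _ ((1 + expR 1)^-1%:E)); first by rewrite lte_fin.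
apply: (@le_trans _ _ (\int[mu]_(x in `[0%R, 1%R]) (logistic s x)%:E)%E); last first.
  apply: ge0_subset_integral => //.
    exact: (measurable_continuous (@continuous_logistic s)).
  by move=> x _; rewrite lee_fin ltW // logistic_gt0.
apply: (@le_trans _ _ (\int[mu]_(x in `[0%R, 1%R]) (cst (1 + expR 1)^-1%:E x))%E).
  have mu01 : mu `[0%R, 1%R] = 1%E.
    by rewrite /mu lebesgue_measure_itv /= lte_fin ltr01 sube0.
  by rewrite integral_cst // [X in (_ <= _ * X)%E]mu01 mule1.
apply: ge0_le_integral => //.
- by move=> x _; rewrite lee_fin ltW.
- by apply: measurable_funTS; exact: (measurable_continuous (@continuous_logistic s)).
- move=> x; rewrite /= in_itv /= => /andP[x0 x1]; rewrite lee_fin.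
  rewrite /logistic -[leLHS]mul1r; apply: ler_pM; rewrite ?invr_ge0 ?(ltW (den_gt0 _)) //.
    by rewrite -[leLHS]expR0 ler_expR mulr_ge0 //; case/andP: s01 => /ltW.
  by rewrite lef_pV2 ?posrE ?den_gt0 // lerD2l ler_expR.
Qed.

Lemma integral_translate (f : R -> R) y : continuous f -> (forall x, 0 <= f x) ->
  (\int[mu]_x (f (x - y))%:E = \int[mu]_x (f x)%:E)%E.
Proof.
move=> cf f0.
have dF x : is_derive x 1 (fun x => x - y) 1.
  by apply: is_derive_eq; rewrite subr0.
have DF : derive1 (fun x : R => x - y) = cst 1.
  by apply/funext => x; rewrite derive1E derive_val.
rewrite (@increasing_ge0_integration_by_substitutionT _ (fun x => x - y) f) //.
- by apply: eq_integral => x _ /=; rewrite fctE DF mulr1.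
- by move=> a b ab; rewrite ltrD2r.
- by rewrite DF; exact: cst_continuous.
- by rewrite DF; apply/cvg_ex; exists (1 : R); exact: cvg_cst.
- by rewrite DF; apply/cvg_ex; exists (1 : R); exact: cvg_cst.
- apply/cvgrNyPle => A; near=> x; rewrite lerBlDr.
  by near: x; apply: nbhs_ninfty_le; exact: num_real.
- apply/cvgryPge => A; near=> x; rewrite lerBrDr.
  by near: x; apply: nbhs_pinfty_ge; exact: num_real.
Unshelve. all: end_near. Qed.

Lemma continuous_translate (f : R -> R) y : continuous f -> continuous (fun x => f (x - y)).
Proof.
move=> cf x; apply: continuous_comp; last exact: cf.
by apply: (@continuousB _ R^o R^o) => //; exact: cst_continuous.
Qed.

Lemma integrable_translate (f : R -> R) y : continuous f -> (forall x, 0 <= f x) ->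
  mu.-integrable setT (EFin \o f) ->
  mu.-integrable setT (EFin \o (fun x => f (x - y))) /\
  Rintegral mu setT (fun x => f (x - y)) = Rintegral mu setT f.
Proof.
move=> cf f0 fi; split; last by rewrite /Rintegral integral_translate.
apply/integrableP; split; first exact: (measurable_continuous (@continuous_translate f y cf)).
under eq_integral do rewrite /= ger0_norm //.
rewrite integral_translate //; move/integrableP: fi => [_].
by under eq_integral do rewrite /= ger0_norm //.
Qed.

End Kernel.

(** * Bounded Schur multipliers of real matrices *)

Section Schur.
Context {R : realType}.
Let mu := @lebesgue_measure R.

Lemma le_eq2 (a b c d : R) : a <= b -> a = c -> b = d -> c <= d.
Proof. by move=> ab <- <-. Qed.

Definition dominated N K (w : 'I_N -> 'I_K -> R) (b : 'I_N -> R) (a : 'I_K -> R) :=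
  forall f g, \sum_m \sum_n f m * g n * w m n <=
    \sum_m b m * f m ^+ 2 + \sum_n a n * g n ^+ 2.

(* The matrix [w] stands for a bounded form [Re <X e_n, e_m> x_n (y_m)^*], dominated by
   the diagonal forms [b] and [a]; the Schur multiplier [phi] has norm at most [M] if
   it scales this domination by [M].  This avoids operators altogether. *)
Definition schur_le (T : Type) (phi : T -> T -> R) (M : R) :=
  forall N K (l : 'I_N -> T) (l' : 'I_K -> T) w b a, dominated w b a ->
  \sum_m \sum_n phi (l m) (l' n) * w m n <= M * (\sum_m b m + \sum_n a n).

Definition schur (T : Type) (phi : T -> T -> R) := exists2 M, 0 <= M & schur_le phi M.

Lemma dominated_ge0l N K (w : 'I_N -> 'I_K -> R) b a m : dominated w b a -> 0 <= b m.
Proof.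
move=> /(_ (fun k => (k == m)%:R) (fun=> 0)).
rewrite [leLHS]big1; last by move=> i _; rewrite big1 // => j _; rewrite mulr0 mul0r.
rewrite [X in _ + X]big1 ?addr0; last by move=> i _; rewrite expr0n mulr0.
rewrite (bigD1 m) //= big1 ?addr0 ?eqxx ?expr1n ?mulr1 // => i /negbTE ->.
by rewrite expr0n mulr0.
Qed.

Lemma dominated_ge0r N K (w : 'I_N -> 'I_K -> R) b a n : dominated w b a -> 0 <= a n.
Proof.
move=> /(_ (fun=> 0) (fun k => (k == n)%:R)).
rewrite [leLHS]big1; last by move=> i _; rewrite big1 // => j _; rewrite !mul0r.
rewrite [X in X + _]big1 ?add0r; last by move=> i _; rewrite expr0n mulr0.
rewrite (bigD1 n) //= big1 ?addr0 ?eqxx ?expr1n ?mulr1 // => i /negbTE ->.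
by rewrite expr0n mulr0.
Qed.

Lemma schur_ext (T : Type) (phi psi : T -> T -> R) :
  (forall i j, phi i j = psi i j) -> schur phi -> schur psi.
Proof. by move=> h; have -> : psi = phi by apply/funext => i; apply/funext => j. Qed.

Lemma schurD (T : Type) (phi psi : T -> T -> R) :
  schur phi -> schur psi -> schur (fun i j => phi i j + psi i j).
Proof.
move=> [M M0 hM] [P P0 hP]; exists (M + P); first exact: addr_ge0.
move=> N K l l' w b a h; rewrite mulrDl.
apply: le_trans (lerD (hM _ _ l l' _ _ _ h) (hP _ _ l l' _ _ _ h)).
rewrite -big_split /=; apply: ler_sum => m _; rewrite -big_split /=.
by apply: ler_sum => n _; rewrite mulrDl.
Qed.

Lemma dominatedM N K (w : 'I_N -> 'I_K -> R) b a p q : dominated w b a ->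
  dominated (fun m n => p m * q n * w m n) (fun m => b m * p m ^+ 2) (fun n => a n * q n ^+ 2).
Proof.
move=> h f g; apply: le_eq2 (h (fun m => f m * p m) (fun n => g n * q n)) _ _.
  by apply: eq_bigr => m _; apply: eq_bigr => n _; ring.
by congr (_ + _); apply: eq_bigr => n _; ring.
Qed.

Lemma schurM (T : Type) (phi : T -> T -> R) (p q : T -> R) (P : R) :
  (forall i, `|p i| <= P) -> (forall i, `|q i| <= P) -> schur phi ->
  schur (fun i j => p i * phi i j * q j).
Proof.
move=> hp hq [M M0 hM]; exists (M * P ^+ 2); first by rewrite mulr_ge0 ?sqr_ge0.
move=> N K l l' w b a h.
have := hM _ _ l l' _ _ _ (dominatedM (fun m => p (l m)) (fun n => q (l' n)) h).
have -> : \sum_m \sum_n phi (l m) (l' n) * (p (l m) * q (l' n) * w m n) =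
          \sum_m \sum_n p (l m) * phi (l m) (l' n) * q (l' n) * w m n.
  by apply: eq_bigr => m _; apply: eq_bigr => n _; ring.
move/le_trans; apply; rewrite -mulrA ler_wpM2l // mulrDr !mulr_sumr.
have sq (r : R) : `|r| <= P -> r ^+ 2 <= P ^+ 2.
  by move=> hr; rewrite -[leLHS]real_normK ?num_real // ler_pXn2r ?nnegrE // (le_trans _ hr).
apply: lerD; apply: ler_sum => i _; rewrite mulrC ler_wpM2r ?sq //.
  exact: dominated_ge0l h.
exact: dominated_ge0r h.
Qed.

Lemma schur1 (T : Type) : schur (fun _ _ : T => 1).
Proof.
exists 1 => // N K l l' w b a h; apply: le_eq2 (h (fun=> 1) (fun=> 1)) _ _.
  by apply: eq_bigr => m _; apply: eq_bigr => n _; rewrite mul1r.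
by rewrite mul1r; congr (_ + _); apply: eq_bigr => m _; rewrite expr1n mulr1.
Qed.

Lemma schurZ (T : Type) (c : R) (phi : T -> T -> R) :
  schur phi -> schur (fun i j => c * phi i j).
Proof.
move=> h; apply: (schur_ext (phi := fun i j => c * phi i j * 1)).
  by move=> i j; rewrite mulr1.
apply: (schurM (p := fun=> c) (q := fun=> 1) (P := Num.max `|c| 1)) h => i.
  by rewrite le_max lexx.
by rewrite normr1 le_max lexx orbT.
Qed.

Lemma schur_comp (T T' : Type) (h : T' -> T) (phi : T -> T -> R) :
  schur phi -> schur (fun i j => phi (h i) (h j)).
Proof.
by move=> [M M0 hM]; exists M => // N K l l' w b a d; apply: (hM _ _ (h \o l) (h \o l')).
Qed.

Lemma schur_tr (T : Type) (phi : T -> T -> R) : schur phi -> schur (fun i j => phi j i).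
Proof.
move=> [M M0 hM]; exists M => // N K l l' w b a d.
rewrite exchange_big addrC; apply: (hM _ _ l' l (fun n m => w m n)) => f g.
rewrite exchange_big /= addrC; apply: le_eq2 (d g f) _ erefl.
by apply: eq_bigr => m _; apply: eq_bigr => n _; rewrite [f n * _]mulrC.
Qed.

(** This is block-diagonal compression. For each value [v] of [h] on the rows, cutting [w], [b] and
    [a] down to the indices with value [v] preserves domination; adding up over [v], the diagonal
    forms sum to at most [b] and [a], so the constant [M] is unchanged. It serves to change a symbol
    on the diagonal, where a difference quotient is undetermined. *)
Lemma schur_eq (T : Type) (T' : eqType) (h : T -> T') (phi : T -> T -> R) :
  schur phi -> schur (fun i j => (h i == h j)%:R * phi i j).
Proof.
move=> [M M0 hM]; exists M => // N K l l' w b a d.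
pose s := undup [seq h (l m) | m <- enum 'I_N].
have us : uniq s by exact: undup_uniq.
have sumv (x : T') (F : T' -> R) : x \in s -> \sum_(v <- s) (x == v)%:R * F v = F x.
  move=> xs; rewrite (bigD1_seq x) //= eqxx mul1r big1 ?addr0 // => v.
  by rewrite eq_sym => /negbTE ->; rewrite mul0r.
have ms m : h (l m) \in s by rewrite mem_undup; apply: map_f; rewrite mem_enum.
have key v : \sum_m \sum_n phi (l m) (l' n) * ((h (l m) == v)%:R * (h (l' n) == v)%:R * w m n) <=
   M * (\sum_m b m * (h (l m) == v)%:R ^+ 2 + \sum_n a n * (h (l' n) == v)%:R ^+ 2).
  exact: hM (dominatedM (fun m => (h (l m) == v)%:R) (fun n => (h (l' n) == v)%:R) d).
have := ler_sum s (fun v (_ : true) => key v).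
have -> : \sum_(v <- s) \sum_m \sum_n
     phi (l m) (l' n) * ((h (l m) == v)%:R * (h (l' n) == v)%:R * w m n) =
   \sum_m \sum_n (h (l m) == h (l' n))%:R * phi (l m) (l' n) * w m n.
  rewrite exchange_big; apply: eq_bigr => m _; rewrite exchange_big.
  apply: eq_bigr => n _ /=.
  rewrite -[RHS](sumv (h (l m)) (fun v => (v == h (l' n))%:R * phi (l m) (l' n) * w m n)) //.
  by apply: eq_bigr => v _; rewrite [v == _]eq_sym; ring.
move/le_trans; apply; rewrite -mulr_sumr ler_wpM2l // big_split /=.
rewrite !(exchange_big _ _ (index_enum _)) /=.
have sq (c : bool) : (c%:R : R) ^+ 2 = c%:R by case: c; rewrite ?expr1n ?expr0n.
apply: lerD; apply: ler_sum => m _.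
  under eq_bigr do rewrite sq mulrC.
  by rewrite (sumv _ (fun=> b m)).
under eq_bigr do rewrite sq mulrC.
(* A column whose value is attained by no row contributes 0 on the left; [a m >= 0] absorbs it on
   the right. *)
have am := dominated_ge0r m d.
have [xs|xs] := boolP (h (l' m) \in s); first by rewrite (sumv _ (fun=> a m)).
rewrite big1_seq // => v /andP[_ vs]; case: eqP => [E|_]; last by rewrite mul0r.
by rewrite E vs in xs.
Qed.

Lemma Rintegral_comb (I : Type) (s : seq I) (c : I -> R) (f : I -> R -> R) :
  (forall i, mu.-integrable setT (EFin \o f i)) ->
  mu.-integrable setT (EFin \o (fun x => \sum_(i <- s) c i * f i x)) /\
  Rintegral mu setT (fun x => \sum_(i <- s) c i * f i x) = \sum_(i <- s) c i * Rintegral mu setT (f i).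
Proof.
move=> fi; elim: s => [|i s [IH1 IH2]].
  rewrite big_nil; under [X in EFin \o X]eq_fun do rewrite big_nil.
  split; first exact: (integrable0 mu).
  by under eq_Rintegral do rewrite big_nil; rewrite Rintegral_cst // mul0r.
have iZ : mu.-integrable setT (EFin \o (fun x => c i * f i x)).
  exact: (integrableZl measurableT (c i) (fi i)).
under [X in EFin \o X]eq_fun do rewrite big_cons.
split; first exact: (integrableD measurableT iZ IH1).
under eq_Rintegral do rewrite big_cons.
by rewrite RintegralD // RintegralZl // IH2 big_cons.
Qed.

(** For each fixed [x], domination is applied to [f = A _ x] and [g = B _ x]; integrating this
    inequality in [x] replaces the squares by their integrals. *)
Lemma schur_integral (T : Type) (A B : T -> R -> R) (M : R) :
  (forall i, mu.-integrable setT (EFin \o (fun x => A i x ^+ 2))) ->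
  (forall i, mu.-integrable setT (EFin \o (fun x => B i x ^+ 2))) ->
  (forall i j, mu.-integrable setT (EFin \o (fun x => A i x * B j x))) ->
  (forall i, Rintegral mu setT (fun x => A i x ^+ 2) <= M) ->
  (forall i, Rintegral mu setT (fun x => B i x ^+ 2) <= M) ->
  schur_le (fun i j => Rintegral mu setT (fun x => A i x * B j x)) M.
Proof.
move=> iA iB iAB MA MB N K l l' w b a d.
pose F (p : 'I_N * 'I_K) x := A (l p.1) x * B (l' p.2) x.
have [i1 E1] := @Rintegral_comb _ (index_enum ('I_N * 'I_K)%type)
    (fun p => w p.1 p.2) F (fun p => iAB (l p.1) (l' p.2)).
have [i2 E2] := @Rintegral_comb _ (index_enum 'I_N) b (fun m x => A (l m) x ^+ 2) (fun m => iA (l m)).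
have [i3 E3] := @Rintegral_comb _ (index_enum 'I_K) a (fun n x => B (l' n) x ^+ 2) (fun m => iB (l' m)).
have -> : \sum_m \sum_n Rintegral mu setT (fun x => A (l m) x * B (l' n) x) * w m n =
  Rintegral mu setT (fun x => \sum_(p : 'I_N * 'I_K) w p.1 p.2 * F p x).
  by rewrite E1 pair_big /=; apply: eq_bigr => p _; rewrite mulrC.
apply: (@le_trans _ _ (Rintegral mu setT (fun x =>
   \sum_m b m * A (l m) x ^+ 2 + \sum_n a n * B (l' n) x ^+ 2))).
  apply: le_Rintegral => //; first exact: (integrableD measurableT i2 i3).
  move=> x _; apply: le_eq2 (d (fun m => A (l m) x) (fun n => B (l' n) x)) _ erefl.
  by rewrite pair_big /=; apply: eq_bigr => p _; rewrite mulrC.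
rewrite RintegralD // E2 E3 mulrDr !mulr_sumr; apply: lerD; apply: ler_sum => i _.
  by rewrite mulrC ler_wpM2r //; exact: dominated_ge0l d.
by rewrite mulrC ler_wpM2r //; exact: dominated_ge0r d.
Qed.

End Schur.

(** * Difference quotients of powers as integrals *)

Section PowerKernel.
Context {R : realType}.
Let mu := @lebesgue_measure R.

Lemma logistic_lt1 (s u : R) : 0 < s < 1 -> logistic s u <= 1.
Proof.
move=> s01; apply: le_trans (logistic_le u s01) _; rewrite -[leRHS]expR0 ler_expR mulNr oppr_le0.
apply: mulr_ge0 => //; rewrite le_min subr_ge0.
case/andP: s01 => s0 s1; apply/andP; split; exact: ltW.
Qed.

(** With [X], [Y], [Z] the exponentials of [x], [y], [z], the integrand is [(X / Y)^s (X / Z)^t /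
    ((1 + X / Y) (1 + X / Z))]: a product of two resolvents, integrated against [dX / X]. *)
Definition log_kernel (s t y z : R) :=
  Rintegral mu setT (fun x => logistic s (x - y) * logistic t (x - z)).

Lemma integrable_logistic2 (s t y z : R) : 0 < s < 1 -> 0 < t < 1 ->
  mu.-integrable setT (EFin \o (fun x => logistic s (x - y) * logistic t (x - z))).
Proof.
move=> s01 t01.
have [ih _] := integrable_translate y (@continuous_logistic _ s)
   (fun x => ltW (logistic_gt0 s x)) (integrable_logistic s01).
apply: le_integrable ih => //.
  apply/measurable_EFinP/measurable_funM; apply: continuous_measurable_fun;
    exact/continuous_translate/continuous_logistic.
move=> x _; rewrite lee_fin !ger0_norm ?mulr_ge0 ?(ltW (logistic_gt0 _ _)) //.
by rewrite ler_piMr ?logistic_lt1 // ltW ?logistic_gt0.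
Qed.

(** As [logistic <= 1], its square is bounded by the function itself, whose integral does not change
    under translation; the two factors are therefore bounded in L^2 uniformly in [y] and [z]. *)
Lemma schur_log_kernel (s t : R) : 0 < s < 1 -> 0 < t < 1 -> schur (log_kernel s t).
Proof.
move=> s01 t01; pose M := Num.max (Rintegral mu setT (logistic s)) (Rintegral mu setT (logistic t)).
have sqi (r y : R) : 0 < r < 1 -> mu.-integrable setT (EFin \o (fun x => logistic r (x - y) ^+ 2)).
  move=> r01; under [X in EFin \o X]eq_fun do rewrite expr2.
  exact: integrable_logistic2.
have sqM (r y : R) : 0 < r < 1 ->
    Rintegral mu setT (fun x => logistic r (x - y) ^+ 2) <= Rintegral mu setT (logistic r).
  move=> r01; have [ih <-] := integrable_translate y (@continuous_logistic _ r)
     (fun x => ltW (logistic_gt0 r x)) (integrable_logistic r01).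
  apply: le_Rintegral => //; first exact: sqi.
  by move=> x _; rewrite expr2 ler_piMr ?logistic_lt1 // ltW ?logistic_gt0.
exists M.
  by rewrite le_max; apply/orP; left; apply: Rintegral_ge0 => x _; rewrite ltW // logistic_gt0.
apply: schur_integral => [y|z|y z|y|z]; [exact: sqi|exact: sqi|exact: integrable_logistic2|..].
- by rewrite le_max sqM.
- by rewrite le_max sqM ?orbT.
Qed.

Let log_kernel_alg (A B P Q X Y Z : R) : 0 < X -> 0 < Y -> 0 < Z -> A * B = P * Q ->
  A / (1 + X / Y) * (B / (1 + X / Z)) * (Z - Y) =
  Y * Z * Q * (P / Y / (1 + X / Y) - P / Z / (1 + X / Z)).
Proof.
move=> X0 Y0 Z0 AB.
have -> : A / (1 + X / Y) * (B / (1 + X / Z)) * (Z - Y) =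
    (A * B) * ((Z - Y) / ((1 + X / Y) * (1 + X / Z))).
  by rewrite invfM; ring.
by rewrite AB; field; rewrite !gt_eqF // addr_gt0.
Qed.

(** By partial fractions, multiplication by the difference of the exponentials splits the product of
    two denominators into a difference of single ones. Each is a multiple of a translate of
    [logistic (s + t)], and all these translates have the same integral. *)
Lemma log_kernelE (s t y z : R) : 0 < s < 1 -> 0 < t < 1 -> s + t < 1 ->
  log_kernel s t y z * (expR z - expR y) =
  Rintegral mu setT (logistic (s + t)) * (expR ((1 - s) * y) * expR ((1 - t) * z) *
     (expR (- (1 - s - t) * y) - expR (- (1 - s - t) * z))).
Proof.
move=> s01 t01 st1.
have st01 : 0 < s + t < 1 by rewrite st1 andbT addr_gt0; case/andP: s01; case/andP: t01.
have tr w := integrable_translate w (@continuous_logistic _ (s + t))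
     (fun x => ltW (logistic_gt0 (s + t) x)) (integrable_logistic st01).
set C := Rintegral mu setT _.
have E w : Rintegral mu setT (fun x => expR (- (1 - s - t) * w) * logistic (s + t) (x - w)) =
    C * expR (- (1 - s - t) * w).
  by rewrite RintegralZl ?(tr w).2 1?mulrC //; case: (tr w).
have iE w : mu.-integrable setT (EFin \o (fun x => expR (- (1 - s - t) * w) * logistic (s + t) (x - w))).
  exact: (integrableZl measurableT _ (tr w).1).
transitivity (Rintegral mu setT (fun x => expR ((1 - s) * y) * expR ((1 - t) * z) *
   (expR (- (1 - s - t) * y) * logistic (s + t) (x - y) -
    expR (- (1 - s - t) * z) * logistic (s + t) (x - z)))); last first.
  rewrite RintegralZl // ?RintegralB // ?E; first by ring.
  exact: (integrableB measurableT (iE y) (iE z)).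
rewrite /log_kernel -RintegralZr //; last exact: integrable_logistic2.
apply: eq_Rintegral => x _; rewrite /logistic.
have e1 w : expR (- (1 - s - t) * w) * (expR ((s + t) * (x - w))) =
   expR (s * x) * expR (t * x) / expR w.
  by rewrite -!expRN -!expRD; congr expR; ring.
have e2 : expR (s * (x - y)) * expR (t * (x - z)) =
   expR (s * x) * expR (t * x) * (expR (- s * y) * expR (- t * z)).
  by rewrite -!expRD; congr expR; ring.
have e3 : expR ((1 - s) * y) * expR ((1 - t) * z) =
   expR y * expR z * (expR (- s * y) * expR (- t * z)).
  by rewrite -!expRD; congr expR; ring.
have e1' w : expR (- (1 - s - t) * w) * (expR ((s + t) * (x - w)) / (1 + expR (x - w))) =
   expR (s * x) * expR (t * x) / expR w / (1 + expR (x - w)).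
  by rewrite mulrA e1.
rewrite (e1' y) (e1' z) e3 (expRB x y) (expRB x z); apply: log_kernel_alg; rewrite ?expR_gt0 //.
Qed.

Variables (T : Type) (L : T -> R).
Hypothesis L0 : forall i, 0 < L i.

Lemma powE (x a : R) : 0 < x -> x `^ a = expR (a * ln x).
Proof. by move=> x0; rewrite /powR gt_eqF. Qed.

(* In the variables [ln (L i)] a multiple of this symbol is [log_kernel]; only its
   values on the diagonal are not determined by the equation. *)
Lemma schur_divided_difference (al be ga : R) :
  0 < al -> be < 1 -> ga < 1 -> be + ga = al + 1 ->
  exists2 psi, schur psi &
    forall i j, psi i j * (L i - L j) = L i `^ be * L j `^ ga * (L i `^ (- al) - L j `^ (- al)).
Proof.
move=> al0 be1 ga1 bg.
(* The parameters of the kernel are [s = 1 - be] and [t = 1 - ga], so that [1 - s - t = al]. *)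
have s01 : 0 < 1 - be < 1 by apply/andP; split; lra.
have t01 : 0 < 1 - ga < 1 by apply/andP; split; lra.
have st1 : 1 - be + (1 - ga) < 1 by lra.
have st01 : 0 < 1 - be + (1 - ga) < 1 by apply/andP; split; lra.
have C0 := Rintegral_logistic_gt0 st01.
set C := Rintegral mu setT (logistic (1 - be + (1 - ga))) in C0.
exists (fun i j => - C^-1 * log_kernel (1 - be) (1 - ga) (ln (L i)) (ln (L j))).
  exact/schurZ/(schur_comp (fun i => ln (L i)))/schur_log_kernel.
move=> i j; have := log_kernelE (ln (L i)) (ln (L j)) s01 t01 st1.
rewrite !lnK ?posrE // -/C !subKr => h.
have -> : - C^-1 * log_kernel (1 - be) (1 - ga) (ln (L i)) (ln (L j)) * (L i - L j) =
  C^-1 * (log_kernel (1 - be) (1 - ga) (ln (L i)) (ln (L j)) * (L j - L i)) by ring.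
rewrite h mulrA mulVf ?gt_eqF // mul1r !powE //.
by have -> : be - (1 - ga) = al by lra.
Qed.

(* The weights [L ^ - a] and [L ^ - b] make such a multiplier decay with order
   [de = a + b] at the large eigenvalues. *)
Inductive weighted (de : R) : (T -> T -> R) -> Prop :=
| Weighted a b psi : 0 <= a -> 0 <= b -> a + b = de -> schur psi ->
    weighted de (fun i j => L i `^ (- a) * psi i j * L j `^ (- b))
| WeightedD phi1 phi2 : weighted de phi1 -> weighted de phi2 ->
    weighted de (fun i j => phi1 i j + phi2 i j).

Lemma weighted_ext de phi psi : (forall i j, phi i j = psi i j) ->
  weighted de phi -> weighted de psi.
Proof. by move=> h; have -> : psi = phi by apply/funext => i; apply/funext => j. Qed.

Lemma weightedM de phi (p q : T -> R) (P : R) :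
  (forall i, `|p i| <= P) -> (forall i, `|q i| <= P) ->
  weighted de phi -> weighted de (fun i j => p i * phi i j * q j).
Proof.
move=> hp hq; elim=> [a b psi a0 b0 ab spsi|phi1 phi2 _ h1 _ h2].
  apply: (weighted_ext (phi := fun i j => L i `^ (- a) * (p i * psi i j * q j) * L j `^ (- b))).
    by move=> i j; ring.
  by apply: Weighted => //; exact: schurM hp hq spsi.
apply: weighted_ext (WeightedD h1 h2) => i j; ring.
Qed.

Lemma weightedZ de phi (c : R) : weighted de phi -> weighted de (fun i j => c * phi i j).
Proof.
move=> h; apply: (weighted_ext (phi := fun i j => c * phi i j * 1)).
  by move=> i j; rewrite mulr1.
apply: (weightedM (p := fun=> c) (q := fun=> 1) (P := Num.max `|c| 1)) h => i.
  by rewrite le_max lexx.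
by rewrite normr1 le_max lexx orbT.
Qed.

Lemma weightedB de phi psi : weighted de phi -> weighted de psi ->
  weighted de (fun i j => phi i j - psi i j).
Proof.
move=> h1 h2; apply: weighted_ext (WeightedD h1 (weightedZ (-1) h2)) => i j; ring.
Qed.

Lemma weighted_tr de phi : weighted de phi -> weighted de (fun i j => phi j i).
Proof.
elim=> [a b psi a0 b0 ab spsi|phi1 phi2 _ h1 _ h2]; last exact: WeightedD.
apply: (weighted_ext (phi := fun i j => L i `^ (- b) * psi j i * L j `^ (- a))).
  by move=> i j; ring.
by apply: Weighted => //; [rewrite addrC|exact: schur_tr].
Qed.

(** The mask commutes with the weights, so [schur_eq] for the bounded factor is enough. Afterwards
    only the values of a symbol off the diagonal matter. *)
Lemma weighted_neq de phi (T' : eqType) (h : T -> T') : weighted de phi ->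
  weighted de (fun i j => (h i != h j)%:R * phi i j).
Proof.
elim=> [a b psi a0 b0 ab spsi|phi1 phi2 _ h1 _ h2]; last first.
  by apply: weighted_ext (WeightedD h1 h2) => i j; rewrite mulrDr.
apply: (weighted_ext (phi := fun i j => L i `^ (- a) * ((h i != h j)%:R * psi i j) * L j `^ (- b))).
  by move=> i j; ring.
apply: Weighted => //.
apply: (schur_ext (phi := fun i j => psi i j + (-1) * ((h i == h j)%:R * psi i j))).
  by move=> i j; case: (h i == h j) => /=; ring.
by apply: schurD => //; exact/schurZ/schur_eq.
Qed.

End PowerKernel.

(** * Quotients by sums and by differences, with decay *)

Section PowerQuotients.
Context {R : realType}.
Variables (T : Type) (L : T -> R).
Hypothesis L0 : forall i, 0 < L i.
Let p0 i a : 0 < L i `^ a. Proof. exact: powR_gt0. Qed.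
Let pD i a b : L i `^ (a + b) = L i `^ a * L i `^ b.
Proof. by rewrite powRD //; apply/implyP => _; rewrite gt_eqF. Qed.
Let p1 i : L i `^ 1 = L i. Proof. by rewrite powRr1 // ltW. Qed.
Let pN i a : L i `^ (- a) = (L i `^ a)^-1. Proof. exact: powRN. Qed.
Let psq i a : (L i ^+ 2) `^ a = L i `^ (2 * a).
Proof. by rewrite powRrM powR_mulrn // ltW. Qed.

(** Since [1 / (x + y) = (x - y) / (x^2 - y^2)], the symbol is, off the diagonal, minus the
    difference quotient for the power [- 1 / 2] at the squares, the exponents [(s + 1) / 2] and
    [(t + 1) / 2] supplying the remaining powers. On the diagonal its value is [1 / 2] because
    [s + t = 1]; this is put in by hand. *)
Lemma schur_harmonic (s t : R) : 0 < s -> 0 < t -> s + t = 1 ->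
  schur (fun i j => L i `^ s * L j `^ t / (L i + L j)).
Proof.
move=> s0 t0 st; have L20 i : 0 < L i ^+ 2 by rewrite exprn_gt0.
have [||||psi spsi hpsi] := @schur_divided_difference R T (fun i => L i ^+ 2) L20
  (1/2) ((s + 1) / 2) ((t + 1) / 2).
- by lra.
- by lra.
- by lra.
- by lra.
apply: (schur_ext (phi := fun i j =>
   ((L i == L j)%:R * (psi i j) - psi i j) + (2^-1 * ((L i == L j)%:R * 1)))).
  move=> i j; have [E|nE] := eqVneq (L i) (L j).
    rewrite E !mul1r subrr add0r mulr1 -(pD j) st p1 -mulr2n -[L j *+ 2]mulr_natr.
    by rewrite invfM mulrA mulfV ?mul1r // gt_eqF.
  rewrite mul0r sub0r mul0r mulr0 addr0.
  have d0 : L i - L j != 0 by rewrite subr_eq0.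
  have s0' : L i + L j != 0 by rewrite gt_eqF // addr_gt0.
  apply: (mulIf d0); apply: (mulIf s0').
  have := hpsi i j; rewrite !psq.
  have -> : 2 * ((s + 1) / 2) = s + 1 by lra.
  have -> : 2 * ((t + 1) / 2) = t + 1 by lra.
  have -> : 2 * - (1 / 2) = -1 :> R by lra.
  rewrite !pD !pN !p1.
  have -> : - psi i j * (L i - L j) * (L i + L j) = - (psi i j * (L i ^+ 2 - L j ^+ 2)) by ring.
  move=> ->; field.
  by rewrite s0' !gt_eqF.
apply: schurD; last by apply/schurZ/(schur_eq L)/schur1.
apply: (schur_ext (phi := fun i j => (L i == L j)%:R * psi i j + (-1) * psi i j)).
  by move=> i j; ring.
by apply: schurD; [exact: (schur_eq L)|exact: schurZ].
Qed.

(** The excess [1 - s - t] is split in the ratio of [1 - s] to [1 - t]. The exponents left over are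
    [s + a = (1 - t) / (2 - s - t)] and [t + b = (1 - s) / (2 - s - t)], which are positive with sum
    1. *)
Lemma weighted_harmonic (s t : R) : s < 1 -> t < 1 -> s + t <= 1 ->
  weighted L (1 - s - t) (fun i j => L i `^ s * L j `^ t / (L i + L j)).
Proof.
move=> s1 t1 st; have d0 : 0 < 2 - s - t by lra.
have d0' : 2 - s - t != 0 by rewrite gt_eqF.
pose a := (1 - s) * (1 - s - t) / (2 - s - t).
pose b := (1 - t) * (1 - s - t) / (2 - s - t).
apply: (weighted_ext (phi := fun i j => L i `^ (- a) *
   (L i `^ ((1 - t) / (2 - s - t)) * L j `^ ((1 - s) / (2 - s - t)) / (L i + L j)) * L j `^ (- b))).
  move=> i j.
  have -> : L i `^ s = L i `^ (- a) * L i `^ ((1 - t) / (2 - s - t)).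
    by rewrite -pD; congr (_ `^ _); rewrite /a; field.
  have -> : L j `^ t = L j `^ (- b) * L j `^ ((1 - s) / (2 - s - t)).
    by rewrite -pD; congr (_ `^ _); rewrite /b; field.
  ring.
apply: Weighted.
- by rewrite divr_ge0 ?mulr_ge0 //; lra.
- by rewrite divr_ge0 ?mulr_ge0 //; lra.
- by rewrite /a /b; field.
- apply: schur_harmonic; [by rewrite divr_gt0 //; lra|by rewrite divr_gt0 //; lra|by field].
Qed.

(** The exponent 1 is out of reach of the splitting, but [x / (x + y) = 1 - y / (x + y)]: the first
    term is a pure weight, and the second has exponents 0 and [1 - de], both below 1. *)
Lemma weighted_harmonic1 (de : R) : 0 < de ->
  weighted L de (fun i j => L i * L j `^ (- de) / (L i + L j)).
Proof.
move=> de0; have := @weighted_harmonic 0 (1 - de); have -> : 1 - 0 - (1 - de) = de by ring.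
move=> h.
have {}h : weighted L de (fun i j => L i `^ 0 * L j `^ (1 - de) / (L i + L j)).
  by apply: h; lra.
have h1 : weighted L de (fun i j => L i `^ (- 0) * 1 * L j `^ (- de)).
  by apply: Weighted; [by []|exact: ltW|by rewrite add0r|exact: schur1].
apply: weighted_ext (weightedB h1 h) => i j.
rewrite oppr0 !powRr0 pD p1; field.
by rewrite gt_eqF // addr_gt0.
Qed.

(** An exponent equal to 1 forces the other to be negative, which is the previous case up to
    transposition. *)
Lemma weighted_harmonic_le1 (s t : R) : s <= 1 -> t <= 1 -> s + t <= 1 ->
  (s = 1 -> t < 0) -> (t = 1 -> s < 0) ->
  weighted L (1 - s - t) (fun i j => L i `^ s * L j `^ t / (L i + L j)).
Proof.
move=> s1 t1 st hs ht.
have [s1E|s1N] := eqVneq s 1.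
  have t0 := hs s1E; have := @weighted_harmonic1 (- t); rewrite oppr_gt0 => /(_ t0).
  by rewrite s1E subrr add0r; apply: weighted_ext => i j; rewrite opprK p1.
have [t1E|t1N] := eqVneq t 1.
  have s0 := ht t1E; have := @weighted_harmonic1 (- s); rewrite oppr_gt0 => /(_ s0).
  move/weighted_tr; rewrite t1E addrAC subrr add0r; apply: weighted_ext => i j.
  by rewrite opprK p1 [L j * _]mulrC [L j + _]addrC.
by apply: weighted_harmonic => //; rewrite lt_neqAle ?s1N ?t1N.
Qed.

(** The two negative powers are treated separately, with exponents [be - al], [ga] and [be],
    [ga - al]. When [be] or [ga] equals 1, the strict inequality assumed makes its partner
    negative. *)
Lemma weighted_sum_quotient (al be ga : R) :
  0 < al -> be <= 1 -> ga <= 1 -> be + ga <= al + 1 ->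
  (be = 1 -> ga < al) -> (ga = 1 -> be < al) ->
  weighted L (1 + al - be - ga)
  (fun i j => L i `^ be * L j `^ ga * (L i `^ (- al) - L j `^ (- al)) / (L i + L j)).
Proof.
move=> al0 be1 ga1 bg hbe hga.
have h1 : weighted L (1 + al - be - ga) (fun i j => L i `^ (be - al) * L j `^ ga / (L i + L j)).
  have -> : 1 + al - be - ga = 1 - (be - al) - ga by ring.
  by apply: weighted_harmonic_le1 => //; [lra|lra|move=> E; lra|move=> /hga; lra].
have h2 : weighted L (1 + al - be - ga) (fun i j => L i `^ be * L j `^ (ga - al) / (L i + L j)).
  have -> : 1 + al - be - ga = 1 - be - (ga - al) by ring.
  by apply: weighted_harmonic_le1 => //; [lra|lra|move=> /hbe; lra|move=> E; lra].
by apply: weighted_ext (weightedB h1 h2) => i j; rewrite !pD; ring.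
Qed.

(** The product form avoids division: the equation fixes [phi] where [L i] and [L j] differ and is
    [0 = 0] where they agree. *)
Let quotient_spec (al b c : R) phi := weighted L (1 + al - b - c) phi /\
  forall i j, phi i j * (L i - L j) = L i `^ b * L j `^ c * (L i `^ (- al) - L j `^ (- al)).

(* With [q = L j / L i],
   [(1 - q^al) / (1 - q) = 1 / (1 + q) - (q^al - q) / (1 - q^2) + (q - q^(1+al)) / (1 - q^2)]
   where the last two terms are divided differences at [q^2]. *)
Let quotient1 (al c : R) : 0 < al -> al < 1 -> c < al -> exists phi, quotient_spec al 1 c phi.
Proof.
move=> al0 al1 cal; have L20 i : 0 < L i ^+ 2 by rewrite exprn_gt0.
(* Off the diagonal, [- psi2] is [(q^al - q) / (1 - q^2)] and [- psi3] below is
   [(q - q^(1+al)) / (1 - q^2)]. *)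
have [||||psi2 spsi2 hpsi2] := @schur_divided_difference R T (fun i => L i ^+ 2) L20
   ((1 - al) / 2) (1 - al / 2) (1 / 2); try lra.
have [||||psi3 spsi3 hpsi3] := @schur_divided_difference R T (fun i => L i ^+ 2) L20
   (al / 2) (1 / 2) ((1 + al) / 2); try lra.
pose de := al - c; have de0 : 0 < de by rewrite /de; lra.
have w psi : schur psi -> weighted L de (fun i j => L i `^ (- 0) * psi i j * L j `^ (- de)).
  by move=> h; apply: Weighted => //; [exact: ltW|rewrite add0r].
exists (fun i j => (L i `^ (- 0) * (psi3 i j + -1 * psi2 i j) * L j `^ (- de)) -
           (L i * L j `^ (- de) / (L i + L j))); split.
  have -> : 1 + al - 1 - c = de by rewrite /de; ring.
  apply: weightedB (weighted_harmonic1 de0); apply: w.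
  by apply: schurD => //; exact: schurZ.
move=> i j.
have s0 : L i + L j != 0 by rewrite gt_eqF // addr_gt0.
apply: (mulIf s0); have := hpsi2 i j; have := hpsi3 i j; rewrite !psq.
have -> : 2 * (1 / 2) = 1 :> R by lra.
have -> : 2 * ((1 + al) / 2) = 1 + al by lra.
have -> : 2 * (1 - al / 2) = 1 + (1 - al) by lra.
have -> : 2 * - ((1 - al) / 2) = al - 1 by lra.
have -> : 2 * - (al / 2) = - al by lra.
have -> : c = al - de by rewrite /de; ring.
rewrite oppr0 powRr0 !pD !pN !p1.
have := p0 i al; have := p0 j al; have := p0 j de; have := L0 i; have := L0 j.
move: (L i) (L j) (L i `^ al) (L j `^ al) (L j `^ de) s0 => x y X Y Z s0 y0 x0 Z0 Y0 X0 E3 E2.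
have -> : (1 * (psi3 i j + -1 * psi2 i j) * Z^-1 - x / Z / (x + y)) * (x - y) * (x + y) =
   (psi3 i j * (x ^+ 2 - y ^+ 2) - psi2 i j * (x ^+ 2 - y ^+ 2)) / Z - x * (x - y) / Z.
  by field; rewrite s0 gt_eqF.
rewrite E3 E2; field.
by rewrite !gt_eqF.
Qed.

(** For [al = 1] the quotient is the pure weight [- L i ^ (be - 1) * L j ^ (ga - 1)]. For [al < 1]
    and exponents below 1, the excess is split in the ratio of [1 - be] to [1 - ga]; the identity [1
    - be - a = (1 - be) (1 - al) / (2 - be - ga)] and its counterpart keep the enlarged exponents
    below 1. *)
Lemma weighted_difference_quotient (al be ga : R) :
  0 < al -> be <= 1 -> ga <= 1 -> be + ga <= al + 1 ->
  (be = 1 -> ga < al) -> (ga = 1 -> be < al) ->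
  al <= 1 -> exists phi, quotient_spec al be ga phi.
Proof.
move=> al0 be1 ga1 bg hbe hga al1; have [al1E|alN] := eqVneq al 1.
  exists (fun i j => L i `^ (- (1 - be)) * (-1 * 1) * L j `^ (- (1 - ga))); split.
    by apply: Weighted; [lra|lra|rewrite al1E; ring|exact/schurZ/schur1].
  move=> i j; rewrite al1E !opprB !pD !pN !p1; field.
  by rewrite !gt_eqF.
have {alN} {}al1 : al < 1 by rewrite lt_neqAle alN.
have [be1E|beN] := eqVneq be 1; first by rewrite be1E; apply: quotient1 => //; exact: hbe.
have [ga1E|gaN] := eqVneq ga 1.
  rewrite ga1E; have [phi [wphi hphi]] := quotient1 al0 al1 (hga ga1E).
  exists (fun i j => phi j i); split.
    have -> : 1 + al - be - 1 = 1 + al - 1 - be by ring.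
    exact: (@weighted_tr R T L _ phi wphi).
  by move=> i j; have := hphi j i; rewrite -(opprB (L i)) mulrN => /eqP; rewrite eqr_oppLR => /eqP ->; ring.
have {beN} be1' : be < 1 by rewrite lt_neqAle beN.
have {gaN} ga1' : ga < 1 by rewrite lt_neqAle gaN.
pose de := 1 + al - be - ga; have de0 : 0 <= de by rewrite /de; lra.
have d0 : 0 < 2 - be - ga by lra.
have d0' : 2 - be - ga != 0 by rewrite gt_eqF.
pose a := de * (1 - be) / (2 - be - ga); pose b := de * (1 - ga) / (2 - be - ga).
have ab : a + b = de by rewrite /a /b; field.
have a0 : 0 <= a by rewrite divr_ge0 ?mulr_ge0 //; lra.
have b0 : 0 <= b by rewrite divr_ge0 ?mulr_ge0 //; lra.
have ba1 : be + a < 1.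
  suff : 0 < 1 - be - a by lra.
  have -> : 1 - be - a = (1 - be) * (1 - al) / (2 - be - ga) by rewrite /a /de; field.
  by rewrite divr_gt0 ?mulr_gt0 //; lra.
have gb1 : ga + b < 1.
  suff : 0 < 1 - ga - b by lra.
  have -> : 1 - ga - b = (1 - ga) * (1 - al) / (2 - be - ga) by rewrite /b /de; field.
  by rewrite divr_gt0 ?mulr_gt0 //; lra.
have [psi spsi hpsi] : exists2 psi, schur psi & forall i j,
    psi i j * (L i - L j) = L i `^ (be + a) * L j `^ (ga + b) * (L i `^ (- al) - L j `^ (- al)).
  by apply: schur_divided_difference => //; move: ab; rewrite /de; lra.
exists (fun i j => L i `^ (- a) * psi i j * L j `^ (- b)); split; first exact: Weighted.
move=> i j.
have -> : L i `^ (- a) * psi i j * L j `^ (- b) * (L i - L j) =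
   L i `^ (- a) * L j `^ (- b) * (psi i j * (L i - L j)) by ring.
rewrite hpsi !pD !pN; field.
by rewrite !gt_eqF.
Qed.

End PowerQuotients.

(** * Borel functional calculus in an eigenbasis *)

Section Series.
Import HBNNSimple.
Context {R : realType}.
Implicit Types (a : nat -> R).

Lemma sum_EFin_nat a N : (\sum_(0 <= i < N) (a i)%:E)%E = (\sum_(i < N) a i)%:E.
Proof. by rewrite sumEFin big_mkord. Qed.

Lemma nneseries_le_bound a (M : R) : (forall n, 0 <= a n) ->
  (forall N, \sum_(i < N) a i <= M) -> (\sum_(n <oo) (a n)%:E <= M%:E)%E.
Proof.
move=> a0 aM; apply: lime_le.
  by apply: is_cvg_nneseries => n _ _; rewrite lee_fin.
by apply: nearW => N; rewrite sum_EFin_nat lee_fin.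
Qed.

Lemma nneseries_partial_le a N : (forall n, 0 <= a n) ->
  ((\sum_(i < N) a i)%:E <= \sum_(n <oo) (a n)%:E)%E.
Proof.
by move=> a0; rewrite -sum_EFin_nat; apply: nneseries_lim_ge => n _ _; rewrite lee_fin.
Qed.

Definition sum_to a (r : R) := forall e, 0 < e ->
  exists N, forall n, (N <= n)%N -> `|\sum_(i < n) a i - r| < e.

Lemma nneseries_sum_to a (M : R) : (forall n, 0 <= a n) ->
  (forall N, \sum_(i < N) a i <= M) ->
  exists2 r, (\sum_(n <oo) (a n)%:E)%E = r%:E & sum_to a r.
Proof.
move=> a0 aM; have le := nneseries_le_bound a0 aM.
have ge0 : (0 <= \sum_(n <oo) (a n)%:E)%E by apply: nneseries_ge0 => n _ _; rewrite lee_fin.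
have [r E] : exists r, (\sum_(n <oo) (a n)%:E)%E = r%:E.
  by move: le ge0; case: (\sum_(n <oo) (a n)%:E)%E => [r||] //; exists r.
exists r => // e e0.
have part N : \sum_(i < N) a i <= r by rewrite -lee_fin -E; exact: nneseries_partial_le.
have [N hN] : exists N, r - e < \sum_(i < N) a i.
  apply: contrapT => h.
  have : (\sum_(n <oo) (a n)%:E <= (r - e)%:E)%E.
    apply: nneseries_le_bound => // N; rewrite leNgt; apply/negP => h1; apply: h.
    by exists N.
  by rewrite E lee_fin lerBrDr gerDl leNgt e0.
exists N => n Nn; rewrite ltr_distl.
have mono : \sum_(i < N) a i <= \sum_(i < n) a i.
  by rewrite -(subnKC Nn) big_split_ord /= lerDl sumr_ge0.
by rewrite (lt_le_trans hN mono) /= (le_lt_trans (part n)) // ltrDl.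
Qed.

Lemma sum_toB a b r s : sum_to a r -> sum_to b s -> sum_to (fun n => a n - b n) (r - s).
Proof.
move=> ha hb e e0; have e2 : 0 < e / 2 by rewrite divr_gt0.
have [N hN] := ha _ e2; have [M hM] := hb _ e2; exists (maxn N M) => n; rewrite geq_max => /andP[Nn Mn].
rewrite sumrB.
have -> : \sum_(i < n) a i - \sum_(i < n) b i - (r - s) =
  (\sum_(i < n) a i - r) - (\sum_(i < n) b i - s) by ring.
apply: le_lt_trans (ler_normB _ _) _; have := hN n Nn; have := hM n Mn.
by move: (`|_|) (`|_|) => p q; lra.
Qed.

(** [scalar_measure E x] is a bare set function. Integrals see only its values on measurable sets,
    so it may be replaced by a genuine measure that agrees with it there. *)
Lemma eq_set_integral d (T : measurableType d) (m1 m2 : set T -> \bar R) (f : T -> \bar R) :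
  (forall A, measurable A -> m1 A = m2 A) ->
  (\int[m1]_x f x = \int[m2]_x f x)%E.
Proof.
move=> m12; have h (m m' : set T -> \bar R) (g : T -> \bar R) :
    (forall A, measurable A -> m A = m' A) ->
    [set sintegral m h | h in [set h : {nnsfun T >-> R} | forall x, ((h x)%:E <= g x)%E]] `<=`
    [set sintegral m' h | h in [set h : {nnsfun T >-> R} | forall x, ((h x)%:E <= g x)%E]].
  move=> mm' _ [k hk <-]; exists k => //; apply: eq_fsbigr => r _.
  by rewrite mm'.
rewrite /integral; congr (ereal_sup _ - ereal_sup _)%E; rewrite eqEsubset; split;
  by apply: h => A mA; rewrite m12.
Qed.

Definition point_masses (w : nat -> {nonneg R}) (l : nat -> R) : set R -> \bar R :=
  mseries (fun n => mscale (w n) (\d_(l n))) 0.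

Lemma ge0_integral_point_masses (w : nat -> {nonneg R}) (l : nat -> R) (g : R -> R) :
  measurable_fun setT g -> (forall t, 0 <= g t) ->
  (\int[point_masses w l]_t (g t)%:E = \sum_(n <oo) ((w n)%:num * g (l n))%:E)%E.
Proof.
move=> mg g0; have mgE : measurable_fun setT (EFin \o g) by exact/measurable_EFinP.
have g0E (t : R) : [set: R] t -> (0 <= (g t)%:E)%E by move=> _; rewrite lee_fin.
rewrite (ge0_integral_measure_series _ measurableT g0E mgE).
apply: eq_eseriesr => n _.
rewrite (ge0_integral_mscale _ measurableT _ mgE g0E) (integral_dirac _ measurableT mgE).
by rewrite diracT mul1e EFinM.
Qed.

(** Positive and negative parts are summed separately; the bound on the absolute values makes both
    sums finite. *)
Lemma integral_point_masses (w : nat -> {nonneg R}) (l : nat -> R) (g : R -> R) (M : R) :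
  measurable_fun setT g ->
  (forall N, \sum_(i < N) (w i)%:num * `|g (l i)| <= M) ->
  exists2 r, (\int[point_masses w l]_t (g t)%:E)%E = r%:E &
    sum_to (fun n => (w n)%:num * g (l n)) r.
Proof.
move=> mg gM; rewrite integralE.
have bnd (h : R -> R) : (forall t, h t <= `|g t|) ->
    forall N, \sum_(i < N) (w i)%:num * h (l i) <= M.
  by move=> hg N; apply: le_trans (gM N); apply: ler_sum => i _; rewrite ler_wpM2l.
have mp : measurable_fun setT g^\+%R by exact: measurable_funrpos.
have mn : measurable_fun setT g^\-%R by exact: measurable_funrneg.
have p0 t : 0 <= g^\+%R t by exact: funrpos_ge0.
have n0 t : 0 <= g^\-%R t by exact: funrneg_ge0.
have bp t : g^\+%R t <= `|g t| by rewrite /funrpos ge_max ler_norm normr_ge0.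
have bn t : g^\-%R t <= `|g t| by rewrite /funrneg ge_max normr_ge0 andbT -normrN ler_norm.
have w0 (h : R -> R) : (forall t, 0 <= h t) -> forall n, 0 <= (w n)%:num * h (l n).
  by move=> h0 n; rewrite mulr_ge0.
have [rp Ep hp] := nneseries_sum_to (w0 _ p0) (bnd _ bp).
have [rn En hn] := nneseries_sum_to (w0 _ n0) (bnd _ bn).
exists (rp - rn).
  rewrite EFinB -Ep -En -!ge0_integral_point_masses //.
  by congr (_ - _)%E; apply: eq_integral => t _; rewrite ?funeposE ?funenegE /= ?/funrpos ?/funrneg EFin_max.
have -> : (fun n => (w n)%:num * g (l n)) =
    (fun n => (w n)%:num * g^\+%R (l n) - (w n)%:num * g^\-%R (l n)).
  apply/funext => n; rewrite -mulrBr; congr (_ * _); rewrite /funrpos /funrneg.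
  by case: (leP (g (l n)) 0) => h; case: (leP (- g (l n)) 0) => k; lra.
exact: sum_toB.
Qed.

End Series.

(** * The spectral measure built from an eigenbasis *)

Section SpectralMeasure.
Context {R : realType} {H : hilbertSpace R}.
Local Notation C := R[i].
Variables (e : nat -> H) (d : nat -> bool).
Hypothesis he : forall i j, '[e i, e j] = ((i == j) && d i)%:R.
Hypothesis tot : forall x, (forall i, '[x, e i] = 0) -> x = 0.

Definition diag_op (f : nat -> R) : H -> H :=
  xget 0 [set X | bounded_op X /\ forall x i, '[X x, e i] = (f i)%:C%C * '[x, e i]].

Lemma diag_opP f (M : R) : 0 <= M -> (forall i, d i -> `|f i| <= M) ->
  [/\ bounded_op (diag_op f), forall x i, '[diag_op f x, e i] = (f i)%:C%C * '[x, e i] &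
      forall x, nrm (diag_op f x) <= M * nrm x].
Proof.
move=> M0 fM; have [X [bX cX nX]] := diag_ex he tot M0 fM.
have [|bd cd] := @xgetPex _ 0 [set X | bounded_op X /\ forall x i, '[X x, e i] = (f i)%:C%C * '[x, e i]].
  by exists X.
split=> // x; rewrite (_ : diag_op f x = X x) //.
by apply: (coord_inj tot) => i; rewrite cd cX.
Qed.

Lemma diag_op_basis f (M : R) n : 0 <= M -> (forall i, d i -> `|f i| <= M) ->
  diag_op f (e n) = (f n)%:C%C *: e n.
Proof.
move=> M0 fM; have [_ cX _] := diag_opP M0 fM.
apply: (coord_inj tot) => i; rewrite cX innerZl he.
by have [->|_] := eqVneq n i; rewrite ?mulr0.
Qed.

Lemma inner_of_sum_to x y (f : nat -> R) r : (forall i, '[y, e i] = (f i)%:C%C * '[x, e i]) ->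
  sum_to (fun n => normc '[x, e n] ^+ 2 * f n) r -> '[y, x] = r%:C%C.
Proof.
move=> hy hr; apply/eqP; rewrite -subr_eq0 -normc_eq0 eq_le normc_ge0 andbT.
apply/ler_addgt0Pl => eps eps0; rewrite addr0.
have e2 : 0 < eps / 2 by rewrite divr_gt0.
have [N hN] := hr _ e2; have [M hM] := scvg_inner x (btrunc_cvg he tot y) e2.
have := hN (maxn N M) (leq_maxl _ _); have := hM (maxn N M) (leq_maxr _ _).
set K := maxn N M.
have -> : '[btrunc e K y, x] = (\sum_(i < K) normc '[x, e i] ^+ 2 * f i)%:C%C.
  rewrite /btrunc inner_suml rmorph_sum; apply: eq_bigr => i _ /=.
  by rewrite innerZl hy (innerC (e i)) -mulrA mul_conjC -rmorphM /= mulrC.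
set S := \sum_(_ < _) _; move=> h1 h2.
have -> : '[y, x] - r%:C%C = - (S%:C%C - '[y, x]) + (S - r)%:C%C by rewrite rmorphB /=; ring.
apply: le_trans (le_normcD _ _) _; rewrite normcN normc_real.
by move: h1 h2; move: (normc _) (`|_|) => p q; lra.
Qed.

Variable lam : nat -> R.

Definition pvm0 (B : set R) : H -> H := diag_op (fun i => \1_B (lam i)).

Lemma pvm0P B :
  [/\ bounded_op (pvm0 B), forall x i, '[pvm0 B x, e i] = (\1_B (lam i))%:C%C * '[x, e i] &
      forall x, nrm (pvm0 B x) <= nrm x].
Proof.
have [|i _|bX cX nX] := @diag_opP (fun i => \1_B (lam i)) 1.
- by [].
- by rewrite /indic; case: (_ \in _); rewrite ?normr1 ?normr0.
by split => // x; have := nX x; rewrite mul1r.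
Qed.

(** The remainder is [pvm0 (V n) x] up to sign, for sets [V n] decreasing to the empty set. A
    truncation of [x] is close to [x] and involves finitely many eigenvalues, each of which
    eventually leaves [V n]. *)
Lemma pvm0_sadd (B : (set R)^nat) x : trivIset setT B ->
  (fun n => \sum_(i < n) pvm0 (B i) x) @ \oo --> pvm0 (\bigcup_n B n) x.
Proof.
move=> tB; apply/scvgP => eps eps0.
pose U n := \bigcup_(i in [set i | (i < n)%N]) B i.
pose V n := \bigcup_n B n `\` U n.
have sE n : \sum_(i < n) pvm0 (B i) x - pvm0 (\bigcup_n B n) x = - pvm0 (V n) x.
  apply: (coord_inj tot) => j; rewrite innerBl innerNl inner_suml.
  have [_ -> _] := pvm0P (\bigcup_n B n); have [_ -> _] := pvm0P (V n).
  under eq_bigr => i _ do have [_ -> _] := pvm0P (B i).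
  rewrite -mulr_suml -rmorph_sum -mulrBl -rmorphB -mulNr -rmorphN /=.
  congr ((_)%:C%C * _).
  have [[k kB]|nB] := pselect (exists k, B k (lam j)).
    have uk i : B i (lam j) -> i = k.
      by move=> iB; apply: tB => //; exists (lam j).
    rewrite [X in _ - X](_ : _ = 1); last by rewrite indicE mem_set //; exists k.
    have [kn|nk] := ltnP k n.
      rewrite (bigD1 (Ordinal kn)) //= indicE mem_set // big1 ?addr0.
        rewrite subrr indicE memNset ?oppr0 // => -[_]; apply; by exists k.
      move=> i; rewrite -val_eqE /= => ik; rewrite indicE memNset // => /uk ik'.
      by rewrite ik' eqxx in ik.
    rewrite big1 ?sub0r; last first.
      move=> i _; rewrite indicE memNset // => /uk ik.
      by have := ltn_ord i; rewrite ik ltnNge nk.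
    rewrite indicE mem_set //; split; first by exists k.
    by move=> [i /= ik /uk ik']; rewrite ik' ltnNge nk in ik.
  rewrite big1 => [|i _]; last by rewrite indicE memNset // => h; apply: nB; exists i.
  rewrite indicE memNset; last by move=> [k _ kB]; apply: nB; exists k.
  by rewrite indicE memNset ?subr0 ?oppr0 // => -[[k _ kB] _]; apply: nB; exists k.
have [K hK] := btrunc_cvg he tot x eps0.
have hx := hK K (leqnn K).
have /choice[nn hnn] (i : nat) : exists n, forall m, (n <= m)%N -> ~ V m (lam i).
  have [[k kB]|nB] := pselect (exists k, B k (lam i)).
    by exists k.+1 => m km [_]; apply; exists k.
  by exists 0%N => m _ [[k _ kB] _]; apply: nB; exists k.
exists (\max_(i < K) nn i) => n hn; rewrite sE nrmN.
have [bV cV nV] := pvm0P (V n).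
have -> : pvm0 (V n) x = pvm0 (V n) (x - btrunc e K x).
  apply: (coord_inj tot) => j; rewrite !cV innerBl (inner_btrunc he).
  case: ltnP => jK; last by rewrite subr0.
  rewrite indicE memNset ?mul0r //; apply: hnn.
  by apply: leq_trans hn; exact: (leq_bigmax (Ordinal jK)).
by apply: le_lt_trans (nV _) _; rewrite nrm_subC.
Qed.

Lemma pvm0_projection_valued_measure : projection_valued_measure pvm0.
Proof.
split.
- move=> B mB; have [bB cB nB] := pvm0P B; split=> //.
    apply/funext => x /=; apply: (coord_inj tot) => i; rewrite !cB mulrA -rmorphM /=.
    by rewrite indicE; case: (_ \in _); rewrite ?mulr1 ?mulr0.
  move=> x y; apply: (inner_coord_eq he tot) => i.
  by rewrite !cB rmorphM /= [X in _ = _ * (X * _)]conjC_real; ring.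
- apply/funext => x; apply: (coord_inj tot) => i; have [_ -> _] := pvm0P set0.
  by rewrite indic0 mul0r inner0l.
- apply/funext => x; apply: (coord_inj tot) => i; have [_ -> _] := pvm0P setT.
  by rewrite indicT mul1r.
- move=> A B mA mB; apply/funext => x /=; apply: (coord_inj tot) => i.
  have [_ -> _] := pvm0P (A `&` B); have [_ -> _] := pvm0P A; have [_ -> _] := pvm0P B.
  by rewrite mulrA -rmorphM /= !indicE in_setI; case: (_ \in _); case: (_ \in _); rewrite ?mulr1 ?mulr0.
- by move=> B mB tB x; exact: pvm0_sadd.
Qed.

Definition weight x n : {nonneg R} := NngNum (sqr_ge0 (normc '[x, e n])).

Lemma scalar_pvm0 x B : scalar_measure pvm0 x B = point_masses (weight x) lam B.
Proof.
have [bB cB nB] := pvm0P B.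
rewrite /point_masses /mseries /scalar_measure.
have i01 n : 0 <= (\1_B (lam n) : R) <= 1.
  by rewrite indicE; case: (_ \in _); rewrite ?lexx ?ler01.
have [n|N|r E hr] := @nneseries_sum_to _ (fun n => normc '[x, e n] ^+ 2 * \1_B (lam n)) (nrm x ^+ 2).
- by rewrite mulr_ge0 ?sqr_ge0 //; case/andP: (i01 n).
- apply: le_trans (bessel he N x); apply: ler_sum => i _.
  by rewrite ler_piMr ?sqr_ge0 //; case/andP: (i01 i).
rewrite (inner_of_sum_to (cB x) hr) /= -E; apply: eq_eseriesr => n _.
by rewrite /mscale /= diracE indicE EFinM.
Qed.

Lemma ge0_integral_pvm0 x (g : R -> R) : measurable_fun setT g -> (forall t, 0 <= g t) ->
  (\int[scalar_measure pvm0 x]_t (g t)%:E =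
   \sum_(n <oo) (normc '[x, e n] ^+ 2 * g (lam n))%:E)%E.
Proof.
move=> mg g0; rewrite -(ge0_integral_point_masses (weight x) lam mg g0).
by apply: eq_set_integral => A _; exact: scalar_pvm0.
Qed.

Lemma integral_pvm0 x y (g : R -> R) (M : R) :
  measurable_fun setT g ->
  (forall i, '[y, e i] = (g (lam i))%:C%C * '[x, e i]) ->
  (forall N, \sum_(i < N) normc '[x, e i] ^+ 2 * `|g (lam i)| <= M) ->
  '[y, x] = (fine (\int[scalar_measure pvm0 x]_t (g t)%:E)%E)%:C%C.
Proof.
move=> mg hy gM; have [r E hr] := @integral_point_masses _ (weight x) lam g M mg gM.
have -> : (\int[scalar_measure pvm0 x]_t (g t)%:E)%E = r%:E.
  by rewrite -E; apply: eq_set_integral => A _; exact: scalar_pvm0.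
exact: (inner_of_sum_to hy hr).
Qed.

Variable D : unbounded_op H.
Hypothesis sD : selfadjoint D.
Hypothesis hD : forall i, udom D (e i) /\ D (e i) = (lam i)%:C%C *: e i.

Lemma coord_uop x i : udom D x -> '[D x, e i] = (lam i)%:C%C * '[x, e i].
Proof. by move=> dx; have [de De] := hD i; rewrite uopE // De innerZr conjC_real. Qed.

Lemma udom_coord x y : (forall i, '[y, e i] = (lam i)%:C%C * '[x, e i]) ->
  udom D x /\ D x = y.
Proof.
move=> hy; apply: uop_adjoint => // v dv; apply: (inner_coord_eq he tot) => i.
by rewrite coord_uop // hy rmorphM /= [X in _ = _ * (X * _)]conjC_real; ring.
Qed.

Lemma pvm0_spectral_measure : spectral_measure_of D pvm0.
Proof.
have msq : measurable_fun [set: R] (fun t : R => t ^+ 2) by exact: exprn_measurable.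
split; first exact: pvm0_projection_valued_measure.
- move=> x; rewrite (ge0_integral_pvm0 x msq); last by move=> t; exact: sqr_ge0.
  split=> [dx|].
    apply: (@le_lt_trans _ _ (nrm (D x) ^+ 2)%:E); last exact: ltry.
    apply: nneseries_le_bound => [n|N]; first by rewrite mulr_ge0 ?sqr_ge0.
    apply: le_trans (bessel he N (D x)); apply: ler_sum => i _.
    by rewrite coord_uop // normcM normc_real exprMn real_normK ?num_real // mulrC.
  set S := (\sum_(n <oo) _)%E => Sfin.
  have S0 : (0 <= S)%E by apply: nneseries_ge0 => n _ _; rewrite lee_fin mulr_ge0 ?sqr_ge0.
  have fS : S = (fine S)%:E by rewrite fineK // ge0_fin_numE.
  (* A finite second moment makes the products [lam i * '[x, e i]] square summable; the vector with
     these coordinates is [D x]. *)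
  have [|i di|N|y [hy _ _]] := riesz_fischer he (c := fun i => (lam i)%:C%C * '[x, e i])
     (M := Num.sqrt (fine S)).
  - exact: sqrtr_ge0.
  - by rewrite (coord_dead he x di) mulr0.
  - rewrite sqr_sqrtr ?fine_ge0 // -lee_fin -fS.
    apply: le_trans (nneseries_partial_le N _); last by move=> n; rewrite mulr_ge0 ?sqr_ge0.
    rewrite lee_fin; apply: ler_sum => i _.
    by rewrite normcM normc_real exprMn real_normK ?num_real // mulrC.
  by have [] := udom_coord hy.
- move=> x dx; apply: (integral_pvm0 (M := nrm x ^+ 2 + nrm (D x) ^+ 2)).
  + exact: measurable_id.
  + by move=> i; exact: coord_uop.
  + move=> N; apply: le_trans (lerD (bessel he N x) (bessel he N (D x))).
    rewrite -big_split /=; apply: ler_sum => i _.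
    rewrite coord_uop // normcM normc_real exprMn -[X in _ <= X + _]mulr1 [X in _ + X]mulrC -mulrDr.
    rewrite ler_wpM2l ?sqr_ge0 //.
    have := sqr_ge0 (`|lam i| - 1); have := normr_ge0 (lam i).
    by move: (`|lam i|) => t t0; rewrite sqrrB1 => h; nra.
Qed.

Lemma pvm0_borel_calculus (f : R -> R) (M : R) : measurable_fun setT f -> 0 <= M ->
  (forall i, d i -> `|f (lam i)| <= M) ->
  is_borel_calculus D f (diag_op (f \o lam)).
Proof.
move=> mf M0 fM; have [bf cf nf] := diag_opP M0 fM.
split=> //; exists pvm0; split; first exact: pvm0_spectral_measure.
move=> x; split; last first.
  apply: (integral_pvm0 (M := M * nrm x ^+ 2)) => // N.
  apply: le_trans (ler_wpM2l M0 (bessel he N x)); rewrite mulr_sumr.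
  apply: ler_sum => i _; rewrite mulrC.
  case: (boolP (d i)) => [di|di]; first by rewrite ler_wpM2r ?sqr_ge0 ?fM.
  by rewrite (coord_dead he x di) normc0 expr0n !mulr0.
rewrite (ge0_integral_pvm0 x); last 2 first.
- exact: (measurable_funX 2 mf).
- by move=> t; exact: sqr_ge0.
apply: (@le_lt_trans _ _ (M ^+ 2 * nrm x ^+ 2)%:E); last exact: ltry.
apply: nneseries_le_bound => [n|N]; first by rewrite mulr_ge0 ?sqr_ge0.
apply: le_trans (ler_wpM2l (sqr_ge0 M) (bessel he N x)); rewrite mulr_sumr.
apply: ler_sum => i _; rewrite mulrC.
case: (boolP (d i)) => [di|di].
  rewrite ler_wpM2r ?sqr_ge0 // -[leLHS]real_normK ?num_real //.
  by rewrite ler_pXn2r ?nnegrE // fM.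
by rewrite (coord_dead he x di) normc0 expr0n !mulr0.
Qed.

End SpectralMeasure.

(** * Uniqueness of the spectral measure on eigenvectors *)

Section ScalarMeasure.
Context {R : realType} {H : hilbertSpace R}.
Variable E : set R -> H -> H.
Hypothesis pE : projection_valued_measure E.

Lemma pvm_inner B x : measurable B -> '[E B x, x] = (nrm (E B x) ^+ 2)%:C%C.
Proof.
move=> mB; have [/(_ B mB)[bB iB sB] _ _ _ _] := pE.
by rewrite -inner_nrm -sB -[E B (E B x)]/((E B \o E B) x) iB.
Qed.

(* [scalar_measure E x] need not be nonnegative on non-measurable sets *)
Definition pvm_measure (h : projection_valued_measure E) (x : H) : set R -> \bar R :=
  fun B => if `[< measurable B >] then scalar_measure E x B else 0%E.

Lemma pvm_measureE (x : H) B : measurable B -> pvm_measure pE x B = (nrm (E B x) ^+ 2)%:E.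
Proof.
by move=> mB; rewrite /pvm_measure asboolT // /scalar_measure pvm_inner.
Qed.

Let pvm_measure0 (x : H) : pvm_measure pE x set0 = 0%E.
Proof.
rewrite pvm_measureE //; have [_ -> _ _ _] := pE.
by rewrite nrm0 expr0n.
Qed.

Let pvm_measure_ge0 (x : H) B : (0 <= pvm_measure pE x B)%E.
Proof.
rewrite /pvm_measure; case: asboolP => // mB.
by rewrite /scalar_measure pvm_inner // lee_fin sqr_ge0.
Qed.

Let pvm_measure_sigma_additive (x : H) : semi_sigma_additive (pvm_measure pE x).
Proof.
move=> F mF tF mUF; have [_ _ _ _ /(_ F mF tF x)/scvgP hc] := pE.
rewrite pvm_measureE //.
have -> : (fun n => \sum_(0 <= i < n) pvm_measure pE x (F i))%E =
    EFin \o (fun n => complex.Re '[\sum_(i < n) E (F i) x, x]).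
  apply/funext => n /=; rewrite big_mkord inner_suml Re_sum -sumEFin.
  by apply: eq_bigr => i _; rewrite pvm_measureE // pvm_inner.
have -> : nrm (E (\bigcup_n F n) x) ^+ 2 = complex.Re '[E (\bigcup_n F n) x, x].
  by rewrite pvm_inner.
apply/fine_cvgP; split; first exact: nearW.
apply/cvgrPdist_lt => e e0; have [N hN] := scvg_inner x hc e0.
exists N => // n /= Nn; have := hN n Nn; apply: le_lt_trans.
rewrite distrC -ReB; set z := _ - _.
by have := normc_ge_Re z; rewrite normCE lecR.
Qed.

HB.instance Definition _ (x : H) := isMeasure.Build _ _ _ (pvm_measure pE x)
  (pvm_measure0 x) (@pvm_measure_ge0 x) (@pvm_measure_sigma_additive x).

Lemma integral_pvm_measure (x : H) (f : R -> \bar R) :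
  (\int[scalar_measure E x]_t f t = \int[pvm_measure pE x]_t f t)%E.
Proof.
apply: eq_set_integral => B mB.
by rewrite pvm_measureE // /scalar_measure pvm_inner.
Qed.

End ScalarMeasure.

Section Mean.
Context {R : realType}.

(** A finite measure carried by a set strictly on one side of its mean must vanish: the function
    [s * (t - l)] is positive on [B] and has integral 0. The sign of [s] selects the side. *)
Lemma barycentre_measure0 (m : {measure set R -> \bar R}) (l s : R) (B : set R) :
  (m setT < +oo)%E -> (\int[m]_t (t ^+ 2)%:E < +oo)%E ->
  fine (\int[m]_t t%:E)%E = l * fine (m setT) ->
  measurable B -> m (~` B) = 0%E -> (forall t, B t -> 0 < s * (t - l)) -> m setT = 0%E.
Proof.
move=> mfin m2 mean mB mB0 sB.
have i1 (c : R) : m.-integrable setT (EFin \o cst c).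
  apply/integrableP; split; first exact/measurable_EFinP.
  rewrite (eq_integral (cst `|c|%:E)) // integral_cst //.
  by rewrite lte_mul_pinfty.
have msq : measurable_fun [set: R] (fun t : R => t ^+ 2) by exact: exprn_measurable.
have i2 : m.-integrable setT (EFin \o (fun t : R => t ^+ 2)).
  apply/integrableP; split; first exact/measurable_EFinP.
  rewrite (eq_integral (fun t : R => (t ^+ 2)%:E)) // => t _ /=.
  by rewrite ger0_norm // sqr_ge0.
have it : m.-integrable setT (EFin \o (fun t : R => t)).
  apply: le_integrable (integrableD measurableT (i1 1) i2) => //.
    by apply/measurable_EFinP; exact: measurable_id.
  move=> t _ /=; rewrite lee_fin [leRHS]ger0_norm ?addr_ge0 ?sqr_ge0 //.
  have := sqr_ge0 (`|t| - 1); have := normr_ge0 t; rewrite -[t ^+ 2]real_normK ?num_real //.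
  by move: (`|t|) => r r0; rewrite sqrrB1 => h; nra.
have iD : m.-integrable setT (EFin \o (fun t : R => s * (t - l))).
  have := integrableZl measurableT s (integrableB measurableT it (i1 l)).
  by apply: eq_integrable.
have I0 : (\int[m]_t (s * (t - l))%:E)%E = 0%E.
  transitivity (s%:E * (\int[m]_t t%:E - \int[m]_t (cst l t)%:E))%E.
    have E1 := integralB measurableT it (i1 l).
    have E2 := integralZl measurableT (integrableB measurableT it (i1 l)) s.
    by rewrite E1 in E2; rewrite -E2.
  have -> : (\int[m]_t (cst l t)%:E = l%:E * m setT)%E by exact: (integral_cst m measurableT l%:E).
  rewrite -(fineK (integrable_fin_num measurableT it)).
  rewrite mean.
  have mf : m setT \is a fin_num by rewrite ge0_fin_numE.
  move: mf; case: (m setT) => // r _ /=; by rewrite -EFinD subrr mule0.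
have IB : (\int[m]_(t in B) `|(s * (t - l))%:E|)%E = 0%E.
  rewrite -I0 (negligible_integral (measurableC mB) measurableT iD mB0) setTD setCK.
  by apply: eq_integral => t; rewrite inE => /sB h; rewrite /= ger0_norm // ltW.
have mD : measurable_fun B (fun t : R => (s * (t - l))%:E).
  by apply: measurable_funTS; exact: (measurable_int m iD).
have /(ae_eq_integral_abs m mB mD) [N [mN N0 hN]] := IB.
apply/eqP; rewrite eq_le measure_ge0 andbT.
have -> : setT = N `|` ~` B.
  apply/seteqP; split=> // t _; have [Bt|] := pselect (B t); last by right.
  left; apply: hN => /= /(_ Bt); rewrite /cst => -[] h.
  by have := sB t Bt; rewrite h ltxx.
apply: le_trans (measureU2 _ mN (measurableC mB)) _.
by rewrite [X in (X + _ <= _)%E]N0 [X in (_ + X <= _)%E]mB0 adde0.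
Qed.

End Mean.

Section Uniqueness.
Context {R : realType} {H : hilbertSpace R}.
Local Notation C := R[i].
Variable D : unbounded_op H.
Hypothesis sD : selfadjoint D.
Variable E : set R -> H -> H.
Hypothesis sE : spectral_measure_of D E.
Let pE : projection_valued_measure E. Proof. by case: sE. Qed.

Lemma conjC_i : ('i%C : C)^* = - 'i%C.
Proof. by apply/eqP; rewrite eq_complex /= oppr0 !eqxx. Qed.

(** Let [u = E B e0] and [w = e0 - u]. For [|c| = 1] the vectors [u + c w] all have the scalar
    measure of [e0], so they lie in the domain and give the same value of the quadratic form of [D].
    Taking [c] among 1, -1, i, -i yields [u] in the domain and ['[D u, w] = 0], whence ['[D u, u] =
    '[u, D e0] = l |u|^2]. *)
Lemma pvm_compression (e0 : H) (l : R) (B : set R) : measurable B ->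
  udom D e0 -> D e0 = l%:C%C *: e0 ->
  udom D (E B e0) /\ '[D (E B e0), E B e0] = (l * nrm (E B e0) ^+ 2)%:C%C.
Proof.
move=> mB de De; have [_ hdom hval] := sE; have [hp _ _ hI _] := pE.
have [bB iB sB] := hp B mB.
have [u uB] : exists u, u = E B e0 by exists (E B e0).
have [w wE] : exists w, w = e0 - u by exists (e0 - u).
rewrite -uB.
have uw0 v : '[E B v, w] = 0.
  by rewrite sB wE uB bopB // -[X in _ - X]/((E B \o E B) e0) iB subrr inner0r.
have cross C0 : measurable C0 -> '[E C0 u, w] = 0.
  move=> mC; rewrite uB -[E C0 _]/((E C0 \o E B) e0) -hI // setIC hI //.
  exact: uw0.
have scal c C0 : normc c = 1 -> measurable C0 ->
    scalar_measure E (u + c *: w) C0 = scalar_measure E e0 C0.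
  move=> c1 mC; have [bC iC sC] := hp C0 mC.
  have X c' : normc c' = 1 ->
     '[E C0 (u + c' *: w), u + c' *: w] = '[E C0 u, u] + '[E C0 w, w].
    move=> c'1; rewrite bopD // bopZ // !(innerDl, innerDr, innerZl, innerZr).
    have c2 : '[E C0 w, u] = 0 by rewrite sC innerC cross // conjC0.
    have cc : c' * c'^* = 1 by rewrite mul_conjC c'1 expr1n.
    rewrite cross // c2; transitivity ('[E C0 u, u] + c' * c'^* * '[E C0 w, w]).
      by ring.
    by rewrite cc mul1r.
  rewrite /scalar_measure X // -(X 1) ?normc1 // scale1r.
  by rewrite wE addrC subrK.
have domc c : normc c = 1 -> udom D (u + c *: w) /\
    '[D (u + c *: w), u + c *: w] = '[D e0, e0].
  move=> c1; have eqI (f : R -> \bar R) :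
      (\int[scalar_measure E (u + c *: w)%R]_t f t = \int[scalar_measure E e0]_t f t)%E.
    by apply: eq_set_integral => C0 mC; exact: scal.
  have dc : udom D (u + c *: w) by apply/hdom; rewrite eqI; apply/hdom.
  by split=> //; rewrite hval // hval // eqI.
have uE : u = 2^-1%:C%C *: ((u + 1 *: w) + (u + (-1) *: w)).
  have -> : (u + 1 *: w) + (u + (-1) *: w) = (2%:R : C) *: u.
    by rewrite scale1r scaleN1r addrACA subrr addr0 scaler_nat mulr2n.
  rewrite scalerA -(rmorph_nat (real_complex R) 2) -rmorphM /= mulVf ?scale1r //.
have n1 : normc (-1 : C) = 1 by rewrite normcN normc1.
have ni : normc ('i%C : C) = 1 by rewrite /= expr0n expr1n add0r sqrtr1.
have nNi : normc (- 'i%C : C) = 1 by rewrite normcN.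
have du : udom D u.
  rewrite uE; apply: (proj1 (udomZ _ _)).
  by apply: (proj1 (udomD _ _)); [exact: (domc 1 (normc1 R)).1|exact: (domc (-1) n1).1].
have dw : udom D w by rewrite wE; exact: (proj1 (udomB de du)).
split=> //.
have q c : normc c = 1 -> '[D u, u] + '[D w, w] + (c^* * '[D u, w] + c * '[D w, u]) = '[D e0, e0].
  move=> c1; have [_ <-] := domc c c1.
  have [dcw Dcw] := udomZ c dw; have [_ ->] := udomD du dcw.
  rewrite Dcw !(innerDl, innerDr, innerZl, innerZr) [c * (c^* * _)]mulrA mul_conjC c1 expr1n mul1r.
  ring.
have q1 := q 1 (normc1 R); have qN1 := q (-1) n1.
have qi := q _ ni; have qNi := q _ nNi.
have cN1 : (-1 : C)^* = -1 by rewrite rmorphN rmorph1.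
have cNi : (- 'i%C : C)^* = 'i%C by rewrite -conjC_i conjCK.
rewrite conjC1 in q1; rewrite cN1 in qN1; rewrite conjC_i in qi; rewrite cNi in qNi.
have s1 : '[D u, w] + '[D w, u] = 0.
  have : ('[D u, w] + '[D w, u]) *+ 2 = 0.
    transitivity (('[D u, u] + '[D w, w] + (1 * '[D u, w] + 1 * '[D w, u])) -
      ('[D u, u] + '[D w, w] + (- 1 * '[D u, w] + -1 * '[D w, u]))); first by ring.
    by rewrite q1 qN1 subrr.
  by move/eqP; rewrite mulrn_eq0 /= => /eqP.
have s2 : 'i%C * ('[D w, u] - '[D u, w]) = 0.
  have : ('i%C * ('[D w, u] - '[D u, w])) *+ 2 = 0.
    transitivity (('[D u, u] + '[D w, w] + (- 'i%C * '[D u, w] + 'i%C * '[D w, u])) -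
      ('[D u, u] + '[D w, w] + ('i%C * '[D u, w] + - 'i%C * '[D w, u]))); first by ring.
    by rewrite qi qNi subrr.
  by move/eqP; rewrite mulrn_eq0 /= => /eqP.
have Duw : '[D u, w] = 0.
  have i0 : ('i%C : C) != 0 by rewrite -normc_eq0 ni oner_eq0.
  move/eqP: s2; rewrite mulf_eq0 (negbTE i0) /= subr_eq0 => /eqP s2.
  move: s1; rewrite s2 -mulr2n => /eqP; rewrite mulrn_eq0 /= => /eqP //.
have e0E : e0 = u + w by rewrite wE addrC subrK.
have -> : '[D u, u] = '[D u, e0] by rewrite [in RHS]e0E innerDr Duw addr0.
rewrite (uopE sD) // De innerZr conjC_real [in LHS]e0E innerDr [in '[u, w]]uB uw0 addr0.
by rewrite inner_nrm -rmorphM.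
Qed.

(** The scalar measure of [E B e0] is carried by [B] and has mean [l] by [pvm_compression], while
    [B] lies on one side of [l]. *)
Lemma pvm_side0 (e0 : H) (l s : R) (B : set R) : measurable B ->
  udom D e0 -> D e0 = l%:C%C *: e0 -> (forall t, B t -> 0 < s * (t - l)) -> E B e0 = 0.
Proof.
move=> mB de De sB; have [hp E0 ET hI _] := pE; have [_ hdom hval] := sE.
have [du Du] := pvm_compression mB de De; set u := E B e0 in du Du *.
have mT : pvm_measure pE u setT = (nrm u ^+ 2)%:E by rewrite pvm_measureE // ET.
have : pvm_measure pE u setT = 0%E.
  apply: (barycentre_measure0 (m := pvm_measure pE u) (l := l) (s := s) (B := B)) => //.
  - by apply: (@le_lt_trans _ _ (nrm u ^+ 2)%:E); [rewrite -mT|exact: ltry].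
  - by rewrite -integral_pvm_measure; apply/hdom.
  - transitivity (l * nrm u ^+ 2); last first.
      by congr (_ * _); rewrite -[LHS]/(fine (nrm u ^+ 2)%:E) -mT.
    apply: (@complexI R); rewrite -Du hval //.
    by rewrite -integral_pvm_measure.
  - apply: etrans (pvm_measureE pE u (measurableC mB)) _.
    rewrite /u -[E (~` B) _]/((E (~` B) \o E B) e0) -(hI _ _ (measurableC mB) mB).
    by rewrite setICl E0 nrm0 expr0n.
rewrite mT => -[/eqP]; rewrite sqrf_eq0 nrm_eq0 => /eqP //.
Qed.

(** Both open half-lines at [l] annihilate [e0], hence so does every measurable set that avoids [l].
    If [l] is in [B], this applies to the complement, and [|E B e0| = |e0|] then forces
    [E B e0 = e0]. *)
Lemma pvm_eigen (e0 : H) (l : R) (B : set R) : measurable B ->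
  udom D e0 -> D e0 = l%:C%C *: e0 -> E B e0 = (\1_B l)%:C%C *: e0.
Proof.
move=> mB de De; have [hp E0 ET hI _] := pE.
have zero A : measurable A -> ~ A l -> E A e0 = 0.
  move=> mA Al.
  have mgt : measurable [set t : R | l < t] by rewrite -set_itvoy.
  have mlt : measurable [set t : R | t < l] by rewrite -set_itvNyo.
  have g0 : E [set t : R | l < t] e0 = 0.
    by apply: (@pvm_side0 _ l 1) => // t /=; rewrite mul1r subr_gt0.
  have l0 : E [set t : R | t < l] e0 = 0.
    by apply: (@pvm_side0 _ l (-1)) => // t /=; rewrite mulN1r opprB subr_gt0.
  suff : (pvm_measure pE e0 A <= 0)%E.
    rewrite pvm_measureE // lee_fin => h; apply/eqP.
    by rewrite -nrm_eq0 -sqrf_eq0 eq_le h sqr_ge0.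
  apply: (@le_trans _ _ (pvm_measure pE e0 ([set t : R | l < t] `|` [set t | t < l]))).
    apply: le_measure; rewrite ?inE //; first exact: measurableU.
    move=> t At /=; have [tl|tl|tl] := ltgtP t l; [by right|by left|].
    by rewrite tl in At.
  apply: le_trans (measureU2 _ mgt mlt) _.
  have m1 : pvm_measure pE e0 [set t : R | l < t] = 0%E by rewrite pvm_measureE // g0 nrm0 expr0n.
  have m2 : pvm_measure pE e0 [set t : R | t < l] = 0%E by rewrite pvm_measureE // l0 nrm0 expr0n.
  by rewrite [X in (X + _ <= _)%E]m1 [X in (_ + X <= _)%E]m2 adde0.
rewrite indicE; case: (boolP (l \in B)) => [/set_mem lB|lB]; last first.
  by rewrite scale0r zero // => /mem_set; apply/negP.
rewrite scale1r; have [bB iB sB] := hp B mB.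
have cB0 : E (~` B) e0 = 0 by apply: zero; [exact: measurableC|move=> /(_ lB)].
have : pvm_measure pE e0 setT = (pvm_measure pE e0 B + pvm_measure pE e0 (~` B))%E.
  by rewrite -(setUv B) measureU // ?setICr //; exact: measurableC.
rewrite !pvm_measureE //; last exact: measurableC.
rewrite ET cB0 nrm0 expr0n adde0 => -[h].
apply/eqP; rewrite eq_sym -subr_eq0 -nrm_eq0 -sqrf_eq0; apply/eqP.
rewrite nrmB_sqr innerC pvm_inner // conjC_real /= -h /=.
by rewrite -mulr2n mulr_natl subrr.
Qed.

End Uniqueness.

(** * Powers, sign and kernel projection of the operator in coordinates *)

Section FunctionalCalculus.
Context {R : realType} {H : hilbertSpace R}.
Local Notation C := R[i].

(** Complex polarization: the quadratic form of the difference is expanded at [x + c y] for [c = 1]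
    and [c = i], where [y] is the image of [x] under the difference. *)
Lemma quadratic_form_inj (X Y : H -> H) : bounded_op X -> bounded_op Y ->
  (forall x, '[X x, x] = '[Y x, x]) -> X = Y.
Proof.
move=> bX bY h; apply/funext => x; apply/eqP; rewrite -subr_eq0; apply/eqP/inner_eq0.
have [Z ZE] : exists Z : H -> H, Z = (fun z => X z - Y z) by exists (fun z => X z - Y z).
have q z : '[Z z, z] = 0 by rewrite ZE innerBl h subrr.
have ZD c z v : Z (z + c *: v) = Z z + c *: Z v.
  by rewrite ZE (bopD bX) (bopD bY) (bopZ bX) (bopZ bY) scalerBr opprD addrACA.
rewrite -[X x - Y x]/((fun z => X z - Y z) x) -ZE; set y := Z x.
have p c : c^* * '[Z x, y] + c * '[Z y, x] = 0.
  have := q (x + c *: y); rewrite ZD !(innerDl, innerDr, innerZl, innerZr) !q.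
  by rewrite !mulr0 add0r addr0 => <-; ring.
have p1 := p 1; have pi := p 'i%C.
rewrite conjC1 !mul1r in p1; rewrite conjC_i in pi.
have i0 : ('i%C : C) != 0.
  by rewrite -normc_eq0 /= expr0n expr1n add0r sqrtr1 oner_eq0.
have E : '[Z y, x] = - '[Z x, y] by apply/eqP; rewrite -addr_eq0 addrC p1.
move: pi; rewrite E.
have -> : - 'i%C * '[Z x, y] + 'i%C * - '[Z x, y] = - 'i%C * ('[Z x, y] *+ 2) by ring.
by move/eqP; rewrite mulf_eq0 oppr_eq0 (negbTE i0) /= mulrn_eq0 => /eqP.
Qed.

Variables (e : nat -> H) (d : nat -> bool).
Hypothesis he : forall i j, '[e i, e j] = ((i == j) && d i)%:R.
Hypothesis tot : forall x, (forall i, '[x, e i] = 0) -> x = 0.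
Variable lam : nat -> R.
Variable D : unbounded_op H.
Hypothesis sD : selfadjoint D.
Hypothesis hD : forall i, udom D (e i) /\ D (e i) = (lam i)%:C%C *: e i.

Lemma pvm_unique E B : spectral_measure_of D E -> measurable B -> E B = pvm0 e lam B.
Proof.
move=> sE mB; have [[hp _ _ _ _] _ _] := sE; have [bE _ _] := hp B mB.
have [b0 c0 _] := pvm0P he tot lam B.
apply: (op_basis_inj he tot) => // n m; rewrite c0.
have [dn Dn] := hD n; rewrite (pvm_eigen sD sE mB dn Dn) innerZl he.
by have [->|_] := eqVneq n m; rewrite ?mulr0.
Qed.

Lemma borel_calculus_quadratic (f : R -> R) X x : is_borel_calculus D f X ->
  '[X x, x] = (fine (\int[scalar_measure (pvm0 e lam) x]_t (f t)%:E)%E)%:C%C.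
Proof.
move=> [mf bX [E [sE hE]]]; rewrite (hE x).2; congr (fine _)%:C%C.
by apply: eq_set_integral => B mB; rewrite /scalar_measure (pvm_unique sE mB).
Qed.

(** The operator selected by [borel_calculus] may come from another spectral measure; by uniqueness
    its quadratic form is the one computed in the basis, and this form determines the operator. *)
Lemma borel_calculus_diag (f : R -> R) (M : R) : measurable_fun setT f -> 0 <= M ->
  (forall i, d i -> `|f (lam i)| <= M) -> borel_calculus D f = diag_op e (f \o lam).
Proof.
move=> mf M0 fM.
have hd := pvm0_borel_calculus he tot sD hD mf M0 fM.
have hx : is_borel_calculus D f (borel_calculus D f).
  by apply: (@xgetPex _ 0 [set X | is_borel_calculus D f X]); exists (diag_op e (f \o lam)).
have [_ bd _] := hd; have [_ bx _] := hx.
apply: quadratic_form_inj => // x.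
by rewrite (borel_calculus_quadratic x hd) (borel_calculus_quadratic x hx).
Qed.

Lemma measurable_abs_powN (q : R) : measurable_fun setT (abs_powN q).
Proof.
apply: measurable_fun_ifT => //.
  by apply: measurable_fun_eqr.
by apply: (@measurableT_comp _ _ _ _ _ _ (fun x : R => x `^ (- q)) _ (fun t : R => `|t|));
  [exact: measurable_powR|exact: normr_measurable].
Qed.

Variable K : R.
Hypothesis K0 : 0 < K.
Hypothesis hK : forall i, lam i != 0 -> `|lam i|^-1 <= K.

Lemma abs_powN_bound (q : R) i : 0 <= q -> `|abs_powN q (lam i)| <= K `^ q.
Proof.
move=> q0; rewrite /abs_powN; have [l0|l0] := eqVneq (lam i) 0.
  by rewrite normr0 powR_ge0.
rewrite ger0_norm ?powR_ge0 // powRN -powR_inv1 ?powR_ge0 // powRAC powR_inv1 //.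
by apply: ge0_ler_powR; rewrite ?nnegrE ?invr_ge0 ?(ltW K0) // hK.
Qed.

Lemma abs_op_powNP (q : R) : 0 <= q ->
  [/\ bounded_op (abs_op_powN D q),
      forall x i, '[abs_op_powN D q x, e i] = (abs_powN q (lam i))%:C%C * '[x, e i] &
      abs_op_powN D q = diag_op e (abs_powN q \o lam)].
Proof.
move=> q0; have E : abs_op_powN D q = diag_op e (abs_powN q \o lam).
  apply: borel_calculus_diag (powR_ge0 K q) _; first exact: measurable_abs_powN.
  by move=> i _; exact: abs_powN_bound.
have [bX cX _] := diag_opP he tot (f := abs_powN q \o lam) (powR_ge0 K q)
  (fun i _ => abs_powN_bound i q0).
by rewrite E.
Qed.

Lemma sign_op_coord x i :
  '[sign_op D x, e i] = (lam i * abs_powN 1 (lam i))%:C%C * '[x, e i].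
Proof.
have f1 j : d j -> `|lam j * abs_powN 1 (lam j)| <= 1.
  move=> _; rewrite /abs_powN; have [->|l0] := eqVneq (lam j) 0; first by rewrite mul0r normr0.
  rewrite normrM powR_inv1 // [X in _ * X]ger0_norm ?invr_ge0 //.
  by rewrite mulfV // normr_eq0.
have [bX cX _] := diag_opP he tot (f := fun j => lam j * abs_powN 1 (lam j)) ler01 f1.
have [b1 c1 _] := abs_op_powNP ler01.
rewrite /sign_op /=.
have [|_ ->] := @udom_coord _ _ _ _ he tot lam D sD hD (abs_op_powN D 1 x)
   (diag_op e (fun j => lam j * abs_powN 1 (lam j)) x); last exact: cX.
by move=> j; rewrite cX c1 rmorphM mulrA.
Qed.

Lemma kernel_proj_coord x i : '[kernel_proj D x, e i] = (lam i == 0)%:R%:C%C * '[x, e i].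
Proof.
have f1 j : d j -> `|(lam j == 0)%:R : R| <= 1.
  by move=> _; case: eqP; rewrite ?normr1 ?normr0 ?ler01.
have [bX cX _] := diag_opP he tot (f := fun j => (lam j == 0)%:R) ler01 f1.
set P := diag_op e _ in bX cX.
have kv v : ukernel D v -> forall j, lam j != 0 -> '[v, e j] = 0.
  move=> [dv Dv] j lj; have := coord_uop sD hD j dv.
  by rewrite Dv inner0l => /esym/eqP; rewrite mulf_eq0 fmorph_eq0 (negbTE lj) => /eqP.
have kP : ukernel D (P x).
  have [|dP DP] := @udom_coord _ _ _ _ he tot lam D sD hD (P x) 0; last by [].
  move=> j; rewrite inner0l cX; have [->|] := eqVneq (lam j) 0; first by rewrite mul0r.
  by rewrite mul0r mulr0.
have pP v : ukernel D v -> '[x - P x, v] = 0.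
  move=> kvv; rewrite -(inner0l (0 : H)); apply: (inner_coord_eq he tot) => j.
  rewrite inner0l mul0r; have [l0|lj] := eqVneq (lam j) 0; last by rewrite (kv v) // conjC0 mulr0.
  by rewrite innerBl cX l0 eqxx mul1r subrr mul0r.
suff -> : kernel_proj D x = P x by exact: cX.
rewrite /kernel_proj /orth_proj; case: xgetP => [y _ [ky py]|/(_ (P x))[]]; last by split.
apply/eqP; rewrite -subr_eq0; apply/eqP/inner_eq0.
have kyP : ukernel D (y - P x).
  have [k0 kl] := ukernel_linset D; have := kl (-1) _ _ kP ky.
  by rewrite scaleN1r addrC.
have -> : '[y - P x, y - P x] = '[x - P x, y - P x] - '[x - y, y - P x].
  rewrite -innerBl; congr (inner _ _ _).
  by rewrite [in RHS]opprB [RHS]addrC addrA subrK.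
by rewrite pP // py // subrr.
Qed.

End FunctionalCalculus.

(** * Singular values and weak ideals *)

Section FiniteDefect.
Context {R : realType} {H : hilbertSpace R}.
Local Notation C := R[i].
Implicit Types (f : H -> C) (fs : seq (H -> C)) (X Y : H -> H).

Definition bounded_functional f :=
  (forall c x y, f (c *: x + y) = c * f x + f y) /\
  exists2 M : R, 0 <= M & forall x, normc (f x) <= M * nrm x.

Fixpoint all_bounded fs : Prop :=
  if fs is f :: fs' then bounded_functional f /\ all_bounded fs' else True.

(* Up to constants, [X] is at distance at most [b] from the operators of rank at
   most [k]. *)
Definition fd_small X (k : nat) (b : R) := exists fs K,
  [/\ (size fs <= k)%N, all_bounded fs, 0 <= K &
      forall x, nrm (X x) <= b * nrm x + K * \sum_(f <- fs) normc (f x)].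

Lemma all_bounded_cat fs fs' : all_bounded (fs ++ fs') <-> all_bounded fs /\ all_bounded fs'.
Proof. by elim: fs => [|f fs IH] /=; tauto. Qed.

Lemma all_bounded_map (I : Type) (F : I -> H -> C) (s : seq I) :
  (forall i, bounded_functional (F i)) -> all_bounded (map F s).
Proof. by move=> h; elim: s => //= i s IH; split. Qed.

Lemma bounded_functional_inner X v : bounded_op X -> bounded_functional (fun x => '[X x, v]).
Proof.
move=> bX; split=> [c x y|]; first by rewrite (bopD bX) (bopZ bX) innerDl innerZl.
have [M M0 hM] := bop_bound bX; exists (M * nrm v); first by rewrite mulr_ge0 ?nrm_ge0 ?ltW.
move=> x; apply: le_trans (cauchy_schwarz _ _) _; rewrite mulrAC.
by rewrite ler_wpM2r ?nrm_ge0.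
Qed.

Lemma fd_smallD X Y k l a b : fd_small X k a -> fd_small Y l b -> fd_small (X + Y) (k + l) (a + b).
Proof.
move=> [fs [K [sf bf K0 hK]]] [gs [L [sg bg L0 hL]]]; exists (fs ++ gs), (K + L); split.
- by rewrite size_cat leq_add.
- exact/all_bounded_cat.
- exact: addr_ge0.
move=> x; apply: le_trans (nrmD _ _) _; apply: le_trans (lerD (hK x) (hL x)) _.
rewrite big_cat /= !mulrDl !mulrDr.
set p := \sum_(f <- fs) _; set q := \sum_(f <- gs) _.
have p0 : 0 <= p by apply: sumr_ge0 => f _; exact: normc_ge0.
have q0 : 0 <= q by apply: sumr_ge0 => f _; exact: normc_ge0.
by have := mulr_ge0 K0 q0; have := mulr_ge0 L0 p0; lra.
Qed.

Lemma fd_small_le X k a b : a <= b -> fd_small X k a -> fd_small X k b.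
Proof.
move=> ab [fs [K [sf bf K0 hK]]]; exists fs, K; split=> // x.
by apply: le_trans (hK x) _; rewrite lerD2r ler_wpM2r ?nrm_ge0.
Qed.

Lemma bounded_functional_sum f N (c : 'I_N -> C) (v : 'I_N -> H) : bounded_functional f ->
  f (\sum_i c i *: v i) = \sum_i c i * f (v i).
Proof.
move=> [lf _].
have f0 : f 0 = 0 by have := lf (-1) 0 0; rewrite scaler0 addr0 mulN1r addNr.
have fD x y : f (x + y) = f x + f y by have := lf 1 x y; rewrite scale1r mul1r.
rewrite (big_morph f fD f0); apply: eq_bigr => i _.
by rewrite -[c i *: v i]addr0 lf f0 addr0.
Qed.

(** The values of the functionals at the [v i] form a matrix with more rows than columns; a nonzero
    row of its left kernel supplies the coefficients. *)
Lemma kernel_combination N fs (v : 'I_N -> H) : all_bounded fs -> (size fs < N)%N ->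
  exists2 c : 'I_N -> C, (exists i, c i != 0) &
    \sum_(f <- fs) normc (f (\sum_i c i *: v i)) = 0.
Proof.
move=> bfs sN; pose A := \matrix_(i < N, j < size fs) (nth (fun=> 0) fs j) (v i).
have kA : kermx A != 0.
  rewrite kermx_eq0; apply/negP => /eqP rA.
  by have := rank_leq_col A; rewrite rA leqNgt sN.
have [r [c hc]] : exists i j, kermx A i j != 0.
  apply: contrapT => h; move/negP: kA; apply; apply/eqP/matrixP => i j; rewrite [RHS]mxE.
  by apply/eqP; apply: contrapT => /negP hij; apply: h; exists i, j.
exists (kermx A r); first by exists c.
have bnth j : (j < size fs)%N -> bounded_functional (nth (fun=> 0) fs j).
  by elim: fs bfs {A sN kA r c hc} j => //= f fs IH [bf bfs] [|j] //= hj; exact: IH.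
rewrite (big_nth (fun=> 0)) big_mkord big1 // => j _.
rewrite bounded_functional_sum; last exact: bnth.
have /matrixP/(_ r j) := mulmx_ker A; rewrite [LHS]mxE [RHS]mxE => E.
suff -> : \sum_i kermx A r i * nth (fun=> 0) fs j (v i) = 0 by rewrite normc0.
by rewrite -[RHS]E; apply: eq_bigr => i _; rewrite [A i j]mxE.
Qed.

Lemma orthonormal_comb_nrm N (v : 'I_N -> H) (c : 'I_N -> C) :
  (forall i k, '[v i, v k] = (i == k)%:R) ->
  nrm (\sum_i c i *: v i) ^+ 2 = \sum_i normc (c i) ^+ 2.
Proof.
move=> ov; rewrite -Re_inner_nrm inner_suml Re_sum; apply: eq_bigr => i _.
rewrite innerZl inner_sumr (bigD1 i) //= innerZr ov eqxx mulr1 big1 ?addr0.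
  by rewrite mul_conjC.
by move=> k; rewrite eq_sym => /negbTE ki; rewrite innerZr ov ki mulr0.
Qed.

(** Any [N + 1] orthonormal eigenvectors of the adjoint times [X], with eigenvalues at least
    [s ^ 2], have a nonzero combination [z] annihilated by the functionals of [fd_small]. For it
    [s |z| <= |X z| <= b |z|]. *)
Lemma singular_value_le X N k b : 0 <= b -> (k <= N)%N -> fd_small X k b ->
  bounded_op X -> singular_value X N <= b.
Proof.
move=> b0 kN [fs [K [sf bf K0 hK]]] bX; rewrite /singular_value; set A := [set s : R | _].
have Ab s : A s -> s <= b.
  move=> [s0 [S [v [l [aS ov hl]]]]].
  have [|c [i0 ci0] hc] := kernel_combination (N := N.+1) v bf.
    by rewrite ltnS (leq_trans sf).
  have [z zE] : exists z, z = \sum_i c i *: v i by eexists.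
  have nz : nrm z ^+ 2 = \sum_i normc (c i) ^+ 2 by rewrite zE; exact: orthonormal_comb_nrm.
  have nz0 : 0 < nrm z.
    rewrite lt_def nrm_ge0 andbT; apply/negP => /eqP z0.
    move: nz; rewrite z0 expr0n /= => /esym/eqP; rewrite psumr_eq0; last first.
      by move=> i _; exact: sqr_ge0.
    move/allP/(_ i0); rewrite mem_index_enum => /(_ isT) /=.
    by rewrite sqrf_eq0 normc_eq0 (negbTE ci0).
  have Xz : s ^+ 2 * nrm z ^+ 2 <= nrm (X z) ^+ 2.
    have Xz : X z = \sum_i c i *: X (v i)
      by rewrite zE (bop_sum bX); apply: eq_bigr => i _; rewrite (bopZ bX).
    rewrite -[nrm (X z) ^+ 2]Re_inner_nrm {2}Xz inner_sumr Re_sum nz mulr_sumr.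
    apply: ler_sum => i _; have [sl Sv] := hl i.
    rewrite innerZr aS Sv innerZr conjC_real [(c i)^* * _]mulrCA ReM_real.
    have -> : '[z, v i] = c i.
      rewrite zE inner_suml (bigD1 i) //= innerZl ov eqxx mulr1 big1 ?addr0 //.
      by move=> k0 /negbTE ki; rewrite innerZl ov ki mulr0.
    rewrite [_ * c i]mulrC mul_conjC /= ler_wpM2r ?sqr_ge0 //.
    by rewrite ler_pXn2r // nnegrE; apply: le_trans s0 sl.
  have := hK z; have -> : \sum_(f <- fs) normc (f z) = 0 by rewrite zE.
  rewrite mulr0 addr0 => h.
  rewrite -(ler_pM2r nz0); apply: le_trans h.
  by rewrite -(ler_pXn2r (n := 2)) ?nnegrE ?mulr_ge0 ?nrm_ge0 // exprMn.
have [A0|A0] := pselect (A !=set0); first by apply: ge_sup.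
by rewrite sup_out // => -[].
Qed.

Lemma singular_value_ge0 X N : 0 <= singular_value X N.
Proof.
rewrite /singular_value; set A := [set s : R | _].
have [sA|nA] := pselect (has_sup A); last by rewrite sup_out.
have [[s As] _] := sA.
by apply: le_trans (ub_le_sup _ As); [case: As|case: sA].
Qed.

Lemma singular_value_ge X N s S (v : 'I_N.+1 -> H) (l : 'I_N.+1 -> R) : bounded_op X ->
  0 <= s -> is_adjoint X S -> (forall i k, '[v i, v k] = (i == k)%:R) ->
  (forall i, s <= l i /\ S (X (v i)) = (l i ^+ 2)%:C%C *: v i) ->
  s <= singular_value X N.
Proof.
move=> bX s0 aS ov hl; rewrite /singular_value.
apply: ub_le_sup; last by split=> //; exists S, v, l.
have [M M0 hM] := bop_bound bX; exists M => s1 [s10 [S1 [v1 [l1 [aS1 ov1 hl1]]]]].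
have [sl Sv] := hl1 ord0; apply: le_trans sl _.
have n1 : nrm (v1 ord0) ^+ 2 = 1 by rewrite -Re_inner_nrm ov1 eqxx.
have n1' : nrm (v1 ord0) = 1.
  by apply/eqP; rewrite -(eqrXn2 (n := 2)) ?nrm_ge0 // n1 expr1n.
have E : l1 ord0 ^+ 2 = nrm (X (v1 ord0)) ^+ 2.
  by rewrite -Re_inner_nrm aS1 Sv innerZr conjC_real ReM_real Re_inner_nrm n1 mulr1.
have hX := hM (v1 ord0); rewrite n1' mulr1 in hX.
apply: le_trans (ler_norm _) _.
rewrite -(ler_pXn2r (n := 2)) ?nnegrE ?(ltW M0) // real_normK ?num_real // E.
by rewrite ler_pXn2r ?nnegrE ?nrm_ge0 ?(ltW M0).
Qed.

(** The sets are the cells of a square grid of mesh [h / 2]: inside a cell the real and the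
    imaginary parts each vary by at most [h / 2]. *)
Lemma disc_cover (h M : R) : 0 < h -> exists (J : seq (set C)),
  (forall z : C, normc z <= M -> exists2 Q, Q \in J & Q z) /\
  (forall Q, Q \in J -> forall z z', Q z -> Q z' -> normc (z - z') <= h).
Proof.
move=> h0; have h2 : 0 < h / 2 by rewrite divr_gt0.
(* [Num.truncn] sends negative numbers to 0, hence the explicit lower bounds on both parts. *)
pose cell (i j : nat) := [set z : C | Num.truncn ((complex.Re z + M) / (h / 2)) = i /\
   Num.truncn ((complex.Im z + M) / (h / 2)) = j /\ - M <= complex.Re z /\ - M <= complex.Im z].
pose B := (Num.truncn ((M + M) / (h / 2))).+1.
pose J := [seq cell p.1 p.2 | p <- allpairs pair (iota 0 B) (iota 0 B)].
have Im_le (z : C) : `|complex.Im z| <= normc z.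
  have := normc_ge_Re (z * 'i%C); rewrite normrM normCE.
  rewrite [`|'i%C|]normCE -rmorphM lecR /= ReiNIm normrN.
  by rewrite expr0n expr1n add0r sqrtr1 mulr1.
have Re_le (z : C) : `|complex.Re z| <= normc z.
  by have := normc_ge_Re z; rewrite normCE lecR.
have InJ i j : (i < B)%N -> (j < B)%N -> cell i j \in J.
  by move=> iB jB; apply/mapP; exists (i, j) => //; apply/allpairsP; exists (i, j); rewrite !mem_iota.
have InJ' Q : Q \in J -> exists i j, Q = cell i j.
  by move=> /mapP[p _ ->]; exists p.1, p.2.
have close (r r' : R) : - M <= r -> - M <= r' ->
    Num.truncn ((r + M) / (h / 2)) = Num.truncn ((r' + M) / (h / 2)) -> `|r - r'| <= h / 2.
  move=> r0 r'0 E.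
  have p0 : 0 <= (r + M) / (h / 2) by rewrite divr_ge0 ?(ltW h2) //; lra.
  have p'0 : 0 <= (r' + M) / (h / 2) by rewrite divr_ge0 ?(ltW h2) //; lra.
  have a1 := truncn_le ((r + M) / (h / 2)); have a2 := truncnS_gt ((r + M) / (h / 2)).
  have b1 := truncn_le ((r' + M) / (h / 2)); have b2 := truncnS_gt ((r' + M) / (h / 2)).
  rewrite p0 in a1; rewrite p'0 in b1; rewrite E in a1 a2.
  rewrite -(natr1 (Num.truncn _)) in a2; rewrite -(natr1 (Num.truncn _)) in b2.
  rewrite ler_pdivlMr // in a1; rewrite ler_pdivlMr // in b1.
  rewrite ltr_pdivrMr // in a2; rewrite ltr_pdivrMr // in b2.
  move: a1 a2 b1 b2; move: (Num.truncn _)%:R => k; rewrite !mulrDl ler_norml.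
  by move: (k * _) => kh; rewrite mul1r => ? ? ? ?; apply/andP; split; lra.
exists J; split=> [z zM|Q /InJ'[i [j ->]] z z' [zi [zj [z1 z2]]] [zi' [zj' [z1' z2']]]].
  have bd (r : R) : `|r| <= M -> - M <= r /\ (Num.truncn ((r + M) / (h / 2)) < B)%N.
    rewrite ler_norml => /andP[r1 r2]; split=> //; rewrite /B ltnS.
    apply: le_truncn.
    by rewrite ler_pM2r ?invr_gt0 // lerD2r.
  have [x1 x2] := bd _ (le_trans (Re_le z) zM).
  have [y1 y2] := bd _ (le_trans (Im_le z) zM).
  exists (cell (Num.truncn ((complex.Re z + M) / (h / 2))) (Num.truncn ((complex.Im z + M) / (h / 2)))).
    exact: InJ.
  by [].
have c1 := close _ _ z1 z1' (etrans zi (esym zi')).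
have c2 := close _ _ z2 z2' (etrans zj (esym zj')).
have : normc (z - z') <= `|complex.Re (z - z')| + `|complex.Im (z - z')|.
  rewrite -lecR -normCE [X in `|X|]complexE; apply: le_trans (ler_normD _ _) _.
  rewrite normrM !normCE !normc_real rmorphD /= lerD2l.
  by rewrite expr0n expr1n add0r sqrtr1 mul1r.
rewrite ReB; have -> : complex.Im (z - z') = complex.Im z - complex.Im z'.
  by case: (z) (z') => [? ?] [? ?].
by move: c1 c2; move: (`|_|) (`|_|) => p q; lra.
Qed.

Lemma functionals_cover fs (h : R) : all_bounded fs -> 0 < h -> exists (J : seq (set H)),
  (forall x : H, nrm x <= 1 -> exists2 Q, Q \in J & Q x) /\
  (forall Q, Q \in J -> forall x y, Q x -> Q y ->
     \sum_(f <- fs) normc (f (x - y)) <= (size fs)%:R * h).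
Proof.
move=> + h0; elim: fs => [_|f fs IH /= [[lf [M M0 hM]] bfs]].
  exists [:: setT]; split=> [x _|Q _ x y _ _]; first by exists setT; rewrite ?mem_head.
  by rewrite big_nil mul0r.
have [J [cJ dJ]] := IH bfs; have [I [cI dI]] := disc_cover M h0.
have fB x y : f (x - y) = f x - f y.
  by have := lf (-1) y x; rewrite scaleN1r mulN1r addrC => ->; rewrite addrC.
exists [seq P `&` (f @^-1` Q) | P <- J, Q <- I]; split.
  move=> x x1; have [P PJ Px] := cJ x x1.
  have [|Q QI Qx] := cI (f x); first by apply: le_trans (hM x) _; rewrite ler_piMr.
  by exists (P `&` (f @^-1` Q)) => //; apply/allpairsP; exists (P, Q).
move=> W /allpairsP[[P Q] /= [PJ QI ->]].
move=> x y [Px Qx] [Py Qy]; rewrite big_cons fB -natr1 mulrDl mul1r addrC.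
by rewrite lerD ?(dJ P) ?(dI Q).
Qed.

(** Total boundedness, tested on ultrafilters. The unit ball is a finite union of pieces with images
    of small diameter; an ultrafilter on the closed image contains a neighbourhood of one of these
    images, so it is Cauchy and converges. *)
Lemma compact_op_of_fd_small X : bounded_op X ->
  (forall e : R, 0 < e -> exists k, fd_small X k e) -> compact_op X.
Proof.
move=> bX hX; split=> //; rewrite precompactE compact_ultra => F FU FA.
set A := X @` _ in FA *.
have FC : cauchy F.
  apply: cauchy_exP => c /gt0_complex[e e0 ->].
  have [k [fs [K [_ bf K0 hK]]]] := hX (e / 8) (divr_gt0 e0 (ltr0Sn _ 7)).
  (* With this mesh the functionals contribute at most [e / 8], and the term in the norm at most
     [2 e / 8]; the total is below [e / 2]. *)
  pose h := e / 8 / ((K + 1) * ((size fs)%:R + 1)).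
  have K1 : 0 < K + 1 by rewrite ltr_wpDl.
  have s1 : 0 < (size fs)%:R + 1 :> R by rewrite ltr_wpDl.
  have h0 : 0 < h by rewrite !divr_gt0 ?mulr_gt0.
  have [J [cJ dJ]] := functionals_cover bf h0.
  have small Q : Q \in J -> forall x y, Q x -> Q y -> nrm x <= 1 -> nrm y <= 1 ->
      nrm (X x - X y) <= e / 2.
    move=> QJ x y Qx Qy x1 y1; rewrite -(bopB bX); apply: le_trans (hK _) _.
    have n2 : nrm (x - y) <= 2 by apply: le_trans (nrmB _ _) _; lra.
    have a1 : e / 8 * nrm (x - y) <= e / 8 * 2.
      by rewrite ler_wpM2l // divr_ge0 // ltW.
    have a2 : K * \sum_(f <- fs) normc (f (x - y)) <= e / 8.
      apply: (@le_trans _ _ ((K + 1) * (((size fs)%:R + 1) * h))).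
        apply: ler_pM => //; first by apply: sumr_ge0 => f _; exact: normc_ge0.
          by rewrite lerDl.
        apply: le_trans (dJ Q QJ x y Qx Qy) _.
        by rewrite ler_wpM2r ?(ltW h0) // lerDl.
      have -> : (K + 1) * (((size fs)%:R + 1) * h) = e / 8 by rewrite /h; field; rewrite !gt_eqF.
      by [].
    by move: a1 a2; lra.
  have cover : closure A `<=` \big[setU/set0]_(Q <- J)
      [set y | exists2 x, (Q x /\ nrm x <= 1) & nrm (X x - y) < e / 4].
    move=> y /closure_nrmP/(_ (e / 4))[|_ [x /= x1 <-] hxy]; first by rewrite divr_gt0.
    rewrite nrm_le1 in x1; have [Q QJ Qx] := cJ x x1.
    elim: J QJ {cJ dJ small} => //= Q' J' IH; rewrite inE => /orP[/eqP <-|/IH h1]; rewrite big_cons.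
      by left; exists x.
    by right.
  have : F (\big[setU/set0]_(Q <- J)
      [set y | exists2 x, (Q x /\ nrm x <= 1) & nrm (X x - y) < e / 4]).
    by apply: filterS cover FA.
  have {cover cJ dJ} : forall J', (forall Q, Q \in J' -> Q \in J) -> F (\big[setU/set0]_(Q <- J')
      [set y | exists2 x, (Q x /\ nrm x <= 1) & nrm (X x - y) < e / 4]) ->
      exists x0 : H, F (ball x0 e%:C%C).
    elim=> [_|Q J' IH sub].
      by rewrite big_nil => /filter_ex[].
    rewrite big_cons => FQ.
    have [FQ'|FQ'] := in_ultra_setVsetC
       [set y | exists2 x, (Q x /\ nrm x <= 1) & nrm (X x - y) < e / 4] FU.
      have [_ [x0 [Qx0 x01] _]] := filter_ex FQ'.
      exists (X x0); apply: filterS FQ' => y [x [Qx x1] hxy].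
      rewrite -ball_normE /= nrmE ltcR.
      have := small Q (sub Q (mem_head _ _)) _ _ Qx0 Qx x01 x1.
      have := nrm_tri (X x) (X x0) y; move: hxy.
      by move: (nrm _) (nrm _) (nrm _) => p q r; lra.
    apply: IH => [P PJ|]; first by apply: sub; rewrite inE PJ orbT.
    apply: filterS (filterI FQ FQ') => y [[]//].
  by move=> /(_ J (fun _ => id)).
have /cauchy_cvgP/cvg_ex[l Fl] := FC.
exists l; split=> //; apply: closed_closure => B nB.
have FB := Fl _ nB.
by have [y [? ?]] := filter_ex (filterI FA FB); exists y.
Qed.

End FiniteDefect.

(** * Schur multipliers acting on operators *)

Section SchurMultipliers.
Context {R : realType} {H : hilbertSpace R}.
Local Notation C := R[i].
Variables (e : nat -> H) (d : nat -> bool).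
Hypothesis he : forall i j, '[e i, e j] = ((i == j) && d i)%:R.
Hypothesis tot : forall x, (forall i, '[x, e i] = 0) -> x = 0.

Lemma basis_comb_nrm N (c : 'I_N -> C) :
  nrm (\sum_i c i *: e i) ^+ 2 <= \sum_i normc (c i) ^+ 2.
Proof.
rewrite -Re_inner_nrm inner_suml Re_sum; apply: ler_sum => i _.
rewrite innerZl inner_sumr (bigD1 i) //= innerZr he eqxx big1 ?addr0 /=.
  by rewrite mulrA mul_conjC; case: (d i); rewrite ?mulr1 ?mulr0 ?sqr_ge0.
move=> k ki; rewrite innerZr he (_ : (i == k :> nat) = false) ?mulr0 //.
by apply/negbTE; rewrite eq_sym.
Qed.

Lemma nrm_basis_le1 i : nrm (e i) <= 1.
Proof.
rewrite -(@ler_pXn2r _ 2) ?nnegrE ?nrm_ge0 // -Re_inner_nrm he eqxx /= expr1n.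
by case: (d i); rewrite ?ler01.
Qed.

Lemma nrm_le_sum_coord z (s : seq nat) : uniq s ->
  (forall i, i \notin s -> '[z, e i] = 0) -> nrm z <= \sum_(i <- s) normc '[z, e i].
Proof.
move=> us zs; have -> : z = \sum_(i <- s) '[z, e i] *: e i.
  apply: (coord_inj tot) => j; rewrite inner_suml.
  have [js|js] := boolP (j \in s); last first.
    rewrite zs // big_seq big1 // => i si; rewrite innerZl he.
    by case: eqVneq si js => [->->|_]; rewrite ?mulr0.
  rewrite (bigD1_seq j) //= innerZl he eqxx big1 ?addr0 => [|i /negbTE ij]; last first.
    by rewrite innerZl he ij mulr0.
  by have [dj|dj] := boolP (d j); rewrite ?mulr1 // (coord_dead he) // mul0r.
apply: le_trans (nrm_sum _ _ _) _; apply: ler_sum => i _.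
rewrite nrmZ.
have -> : '[\sum_(j <- s) '[z, e j] *: e j, e i] = '[z, e i] *+ (i \in s).
  rewrite inner_suml; have [js|js] := boolP (i \in s); last first.
    rewrite big_seq big1 // => j sj; rewrite innerZl he.
    by case: eqVneq sj js => [->->|_]; rewrite ?mulr0.
  rewrite (bigD1_seq i) //= innerZl he eqxx big1 ?addr0 => [|j /negbTE ij]; last first.
    by rewrite innerZl he ij mulr0.
  by have [dj|dj] := boolP (d i); rewrite ?mulr1 // (coord_dead he) // mul0r.
have [si|si] := boolP (i \in s); first by rewrite ler_piMr ?normc_ge0 ?nrm_basis_le1.
by rewrite zs // normc0 mul0r.
Qed.

(** For fixed coefficients [x] and [y], Cauchy-Schwarz shows that the real matrix [w] is dominated
    by [opnorm T / 2] times the squared moduli; the Schur estimate is then the hypothesis of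
    [op_of_matrix]. *)
Lemma schur_op psi : schur psi -> exists2 M : R, 0 <= M & forall T, bounded_op T ->
  exists X, [/\ bounded_op X,
    forall n m, '[X (e n), e m] = (psi m n)%:C%C * '[T (e n), e m] &
    forall x, nrm (X x) <= M * opnorm T * nrm x].
Proof.
(* [op_of_matrix] asks for a positive bound, whence [M + 1] and the separate case [opnorm T = 0]. *)
move=> [M M0 hM]; exists (M + 1) => [|T bT]; first exact: addr_ge0.
have [T0|TN] := eqVneq (opnorm T) 0.
  exists 0; split; first exact: bounded_op0.
    move=> n m; suff -> : T (e n) = 0 by rewrite !inner0l mulr0.
    apply/eqP; rewrite -nrm_eq0; apply/eqP/le_anti; rewrite nrm_ge0 andbT.
    by have := opnorm_bound bT (e n); rewrite T0 mul0r.
  by move=> x; rewrite T0 mulr0 mul0r nrm0.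
have tau0 : 0 < opnorm T by rewrite lt_def TN opnorm_ge0.
apply: (op_of_matrix he tot (c := fun m n => (psi m n)%:C%C * '[T (e n), e m])).
- by rewrite mulr_gt0 // ltr_wpDl.
- move=> m n /orP[/(basis_dead he)->|/(basis_dead he)->].
    by rewrite inner0r mulr0.
  by rewrite (bop0 bT) inner0l mulr0.
move=> N K x y; set tau := opnorm T in tau0 *.
pose w (m : 'I_N) (n : 'I_K) := complex.Re ('[T (e n), e m] * x n * (y m)^*).
pose b (m : 'I_N) := tau / 2 * normc (y m) ^+ 2.
pose a (n : 'I_K) := tau / 2 * normc (x n) ^+ 2.
have dw : dominated w b a.
  move=> f g.
  have [u uE] : exists u, u = \sum_(n < K) ((g n)%:C%C * x n) *: e n by eexists.
  have [v vE] : exists v, v = \sum_(m < N) ((f m)%:C%C * y m) *: e m by eexists.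
  have -> : \sum_m \sum_n f m * g n * w m n = complex.Re '[T u, v].
    rewrite uE (bop_sum bT) vE inner_sumr Re_sum; apply: eq_bigr => m _.
    rewrite inner_suml Re_sum; apply: eq_bigr => n _.
    rewrite (bopZ bT) innerZl innerZr rmorphM /= conjC_real /w -mulrA -!ReM_real.
    by congr complex.Re; ring.
  have nu : nrm u ^+ 2 <= \sum_n g n ^+ 2 * normc (x n) ^+ 2.
    rewrite uE; apply: le_trans (basis_comb_nrm _) _; apply: ler_sum => n _.
    by rewrite normcM exprMn normc_real real_normK ?num_real.
  have nv : nrm v ^+ 2 <= \sum_m f m ^+ 2 * normc (y m) ^+ 2.
    rewrite vE; apply: le_trans (basis_comb_nrm _) _; apply: ler_sum => m _.
    by rewrite normcM exprMn normc_real real_normK ?num_real.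
  apply: le_trans (Re_le_normc _) _; apply: le_trans (cauchy_schwarz _ _) _.
  apply: (@le_trans _ _ (tau * nrm u * nrm v)).
    by rewrite ler_wpM2r ?nrm_ge0 ?opnorm_bound.
  apply: (@le_trans _ _ (tau / 2 * (nrm v ^+ 2 + nrm u ^+ 2))).
    rewrite -!mulrA ler_pM2l //; move: (nrm u) (nrm v) => p q.
    by have := sqr_ge0 (p - q); lra.
  apply: (@le_trans _ _ (tau / 2 *
      (\sum_m f m ^+ 2 * normc (y m) ^+ 2 + \sum_n g n ^+ 2 * normc (x n) ^+ 2))).
    by rewrite ler_wpM2l ?divr_ge0 ?(ltW tau0) // lerD.
  rewrite mulrDr !mulr_sumr lerD // ler_sum // => i _; rewrite /a /b mulrA mulrAC //.
have := hM N K (fun m => m : nat) (fun n => n : nat) w b a dw.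
have -> : complex.Re (matrix_form N K (fun m n => (psi m n)%:C%C * '[T (e n), e m]) x y) =
    \sum_(m < N) \sum_(n < K) psi m n * w m n.
  rewrite /matrix_form Re_sum; apply: eq_bigr => m _; rewrite Re_sum; apply: eq_bigr => n _.
  by rewrite -!mulrA ReM_real /w mulrA.
move=> h; apply: le_trans h _; rewrite /a /b -!mulr_sumr.
set p := \sum_(m < N) _; set q := \sum_(n < K) _.
have p0 : 0 <= p by apply: sumr_ge0 => i _; exact: sqr_ge0.
have q0 : 0 <= q by apply: sumr_ge0 => i _; exact: sqr_ge0.
have := mulr_ge0 (ltW tau0) p0; have := mulr_ge0 (ltW tau0) q0; lra.
Qed.

Variables (nk : nat -> bool) (L : nat -> R) (K : R).
Hypothesis L0 : forall i, 0 < L i.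
Hypothesis K0 : 0 < K.
Hypothesis LK : forall i, nk i -> (L i)^-1 <= K.

Let mask (P : pred nat) (a : R) i := (nk i && P i)%:R * L i `^ (- a).

Lemma mask_bound (P : pred nat) a t : 0 <= a -> 0 <= t ->
  (forall i, nk i -> P i -> (L i)^-1 <= t) -> forall i, d i -> `|mask P a i| <= t `^ a.
Proof.
move=> a0 t0 h i _; rewrite /mask; case: (boolP (nk i && P i)) => [/andP[ni Pi]|_].
  rewrite mul1r ger0_norm ?powR_ge0 // powRN -[leLHS]powR_inv1 ?powR_ge0 //.
  rewrite -powRrM mulrN1 -mulN1r powRrM powR_inv1 ?(ltW (L0 i)) //.
  by rewrite ge0_ler_powR ?nnegrE ?invr_ge0 ?(ltW (L0 i)) //; exact: h.
by rewrite mul0r normr0 powR_ge0.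
Qed.

(** A single weighted term acts as [A Y B] with diagonal weights [A], [B] and [Y] the bounded
    multiplier of [T]. Cutting both weights along [s] gives [A Y B1 + A1 Y B2 + A2 Y B2]: the first
    two terms factor through the coordinates in [s], and the third has norm at most that of [Y]
    times [t ^ a * t ^ b]. *)
Lemma weighted_op de phi : weighted L de phi -> exists (c : nat) (M : R), 0 <= M /\
  forall T, bounded_op T -> exists X, [/\ bounded_op X,
    forall n m, '[X (e n), e m] = ((nk m)%:R * phi m n * (nk n)%:R)%:C%C * '[T (e n), e m],
    forall x, nrm (X x) <= M * opnorm T * nrm x &
    forall t (s : seq nat), 0 < t -> uniq s -> (forall i, nk i -> t < (L i)^-1 -> i \in s) ->
      fd_small X (c * size s) (M * opnorm T * t `^ de)].
Proof.
elim=> [a b psi a0 b0 <- spsi|phi1 phi2 _ [c1 [M1 [M10 h1]]] _ [c2 [M2 [M20 h2]]]]; last first.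
  exists (c1 + c2)%N, (M1 + M2); split; first exact: addr_ge0.
  move=> T bT; have [X [bX eX nX fX]] := h1 T bT; have [Y [bY eY nY fY]] := h2 T bT.
  exists (X + Y); split.
  - exact: bounded_opD.
  - move=> n m; rewrite innerDl eX eY -mulrDl -rmorphD /=; congr (_%:C%C * _); ring.
  - move=> x; apply: le_trans (nrmD _ _) _; rewrite !mulrDl; exact: lerD.
  by move=> t s t0 us hs; rewrite mulnDl !mulrDl; apply: fd_smallD; [exact: fX|exact: fY].
have [M M0 hM] := schur_op spsi.
have Ka0 := powR_ge0 K a; have Kb0 := powR_ge0 K b.
(* The 2 counts the two terms that pass through [s]. The first summand of the constant serves the
   operator norm, the second the tail. *)
exists 2%N, (K `^ a * M * K `^ b + M); split; first by rewrite addr_ge0 ?mulr_ge0.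
move=> T bT; have [Y [bY eY nY]] := hM T bT; have tau0 := opnorm_ge0 bT.
have Mt0 : 0 <= M * opnorm T by rewrite mulr_ge0.
have dP q (P : pred nat) t : 0 <= q -> 0 <= t -> (forall i, nk i -> P i -> (L i)^-1 <= t) ->
  [/\ bounded_op (diag_op e (mask P q)),
    forall x i, '[diag_op e (mask P q) x, e i] = (mask P q i)%:C%C * '[x, e i] &
    forall x, nrm (diag_op e (mask P q) x) <= t `^ q * nrm x].
  by move=> q0 t0 h; apply: (diag_opP he tot) (powR_ge0 _ _) (mask_bound q0 t0 h).
have KT i : nk i -> true -> (L i)^-1 <= K by move=> /LK.
have [bA cA nA] := dP a predT K a0 (ltW K0) KT.
have [bB cB nB] := dP b predT K b0 (ltW K0) KT.
set A := diag_op e (mask predT a) in bA cA nA; set B := diag_op e (mask predT b) in bB cB nB.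
have bX := bounded_op_comp bA (bounded_op_comp bY bB).
exists (A \o (Y \o B)); split=> //=.
- move=> n m; rewrite cA.
  have -> : B (e n) = (mask predT b n)%:C%C *: e n.
    exact: (diag_op_basis he tot n (powR_ge0 _ _) (mask_bound b0 (ltW K0) KT)).
  rewrite (bopZ bY) innerZl eY !mulrA -!rmorphM /= /mask !andbT; congr (_%:C%C * _); ring.
- move=> x; apply: le_trans (nA _) _.
  apply: (@le_trans _ _ (K `^ a * (M * opnorm T * (K `^ b * nrm x)))).
    rewrite ler_wpM2l //; apply: le_trans (nY _) _; rewrite ler_wpM2l //; exact: nB.
  have := mulr_ge0 Mt0 (nrm_ge0 x); lra.
move=> t s t0 us hs.
have Ks (P : pred nat) i : nk i -> P i -> (L i)^-1 <= K by move=> /LK.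
have ts i : nk i -> i \notin s -> (L i)^-1 <= t.
  by move=> ni; apply: contraR; rewrite -ltNge; exact: hs.
have [bA1 cA1 nA1] := dP a (mem s) K a0 (ltW K0) (Ks _).
have [bA2 cA2 nA2] := dP a (fun i => i \notin s) t a0 (ltW t0) ts.
have [bB1 cB1 nB1] := dP b (mem s) K b0 (ltW K0) (Ks _).
have [bB2 cB2 nB2] := dP b (fun i => i \notin s) t b0 (ltW t0) ts.
set A1 := diag_op e _ in bA1 cA1 nA1; set A2 := diag_op e _ in bA2 cA2 nA2.
set B1 := diag_op e _ in bB1 cB1 nB1; set B2 := diag_op e _ in bB2 cB2 nB2.
have AE x : A x = A1 x + A2 x.
  apply: (coord_inj tot) => i; rewrite innerDl cA cA1 cA2 -mulrDl -rmorphD /=.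
  by rewrite /mask /= -mulrDl; case: (nk i) (i \in s) => [] [] /=; rewrite ?addr0 ?add0r.
have BE x : B x = B1 x + B2 x.
  apply: (coord_inj tot) => i; rewrite innerDl cB cB1 cB2 -mulrDl -rmorphD /=.
  by rewrite /mask /= -mulrDl; case: (nk i) (i \in s) => [] [] /=; rewrite ?addr0 ?add0r.
exists ([seq (fun x => '[B1 x, e i]) | i <- s] ++ [seq (fun x => '[A1 (Y (B2 x)), e i]) | i <- s]).
exists (K `^ a * (M * opnorm T) + 1); split.
- by rewrite size_cat !size_map mul2n addnn.
- apply/all_bounded_cat; split; apply: all_bounded_map => i.
    exact: bounded_functional_inner.
  exact: (bounded_functional_inner _ (bounded_op_comp bA1 (bounded_op_comp bY bB2))).
- by rewrite addr_ge0 ?mulr_ge0.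
move=> x; rewrite big_cat !big_map /=.
have n1 : nrm (B1 x) <= \sum_(i <- s) normc '[B1 x, e i].
  by apply: nrm_le_sum_coord => // i /negbTE si; rewrite cB1 /mask /= si andbF mul0r mul0r.
have n2 : nrm (A1 (Y (B2 x))) <= \sum_(i <- s) normc '[A1 (Y (B2 x)), e i].
  by apply: nrm_le_sum_coord => // i /negbTE si; rewrite cA1 /mask /= si andbF mul0r mul0r.
have E : A (Y (B x)) = A (Y (B1 x)) + A1 (Y (B2 x)) + A2 (Y (B2 x)).
  by rewrite BE (bopD bY) (bopD bA) -addrA -AE.
rewrite E; apply: le_trans (nrmD _ _) _; apply: le_trans (lerD (nrmD _ _) (lexx _)) _.
have e1 : nrm (A (Y (B1 x))) <= K `^ a * (M * opnorm T) * nrm (B1 x).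
  by apply: le_trans (nA _) _; rewrite -mulrA ler_wpM2l.
have e3 : nrm (A2 (Y (B2 x))) <= M * opnorm T * t `^ (a + b) * nrm x.
  apply: le_trans (nA2 _) _.
  rewrite powRD; last by rewrite (gt_eqF t0) implybT.
  have -> : M * opnorm T * (t `^ a * t `^ b) * nrm x = t `^ a * (M * opnorm T * (t `^ b * nrm x)) by ring.
  by rewrite ler_wpM2l ?powR_ge0 //; apply: le_trans (nY _) _; rewrite ler_wpM2l.
set p := \sum_(i <- s) _ in n1; set q := \sum_(i <- s) _ in n2.
have KM0 : 0 <= K `^ a * (M * opnorm T) by rewrite mulr_ge0.
have f1 : K `^ a * (M * opnorm T) * nrm (B1 x) <= K `^ a * (M * opnorm T) * p by rewrite ler_wpM2l.
have p0 : 0 <= p by apply: le_trans n1; exact: nrm_ge0.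
have q0 : 0 <= q by apply: le_trans n2; exact: nrm_ge0.
have f2 := mulr_ge0 KM0 q0.
have f3 : 0 <= K `^ a * M * K `^ b * opnorm T * t `^ (a + b) * nrm x.
  by rewrite !mulr_ge0 ?powR_ge0 ?nrm_ge0.
rewrite !mulrDl mulrDr -/p -/q.
move: (nrm (A _)) (nrm (A1 _)) (nrm (A2 _)) e1 e3 n2 => r1 r2 r3 e1 e3 n2.
lra.
Qed.

End SchurMultipliers.

(** * The symbol for eigenvalues of either sign *)

Section QuotientSymbol.
Context {R : realType}.
Variable lam : nat -> R.

(** It is set to 0 on the diagonal, where the entries of the commutator vanish, and on the kernel,
    where the two terms with the kernel projection give the entries of the formula. *)
Definition quotient_symbol (al be ga x y : R) : R :=
  if (x == 0) || (y == 0) || (x == y) then 0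
  else `|x| `^ be * `|y| `^ ga * (`|x| `^ (- al) - `|y| `^ (- al)) / (x - y).

(** The value 1 on the kernel keeps [L] positive; those indices are masked in [weighted_op]. *)
Let L i := if lam i == 0 then 1 else `|lam i|.

Lemma modulus_gt0 i : 0 < L i.
Proof. by rewrite /L; case: eqVneq => // h; rewrite normr_gt0. Qed.

(** For eigenvalues of equal sign the symbol is, up to sign, the difference quotient of their
    moduli; for opposite signs [x - y] is plus or minus [|x| + |y|], and the quotient by the sum
    appears. The four sign blocks are cut out by the bounded functions [p] and [m]. For [al = 0] the
    symbol vanishes identically. *)
Lemma weighted_symbol (al be ga : R) : 0 <= al <= 1 -> be <= 1 -> ga <= 1 ->
  be + ga <= al + 1 -> (be = 1 -> ga < al) -> (ga = 1 -> be < al) ->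
  exists2 phi, weighted L (1 + al - be - ga) phi &
    forall i j, (lam i != 0)%:R * phi i j * (lam j != 0)%:R =
      quotient_symbol al be ga (lam i) (lam j).
Proof.
move=> /andP[al0 al1] be1 ga1 bg hbe hga.
have [alE|alN] := eqVneq al 0.
  exists (fun i j => L i `^ (- (1 + al - be - ga)) * (0 * 1) * L j `^ (- 0)).
    by apply: Weighted; [lra|lra|lra|apply: schurZ; exact: schur1].
  move=> i j; rewrite /quotient_symbol alE mul0r mulr0 mul0r mulr0 mul0r.
  by case: ifP => // _; rewrite oppr0 !powRr0 subrr mulr0 mul0r.
have {alN} {}al0 : 0 < al by rewrite lt_def alN.
have [K1 [w1 e1]] := weighted_difference_quotient modulus_gt0 al0 be1 ga1 bg hbe hga al1.
have w2 := weighted_sum_quotient modulus_gt0 al0 be1 ga1 bg hbe hga.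
set K2 := (fun i j => _ / _) in w2.
pose p i : R := (0 < lam i)%R%:R; pose m i : R := (lam i < 0)%R%:R.
have p1 i : `|p i| <= 1 by rewrite /p; case: (0 < lam i); rewrite ?normr1 ?normr0.
have m1 i : `|m i| <= 1 by rewrite /m; case: (lam i < 0); rewrite ?normr1 ?normr0.
exists (fun i j => (lam i != lam j)%:R * ((p i * K1 i j * p j - m i * K1 i j * m j) +
   (p i * K2 i j * m j - m i * K2 i j * p j))).
  by apply: weighted_neq; apply: WeightedD; apply: weightedB; apply: weightedM => //.
move=> i j; rewrite /quotient_symbol.
have [i0|i0] := eqVneq (lam i) 0; first by rewrite !mul0r.
have [j0|j0] := eqVneq (lam j) 0; first by rewrite mulr0.
have [_|ij] := eqVneq (lam i) (lam j); first by rewrite mul0r mulr0 mul0r.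
have Li : L i = `|lam i| by rewrite /L (negbTE i0).
have Lj : L j = `|lam j| by rewrite /L (negbTE j0).
have := e1 i j; rewrite /K2 Li Lj /= !mul1r mulr1 /p /m.
move: (_ * _ * (_ - _)) => num E1.
have d0 : lam i - lam j != 0 by rewrite subr_eq0.
apply/(mulIf d0); rewrite divfK //.
case: (ltgtP 0 (lam i)) i0 => // hi _; case: (ltgtP 0 (lam j)) j0 => // hj _;
  rewrite /= !(mul0r, mul1r, mulr0, mulr1, subr0, addr0, add0r, sub0r, oppr0).
- by rewrite -E1 !gtr0_norm.
- have -> : `|lam i| + `|lam j| = lam i - lam j by rewrite gtr0_norm // ltr0_norm.
  by rewrite divfK.
- have -> : lam i - lam j = - (`|lam i| + `|lam j|) by rewrite ltr0_norm // gtr0_norm //; ring.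
  rewrite mulrNN divfK // gt_eqF // ltr_wpDr //.
  by rewrite normr_gt0 lt_eqF.
- rewrite -E1 !ltr0_norm //; ring.
Qed.

End QuotientSymbol.

(** * Weak ideals and the counting of eigenvalues *)

Section WeakIdeals.
Context {R : realType} {H : hilbertSpace R}.
Implicit Types X T : H -> H.

Lemma invr_powR (x y : R) : 0 <= x -> x^-1 `^ y = (x `^ y)^-1.
Proof. by move=> x0; rewrite -[x^-1]powR_inv1 // -powRrM mulN1r powRN. Qed.

Lemma weak_quasinorm_bound (r : R) T : (weak_quasinorm r T < +oo)%E ->
  exists2 B : R, 0 <= B & forall j, j.+1%:R `^ r^-1 * singular_value T j <= B.
Proof.
move=> h.
have w j : ((j.+1%:R `^ r^-1 * singular_value T j)%:E <= weak_quasinorm r T)%E.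
  by apply: ereal_sup_ubound; exists j.
have w0 : (0 <= weak_quasinorm r T)%E.
  by apply: le_trans (w 0%N); rewrite lee_fin mulr_ge0 ?powR_ge0 ?singular_value_ge0.
exists (fine (weak_quasinorm r T)); first exact: fine_ge0.
by move=> j; rewrite -lee_fin fineK ?w // ge0_fin_numE.
Qed.

Lemma weak_quasinorm_le (r B : R) T :
  (forall j, j.+1%:R `^ r^-1 * singular_value T j <= B) -> (weak_quasinorm r T <= B%:E)%E.
Proof. by move=> h; apply: ge_ereal_sup => _ [j _ <-]; rewrite lee_fin. Qed.

Lemma finite_enum (P : pred nat) (B : nat) :
  (forall s, uniq s -> all P s -> (size s <= B)%N) ->
  exists s, [/\ uniq s, all P s & forall i, P i -> i \in s].
Proof.
move=> hB; apply: contrapT => h.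
have grow k : exists s, [/\ uniq s, all P s & size s = k].
  elim: k => [|k [s [us Ps sk]]]; first by exists [::].
  have [i [Pi si]] : exists i, P i /\ i \notin s.
    apply: contrapT => h'; apply: h; exists s; split=> // i Pi.
    by apply: contrapT => /negP si; apply: h'; exists i.
  by exists (i :: s); rewrite /= si us Pi Ps sk.
have [s [us Ps sB]] := grow B.+1.
by have := hB s us Ps; rewrite sB ltnn.
Qed.

(** The cutoff [t = Cq (c.+1 / N.+1) ^ p^-1] is the one for which [(Cq / t) ^ p = N.+1 / c.+1]. Then
    [n * c.+1 <= N.+1], and using [c.+1] instead of [c] yields [c * n <= N], as [singular_value_le]
    requires. *)
Lemma fd_small_singular_value X (c : nat) (Cq p de b : R) N : 0 < p -> 0 < Cq -> 0 <= b ->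
  bounded_op X ->
  (forall t, 0 < t -> exists2 n, n%:R <= (Cq / t) `^ p & fd_small X (c * n) (b * t `^ de)) ->
  singular_value X N <= b * (Cq * (c.+1%:R / N.+1%:R) `^ p^-1) `^ de.
Proof.
move=> p0 Cq0 b0 bX hX.
have q0 : 0 < c.+1%:R / N.+1%:R :> R by rewrite divr_gt0 ?ltr0Sn.
have t0 : 0 < Cq * (c.+1%:R / N.+1%:R) `^ p^-1 by rewrite mulr_gt0 ?powR_gt0.
have [n nle fX] := hX _ t0.
apply: (singular_value_le (k := (c * n)%N)) fX bX; first by rewrite mulr_ge0 ?powR_ge0.
have : n%:R <= N.+1%:R / c.+1%:R :> R.
  apply: le_trans nle _; rewrite invfM mulrA divff ?gt_eqF // mul1r.
  rewrite -[(_ `^ p^-1)^-1]powR_inv1 ?powR_ge0 // -!powRrM mulN1r mulrN mulVf ?gt_eqF //.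
  by rewrite powR_inv1 ?(ltW q0) // invf_div.
rewrite ler_pdivlMr ?ltr0Sn // -natrM ler_nat mulnS => h.
case: n {nle} h => [|n]; first by rewrite muln0.
by rewrite mulnC addSn ltnS => h; apply: leq_trans h; rewrite leq_addl.
Qed.

Lemma fd_small_weak_quasinorm X (c : nat) (Cq p de b r : R) : 0 < p -> 0 < Cq -> 0 <= b ->
  0 <= de -> r^-1 <= de / p -> bounded_op X ->
  (forall t, 0 < t -> exists2 n, n%:R <= (Cq / t) `^ p & fd_small X (c * n) (b * t `^ de)) ->
  (weak_quasinorm r X <= (b * (Cq `^ de * c.+1%:R `^ (de / p)))%:E)%E.
Proof.
move=> p0 Cq0 b0 de0 hr bX hX; apply: weak_quasinorm_le => N.
have N1 : 1 <= N.+1%:R :> R by rewrite ler1n.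
have Np : 0 < N.+1%:R :> R by rewrite ltr0Sn.
apply: (@le_trans _ _ (N.+1%:R `^ (de / p) * singular_value X N)).
  by rewrite ler_wpM2r ?singular_value_ge0 // ler_powR.
apply: (@le_trans _ _ (N.+1%:R `^ (de / p) * (b * (Cq * (c.+1%:R / N.+1%:R) `^ p^-1) `^ de))).
  by rewrite ler_wpM2l ?powR_ge0 //; apply: fd_small_singular_value hX.
rewrite powRM ?powR_ge0 ?(ltW Cq0) // -powRrM [p^-1 * de]mulrC powRM ?invr_ge0 ?ler0n //.
have -> : (N.+1%:R^-1 : R) `^ (de / p) = (N.+1%:R `^ (de / p))^-1.
  by apply: invr_powR; rewrite ler0n.
have : N.+1%:R `^ (de / p) != 0 :> R by rewrite gt_eqF // powR_gt0.
by move: (N.+1%:R `^ _) => w w0; rewrite le_eqVlt; apply/orP; left; apply/eqP; field.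
Qed.

Lemma fd_small_compact X (c : nat) (Cq p de b : R) : 0 < de -> 0 <= b -> bounded_op X ->
  (forall t, 0 < t -> exists2 n, n%:R <= (Cq / t) `^ p & fd_small X (c * n) (b * t `^ de)) ->
  compact_op X.
Proof.
move=> de0 b0 bX hX; apply: compact_op_of_fd_small => // eps eps0.
have b1 : 0 < b + 1 by rewrite ltr_wpDl.
have q0 : 0 < eps / (b + 1) by rewrite divr_gt0.
(* For this cutoff [b * t ^ de = b * eps / (b + 1)], which is at most [eps]. *)
have t0 : 0 < (eps / (b + 1)) `^ de^-1 by rewrite powR_gt0.
have [n _ fX] := hX _ t0; exists (c * n)%N; apply: fd_small_le fX.
rewrite -powRrM mulVf ?gt_eqF // powRr1 ?(ltW q0) //.
rewrite mulrA ler_pdivrMr // mulrC ler_wpM2l ?(ltW eps0) //.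
by rewrite lerDl.
Qed.

Variables (e : nat -> H) (d : nat -> bool).
Hypothesis he : forall i j, '[e i, e j] = ((i == j) && d i)%:R.
Variable lam : nat -> R.
Variable D : unbounded_op H.
Hypothesis sD : selfadjoint D.
Hypothesis hD : forall i, udom D (e i) /\ D (e i) = (lam i)%:C%C *: e i.
Hypothesis hd : forall i, ~~ d i -> lam i = 0.

(** The basis vectors indexed by [s] are eigenvectors of [T] with [|lam i|^-1 > t]. If there are
    [N + 1] of them, then [t <= singular_value T N], and the weak bound on singular values limits
    [N + 1]. *)
Lemma eigenvalue_count p T : is_partial_inverse D T -> 0 < p -> weak_ideal p T ->
  exists2 Cq : R, 0 < Cq & forall t (s : seq nat), 0 < t -> uniq s ->
    (forall i, i \in s -> lam i != 0 /\ t < `|lam i|^-1) -> (size s)%:R <= (Cq / t) `^ p.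
Proof.
move=> pT p0 [[bT _] /weak_quasinorm_bound[B B0 hB]].
exists (B + 1) => [|t s t0 us hs]; first by rewrite ltr_wpDl.
have Te i : T (e i) = (lam i)^-1%:C%C *: e i by have [? ?] := hD i; exact: (eigen_partial_inverse sD pT).
case sN : (size s) => [|N]; first exact: powR_ge0.
have tN : t <= singular_value T N.
  apply: (singular_value_ge (S := T) (v := fun i : 'I_N.+1 => e (nth 0%N s i))
    (l := fun i => `|lam (nth 0%N s i)|^-1)) => //; first exact: ltW.
  - exact: (partial_inverse_sym sD pT).
  - move=> i k; have [|l0 _] := hs (nth 0%N s i); first by rewrite mem_nth ?sN.
    have di : d (nth 0%N s i) by apply/negPn/negP => /hd E; rewrite E eqxx in l0.
    by rewrite he di andbT nth_uniq ?sN.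
  - move=> i; have [|l0 lt] := hs (nth 0%N s i); first by rewrite mem_nth ?sN.
    split; first exact: ltW.
    by rewrite Te (bopZ bT) Te scalerA -rmorphM /= exprVn real_normK ?num_real // -expr2 -exprVn.
have h := hB N.
have {}h : N.+1%:R `^ p^-1 <= (B + 1) / t.
  rewrite ler_pdivlMr //; apply: (@le_trans _ _ B); last by rewrite lerDl.
  by apply: le_trans h; rewrite ler_wpM2l ?powR_ge0.
have -> : N.+1%:R = (N.+1%:R `^ p^-1) `^ p :> R by rewrite -powRrM mulVf ?gt_eqF // powRr1.
by apply: ge0_ler_powR => //; rewrite ?nnegrE ?powR_ge0 ?divr_ge0 ?addr_ge0 // ltW.
Qed.

Lemma eigenvalue_enum p T : is_partial_inverse D T -> 0 < p -> weak_ideal p T ->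
  exists2 Cq : R, 0 < Cq & forall t, 0 < t -> exists s : seq nat,
    [/\ uniq s, (size s)%:R <= (Cq / t) `^ p &
        forall i, lam i != 0 -> t < `|lam i|^-1 -> i \in s].
Proof.
move=> pT p0 wT; have [Cq Cq0 hC] := eigenvalue_count pT p0 wT; exists Cq => // t t0.
pose P i := (lam i != 0) && (t < `|lam i|^-1).
have cnt s : uniq s -> all P s -> (size s)%:R <= (Cq / t) `^ p.
  by move=> us /allP Ps; apply: hC => // i /Ps /andP[].
have [s us Ps|s [us Ps cs]] := @finite_enum P (Num.truncn ((Cq / t) `^ p)).
  by rewrite truncn_ge_nat ?powR_ge0 //; exact: cnt.
exists s; split=> //; first exact: cnt.
by move=> i i0 it; apply: cs; rewrite /P i0.
Qed.

End WeakIdeals.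

(** * The commutator formula *)

Section CommutatorFormula.
Context {R : realType} {H : hilbertSpace R}.
Local Notation C := R[i].
Variables (e : nat -> H) (d : nat -> bool).
Hypothesis he : forall i j, '[e i, e j] = ((i == j) && d i)%:R.
Hypothesis tot : forall x, (forall i, '[x, e i] = 0) -> x = 0.

Definition entrywise (phi : nat -> nat -> R) (T X : H -> H) :=
  forall n m, '[X (e n), e m] = (phi m n)%:C%C * '[T (e n), e m].

(** The map is selected from the basis and the symbol alone, hence is independent of [p] and of the
    algebra. *)
Definition multiplier (phi : nat -> nat -> R) (T : H -> H) : H -> H :=
  xget 0 [set X | bounded_op X /\ entrywise phi T X].

Lemma multiplier_eq phi T X : bounded_op X -> entrywise phi T X -> multiplier phi T = X.
Proof.
move=> bX eX.
have [|bY eY] := @xgetPex _ 0 [set X | bounded_op X /\ entrywise phi T X]; first by exists X.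
by apply: (op_basis_inj he tot) => // n m; rewrite eY eX.
Qed.

Variable lam : nat -> R.
Variable D : unbounded_op H.
Hypothesis sD : selfadjoint D.
Hypothesis hD : forall i, udom D (e i) /\ D (e i) = (lam i)%:C%C *: e i.
Hypothesis hd : forall i, ~~ d i -> lam i = 0.
Variable K : R.
Hypothesis K0 : 0 < K.
Hypothesis hK : forall i, lam i != 0 -> `|lam i|^-1 <= K.

Lemma commutator_entry a B n m : is_commutator D a B -> udom D (a (e n)) -> bounded_op a ->
  '[B (e n), e m] = (lam m - lam n)%:C%C * '[a (e n), e m].
Proof.
move=> [_ hB] dan ba; have [den Den] := hD n; rewrite hB // innerBl (coord_uop sD hD) //.
by rewrite Den (bopZ ba) innerZl rmorphB mulrBl.
Qed.

Lemma sign_op_bounded : bounded_op (sign_op D).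
Proof.
have sb i : d i -> `|lam i * abs_powN 1 (lam i)| <= 1.
  rewrite /abs_powN; case: eqVneq => [->|l0] _; first by rewrite mul0r normr0.
  by rewrite powR_inv1 // normrM normfV normr_id divff // normr_eq0.
have [bS cS _] := diag_opP he tot ler01 sb.
suff -> : sign_op D = diag_op e (fun i => lam i * abs_powN 1 (lam i)) by [].
by apply/funext => x; apply: (coord_inj tot) => i; rewrite (sign_op_coord he tot sD hD K0 hK) cS.
Qed.

Lemma kernel_proj_bounded : bounded_op (kernel_proj D).
Proof.
have sb i : d i -> `|(lam i == 0)%:R : R| <= 1.
  by case: (lam i == 0); rewrite ?normr1 ?normr0.
have [bS cS _] := diag_opP he tot ler01 sb.
suff -> : kernel_proj D = diag_op e (fun i => (lam i == 0)%:R) by [].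
by apply/funext => x; apply: (coord_inj tot) => i; rewrite (kernel_proj_coord he tot sD hD) cS.
Qed.

Lemma coord_diag_basis (X : H -> H) (f : nat -> R) n :
  (forall x i, '[X x, e i] = (f i)%:C%C * '[x, e i]) -> X (e n) = (f n)%:C%C *: e n.
Proof.
move=> cX; apply: (coord_inj tot) => i; rewrite cX innerZl he.
by case: eqVneq => [->|_] //; rewrite !mulr0.
Qed.

(** This is the commutator formula at one matrix entry, with [x = lam m], [y = lam n] and the entry
    of [a] removed. When exactly one eigenvalue is 0, the matching kernel term gives it through
    [|z|^-(al+1) z |z|^-1 z = |z|^-al]; when neither is, it is the definition of the symbol. *)
Lemma symbol_identity (al be ga x y : R) :
  abs_powN al x - abs_powN al y =
  abs_powN be x * (quotient_symbol al be ga x y * (x - y) * abs_powN ga y) +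
  abs_powN (al + 1) x * (x * abs_powN 1 x * ((x - y) * (y == 0)%:R)) +
  (x == 0)%:R * ((x - y) * (y * abs_powN 1 y * abs_powN (al + 1) y)).
Proof.
have sq (z : R) : z != 0 ->
    `|z| `^ (- (al + 1)) * (z * `|z| `^ (- 1) * z) = `|z| `^ (- al).
  move=> z0; have nz : 0 < `|z| by rewrite normr_gt0.
  rewrite opprD powRD; last by rewrite (gt_eqF nz) implybT.
  rewrite powR_inv1 ?normr_ge0 //.
  have -> : `|z| `^ (- al) * `|z|^-1 * (z * `|z|^-1 * z) = `|z| `^ (- al) * (z ^+ 2 / `|z| ^+ 2).
    by field; rewrite gt_eqF.
  by rewrite real_normK ?num_real // divff ?mulr1 // sqrf_eq0.
rewrite /abs_powN /quotient_symbol.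
have [x0|x0] := eqVneq x 0; have [y0|y0] := eqVneq y 0; rewrite /=.
- by rewrite !(mul0r, mulr0) subr0 !addr0.
- by rewrite !(mul0r, mulr0, mul1r) x0 !add0r -(sq y y0); ring.
- by rewrite !(mul0r, mulr0, mulr1) y0 !(subr0, addr0, add0r) -(sq x x0); ring.
rewrite !(mul0r, mulr0) !addr0.
have [->|xy] := eqVneq x y; first by rewrite !subrr !(mul0r, mulr0).
rewrite divfK ?subr_eq0 // !powRN.
have px : `|x| `^ be != 0 by rewrite gt_eqF // powR_gt0 ?normr_gt0.
have py : `|y| `^ ga != 0 by rewrite gt_eqF // powR_gt0 ?normr_gt0.
have qx : `|x| `^ al != 0 by rewrite gt_eqF // powR_gt0 ?normr_gt0.
have qy : `|y| `^ al != 0 by rewrite gt_eqF // powR_gt0 ?normr_gt0.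
by field; rewrite px py qx qy.
Qed.

Variables (al be ga : R).
Hypothesis al01 : 0 <= al <= 1.
Hypothesis be0 : 0 <= be.
Hypothesis be1 : be <= 1.
Hypothesis ga0 : 0 <= ga.
Hypothesis ga1 : ga <= 1.
Hypothesis bg : be + ga <= al + 1.
Hypothesis hbe : be = 1 -> ga < al.
Hypothesis hga : ga = 1 -> be < al.

Let de := 1 + al - be - ga.
Let phi m n := quotient_symbol al be ga (lam m) (lam n).
Let Phi := multiplier phi.

Lemma symbol_multiplier : exists (c : nat) (M : R), 0 <= M /\ forall T, bounded_op T ->
  [/\ bounded_op (Phi T), entrywise phi T (Phi T),
    forall x, nrm (Phi T x) <= M * opnorm T * nrm x &
    forall t (s : seq nat), 0 < t -> uniq s ->
      (forall i, lam i != 0 -> t < `|lam i|^-1 -> i \in s) ->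
      fd_small (Phi T) (c * size s) (M * opnorm T * t `^ de)].
Proof.
have [psi wpsi epsi] := weighted_symbol lam al01 be1 ga1 bg hbe hga.
have LK i : lam i != 0 -> (if lam i == 0 then 1 else `|lam i|)^-1 <= K.
  by move=> l0; rewrite (negbTE l0); exact: hK.
have [c [M [M0 hM]]] := weighted_op he tot (modulus_gt0 lam) K0 LK wpsi.
exists c, M; split=> // T bT; have [X [bX eX nX fX]] := hM T bT.
have eX' : entrywise phi T X by move=> n m; rewrite eX epsi.
rewrite /Phi (multiplier_eq bX eX'); split=> // t s t0 us hs; apply: fX => // i l0.
by rewrite (negbTE l0); exact: hs.
Qed.

Lemma symbol_multiplier_linear : linear_on_bounded Phi.
Proof.
move=> c S T bS bT; have [k [M [_ hM]]] := symbol_multiplier.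
have [bX eX _ _] := hM S bS; have [bY eY _ _] := hM T bT.
apply: multiplier_eq; first exact: bounded_op_lin.
move=> n m; rewrite -[(c *: Phi S + Phi T) _]/(c *: Phi S (e n) + Phi T (e n)).
rewrite -[(c *: S + T) _]/(c *: S (e n) + T (e n)) !innerDl !innerZl eX eY.
by rewrite mulrDr mulrCA.
Qed.

Lemma symbol_multiplier_bounded : bounded_linear_map Phi.
Proof.
have [k [M [M0 hM]]] := symbol_multiplier; split.
- by move=> T bT; have [] := hM T bT.
- exact: symbol_multiplier_linear.
exists M => T bT; have [bX _ nX _] := hM T bT.
by apply: opnorm_le => //; rewrite mulr_ge0 ?opnorm_ge0.
Qed.

(** All factors other than [a], [B] and [Phi B] are diagonal in the basis, and the entries of these
    three are multiples of those of [a], so [symbol_identity] remains. *)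
Lemma commutator_identity a B : bounded_op a -> (forall x, udom D x -> udom D (a x)) ->
  is_commutator D a B ->
  (abs_op_powN D al \o a) - (a \o abs_op_powN D al) =
    (abs_op_powN D be \o Phi B \o abs_op_powN D ga)
    + (abs_op_powN D (al + 1) \o sign_op D \o B \o kernel_proj D)
    + (kernel_proj D \o B \o sign_op D \o abs_op_powN D (al + 1)).
Proof.
move=> ba da hB; have bB := hB.1; have [k [M [_ hM]]] := symbol_multiplier.
have [bX eX _ _] := hM B bB.
have [al0 _] := andP al01; have al10 : 0 <= al + 1 by rewrite addr_ge0.
have [bpa cpa _] := abs_op_powNP he tot sD hD K0 hK al0.
have [bpb cpb _] := abs_op_powNP he tot sD hD K0 hK be0.
have [bpg cpg _] := abs_op_powNP he tot sD hD K0 hK ga0.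
have [bp1 cp1 _] := abs_op_powNP he tot sD hD K0 hK al10.
have bs := sign_op_bounded; have cs := sign_op_coord he tot sD hD K0 hK.
have bk := kernel_proj_bounded; have ck := kernel_proj_coord he tot sD hD.
apply: (op_basis_inj he tot).
- by apply: bounded_opB; exact: bounded_op_comp.
- apply: bounded_opD; first apply: bounded_opD.
  + exact: bounded_op_comp (bounded_op_comp bpb bX) bpg.
  + exact: bounded_op_comp (bounded_op_comp (bounded_op_comp bp1 bs) bB) bk.
  exact: bounded_op_comp (bounded_op_comp (bounded_op_comp bk bB) bs) bp1.
move=> n m; rewrite -[LHS]/'[abs_op_powN D al (a (e n)) - a (abs_op_powN D al (e n)), e m].
rewrite -[RHS]/'[abs_op_powN D be (Phi B (abs_op_powN D ga (e n))) +
  abs_op_powN D (al + 1) (sign_op D (B (kernel_proj D (e n)))) +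
  kernel_proj D (B (sign_op D (abs_op_powN D (al + 1) (e n)))), e m].
rewrite innerBl !innerDl cpa cpb cp1 cs ck.
rewrite (coord_diag_basis n cpa) (coord_diag_basis n cpg) (coord_diag_basis n ck).
rewrite (coord_diag_basis n cp1) (bopZ bs) (coord_diag_basis n cs).
rewrite (bopZ ba) (bopZ bX) !(bopZ bB) !innerZl eX.
rewrite (commutator_entry m hB (da _ (hD n).1) ba).
rewrite -mulrBl -rmorphB (symbol_identity al be ga (lam m) (lam n)) /phi.
rewrite !rmorphD !rmorphM /= !mulrDl; ring.
Qed.

Variables (p : R) (T : H -> H).
Hypothesis p0 : 0 < p.
Hypothesis pT : is_partial_inverse D T.
Hypothesis wT : weak_ideal p T.

Lemma symbol_multiplier_rank : exists (c : nat) (M Cq : R), [/\ 0 <= M, 0 < Cq &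
  forall X, bounded_op X -> forall t, 0 < t ->
    exists2 n, n%:R <= (Cq / t) `^ p & fd_small (Phi X) (c * n) (M * opnorm X * t `^ de)].
Proof.
have [c [M [M0 hM]]] := symbol_multiplier.
have [Cq Cq0 hC] := eigenvalue_enum he sD hD hd pT p0 wT.
exists c, M, Cq; split=> // X bX t t0; have [_ _ _ fX] := hM X bX.
by have [s [us ss cs]] := hC t t0; exists (size s) => //; exact: fX.
Qed.

Hypothesis de0 : 0 < de.

Lemma symbol_multiplier_compact X : bounded_op X -> compact_op (Phi X).
Proof.
move=> bX; have [c [M [Cq [M0 Cq0 h]]]] := symbol_multiplier_rank.
apply: fd_small_compact (h X bX) => //; first by rewrite mulr_ge0 ?opnorm_ge0.
by have [+ _ _] := symbol_multiplier_bounded; exact.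
Qed.

(** By linearity only [Phi (S - X)] has to be estimated; the constants [M], [Cq] and [c] are the
    same for all operators, so its quasinorm is at most a fixed multiple of [opnorm (S - X)]. *)
Lemma symbol_multiplier_continuous (r : R) : r^-1 <= de / p ->
  continuous_linear_map_to_weak r Phi.
Proof.
move=> hr; have [c [M [Cq [M0 Cq0 h]]]] := symbol_multiplier_rank.
have [bPhi lPhi _] := symbol_multiplier_bounded.
pose Q := Cq `^ de * c.+1%:R `^ (de / p).
have Q0 : 0 <= Q by rewrite mulr_ge0 ?powR_ge0.
have wq X : bounded_op X -> (weak_quasinorm r (Phi X) <= (M * opnorm X * Q)%:E)%E.
  move=> bX; apply: (fd_small_weak_quasinorm p0 Cq0 _ _ hr (bPhi X bX) (h X bX)).
    by rewrite mulr_ge0 ?opnorm_ge0.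
  exact: ltW.
split=> // [X bX|X bX eps eps0].
  by split; [exact: symbol_multiplier_compact|apply: le_lt_trans (wq X bX) (ltry _)].
have Q1 : 0 < M * Q + 1 by rewrite ltr_wpDl // mulr_ge0.
exists (eps / (M * Q + 1)); first by rewrite divr_gt0.
move=> S bS; rewrite ltr_pdivlMr // => hS.
have -> : Phi S - Phi X = Phi (S - X).
  have -> : S - X = -1 *: X + S by rewrite scaleN1r addrC.
  by rewrite lPhi // scaleN1r addrC.
have bSX := bounded_opB bS bX; have o0 := opnorm_ge0 bSX.
apply: le_lt_trans (wq _ bSX) _; rewrite lte_fin; apply: le_lt_trans hS.
by rewrite mulrDr mulr1 [M * _]mulrC -mulrA lerDl.
Qed.

End CommutatorFormula.

Theorem lemma12 (R : realType) (H : hilbertSpace R) (D : unbounded_op H)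
    (alpha beta gamma : R)
    (halpha : 0 <= alpha <= 1) (hbeta : 0 <= beta <= 1)
    (hgamma : 0 <= gamma <= 1)
    (habc : beta + gamma < alpha + 1 \/
            beta + gamma = alpha + 1 /\ Num.max beta gamma < 1) :
  exists Phi : (H -> H) -> (H -> H),
  forall (p : R) (A : set (H -> H)),
    0 < p -> spectral_triple A D -> p_summable p D ->
    (bounded_linear_map Phi /\
     forall a, A a ->
       (abs_op_powN D alpha \o a) - (a \o abs_op_powN D alpha) =
         (abs_op_powN D beta \o Phi (commutator D a) \o abs_op_powN D gamma)
         + (abs_op_powN D (alpha + 1) \o sign_op D \o commutator D a
              \o kernel_proj D)
         + (kernel_proj D \o commutator D a \o sign_op D
              \o abs_op_powN D (alpha + 1))) /\
    (beta + gamma < alpha + 1 ->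
     [/\ Num.max beta gamma < 1 ->
           continuous_linear_map_to_weak
             ((1 + alpha - beta - gamma)^-1 * p) Phi,
         Num.max beta gamma = 1 ->
           forall r : R, (1 + alpha - beta - gamma)^-1 * p < r ->
             continuous_linear_map_to_weak r Phi &
         forall T, bounded_op T -> compact_op (Phi T)]).
Proof.
have [al0 al1] := andP halpha; have [be0 be1] := andP hbeta; have [ga0 ga1] := andP hgamma.
have bg : beta + gamma <= alpha + 1 by case: habc => [/ltW|[->]].
(* When an exponent equals 1 the second alternative is excluded, and the first becomes a strict
   inequality for the other exponent. *)
have hbe : beta = 1 -> gamma < alpha.
  case: habc => [h E|[_ h] E]; first by rewrite E in h; lra.
  by move: h; rewrite gt_max E ltxx.
have hga : gamma = 1 -> beta < alpha.
  case: habc => [h E|[_ h] E]; first by rewrite E in h; lra.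
  by move: h; rewrite gt_max E ltxx andbF.
(* [Phi] is to be given before [p] and [A]. Any one summable triple over [D] provides an eigenbasis,
   which then serves all the others; if there is none, the claim is vacuous. *)
have [[p1 [A1 [p10 tr1 [T1 pT1 wT1]]]]|none] := pselect (exists p A,
    [/\ 0 < p, spectral_triple A D & p_summable p D]); last first.
  by exists (fun=> 0) => p A p0 tr ps; case: none; exists p, A.
have [sep _ sD _ _] := tr1.
have [e [lam [d [he tot hD hd]]]] := eigenbasis_ex sD pT1 wT1.1 sep.
(* A bound of the partial inverse, evaluated on unit eigenvectors, bounds the inverses of the
   nonzero eigenvalues. *)
have [K K0 hK] : exists2 K, 0 < K & forall i, lam i != 0 -> `|lam i|^-1 <= K.
  have [M M0 hM] := bop_bound wT1.1.1; exists M => // i l0.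
  have di : d i by apply/negPn/negP => /hd E; rewrite E eqxx in l0.
  have n1 : nrm (e i) = 1.
    by apply/eqP; rewrite -(@eqrXn2 _ 2) ?nrm_ge0 // expr1n -Re_inner_nrm he eqxx di.
  have [dei Dei] := hD i; have := hM (e i).
  by rewrite (eigen_partial_inverse sD pT1 dei Dei) nrmZ normc_real n1 !mulr1 normfV.
exists (multiplier e (fun m n => quotient_symbol alpha beta gamma (lam m) (lam n))).
move=> p A p0 [_ [Ab _ _ _ _] _ _ com] [T pT wT]; split.
  split; first exact: (symbol_multiplier_bounded he tot K0 hK).
  move=> a Aa; have [da exB] := com a Aa.
  apply: (commutator_identity he tot sD hD K0 hK) => //; first exact: Ab.
  exact: (@xgetPex _ 0 [set B | is_commutator D a B] exB).
move=> lt; have de0 : 0 < 1 + alpha - beta - gamma by lra.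
split.
- move=> _; apply: (symbol_multiplier_continuous he tot sD hD hd K0 hK halpha
    be1 ga1 bg hbe hga p0 pT wT) => //.
  by rewrite invfM invrK.
- move=> _ r hr; apply: (symbol_multiplier_continuous he tot sD hD hd K0 hK halpha
    be1 ga1 bg hbe hga p0 pT wT) => //.
  have q0 : 0 < (1 + alpha - beta - gamma)^-1 * p by rewrite mulr_gt0 ?invr_gt0.
  have -> : (1 + alpha - beta - gamma) / p = ((1 + alpha - beta - gamma)^-1 * p)^-1.
    by rewrite invfM invrK.
  by rewrite lef_pV2 ?posrE ?(lt_trans q0 hr) // ltW.
move=> X bX; exact: (symbol_multiplier_compact he tot sD hD hd K0 hK halpha
  be1 ga1 bg hbe hga p0 pT wT de0).
Qed.
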